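(* Let $p_0,u_0,\rho_0>0$ be constants with $M_0>1$ and let $\theta_W\in(0,\pi/2)$. Consider Problem B (uniform supersonic flow $(p_0,u_0,0,\rho_0)$ given on $\Sigma_0$, against a ramp of angle $\theta_W$), and transonic shock solutions for which the flow behind the shock-front satisfies $u>0$. (a) Let $\tan\theta_W\in(0,w_*]$. If a transonic shock solution satisfies $$p\to p_{strong}\quad\text{as }(x,y)\to\infty\text{ (in }\mathcal D^+\cup\mathcal S)$$ and, at the vertex $O$ (values taken from behind the shock-front), $w=\tan\theta_W$ and $p=p_{strong}$, then it is the strong transonic shock solution $U_s$. (b) Let $\tan\theta_W\in(w_{sonic},w_* )$. If a transonic shock solution satisfies $$p\to p_{weak}\quad\text{as }(x,y)\to\infty\text{ (in }\mathcal D^+\cup\mathcal S)$$ and, at the vertex $O$ (values taken from behind the shock-front), $w=\tan\theta_W$ and $p=p_{weak}$, then it is the weak transonic shock solution $U_w$.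
   Context: Fix $\gamma>1$. The steady full compressible Euler system for $(p,u,v,\rho)$ (pressure, velocity components, density; $p,\rho>0$) is $$\partial_x(\rho u)+\partial_y(\rho v)=0,\quad \partial_x(\rho u^2+p)+\partial_y(\rho uv)=0,\quad \partial_x(\rho uv)+\partial_y(\rho v^2+p)=0,\quad \tfrac12(u^2+v^2)+\tfrac{c^2}{\gamma-1}=b_0,$$ where $c=\sqrt{\gamma p/\rho}$ is the sonic speed and $b_0=\tfrac12u_0^2+\frac{\gamma p_0}{(\gamma-1)\rho_0}$ (the same on both sides of the shock-front). The Mach number is $M=\sqrt{u^2+v^2}/c$; the flow is supersonic if $M>1$, subsonic if $M<1$. Write $w=v/u$, $c_0=\sqrt{\gamma p_0/\rho_0}$, $M_0=u_0/c_0$. Problem B: $\mathcal D=\{(x,y):x>0,\ y>x\tan\theta_W\}$, $\Sigma_0=\{x=0,\ y\ge0\}$, $\Gamma=\{x>0,\ y=x\tan\theta_W\}$, $O=(0,0)$. Data: $(p,u,v,\rho)=(p_0,u_0,0,\rho_0)$ on $\Sigma_0$ and slip condition $w=\tan\theta_W$ on $\Gamma$. Transonic shock solution of Problem B: a function $f\in C^2((0,\infty))\cap C([0,\infty))$ with $f(0)=0$ and $0<f(y)<y\cot\theta_W$ for $y>0$; shock-front $\mathcal S=\{(f(y),y):y>0\}$ issuing from $O$; $\mathcal D^-=\{(x,y)\in\mathcal D:x<f(y)\}$, $\mathcal D^+=\{(x,y)\in\mathcal D:x>f(y)\}$; and functions $p,u,v,\rho\in L^\infty_{loc}$ which on each of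 $\mathcal D^-$, $\mathcal D^+$ are continuous up to the boundary (one-sided values on $\mathcal S$ and at $O$) and $C^1$ locally up to the boundary away from $O$, such that: the flow is supersonic in $\mathcal D^-$ and subsonic in $\mathcal D^+$ (including boundary values); the Euler system holds pointwise in $\mathcal D^-\cup\mathcal D^+$; the data on $\Sigma_0$ and $\Gamma$ are attained pointwise; and across $\mathcal S$ $$[\rho u]-f'(y)[\rho v]=0,\quad [\rho u^2+p]-f'(y)[\rho uv]=0,\quad [\rho uv]-f'(y)[\rho v^2+p]=0,\qquad [p]>0,$$ where $[q]$ is the value of $q$ on $\mathcal S$ from $\mathcal D^+$ minus that from $\mathcal D^-$. ''Behind the shock-front'' means in $\mathcal D^+$, including boundary values. Shock polar: for $p_0\le p\le p^+:=p_0\big(1+\frac{2\gamma}{\gamma+1}(M_0^2-1)\big)$ let $$h(p)=\frac{\frac p{p_0}-1}{\gamma M_0^2-(\frac p{p_0}-1)}\sqrt{\frac{\frac{2\gamma}{\gamma+1}(M_0^2-1)-(\frac p{p_0}-1)}{\frac p{p_0}+\frac{\gamma-1}{\gamma+1}}}.$$ The possible values of $(w,p)$ behind a shock with upstream state $(p_0,u_0,0,\rho_0)$ satisfy $w=\pm h(p)$. The function $h$ attains its maximum $w_*=h(p_* )$ at a unique $p_*\in(p_0,p^+)$, is strictly increasing on $[p_0,p_*]$ and strictly decreasing on $[p_*,p^+]$. There is a unique $p_{sonic}\in(p_0,p_* )$ for which the state behind the shock is exactly sonic ($M=1$), the state behind being subsonic exactly when $p>p_{sonic}$; $w_{sonic}=h(p_{sonic})$.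 For $\tan\theta_W\in(0,w_*]$, $p_{strong}$ is the unique $p\in[p_*,p^+)$ with $h(p)=\tan\theta_W$. For $\tan\theta_W\in(w_{sonic},w_* )$, $p_{weak}$ is the unique $p\in(p_{sonic},p_* )$ with $h(p)=\tan\theta_W$. Special solutions $U_s$ and $U_w$: put $\bar p=p_{strong}$ for $U_s$ and $\bar p=p_{weak}$ for $U_w$. The shock-front is the ray $x=y\cot\alpha$, $y>0$; the state is $(p_0,u_0,0,\rho_0)$ in $\mathcal D^-$, and in $\mathcal D^+$ it is the constant state with $p=\bar p$, $w=\tan\theta_W$, $v=uw$, where $$u=u_0-\frac{\bar p-p_0}{\rho_0u_0},\quad \rho=\rho_0\frac{(\gamma+1)\bar p+(\gamma-1)p_0}{(\gamma-1)\bar p+(\gamma+1)p_0},\quad \sin\alpha=\frac1{M_0}\sqrt{\frac{\gamma+1}{2\gamma}\Big(\frac{\bar p}{p_0}+\frac{\gamma-1}{\gamma+1}\Big)},\ \ \alpha\in(0,\pi/2).$$ *)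

(* Defs.v *)
From Stdlib Require Import Reals.
From Coquelicot Require Import Coquelicot.
Open Scope R_scope.

(** * Gas states *)

Record state : Type := mkState { pres : R; velx : R; vely : R; dens : R }.

(** The quantity [w = v / u]. *)
Definition slope (U : state) : R := vely U / velx U.

Definition sonic_speed (gamma : R) (U : state) : R :=
  sqrt (gamma * pres U / dens U).

Definition mach (gamma : R) (U : state) : R :=
  sqrt (velx U ^ 2 + vely U ^ 2) / sonic_speed gamma U.

Definition supersonic (gamma : R) (U : state) : Prop := mach gamma U > 1.
Definition subsonic (gamma : R) (U : state) : Prop := mach gamma U < 1.

Definition mach0 (gamma p0 u0 rho0 : R) : R := u0 / sqrt (gamma * p0 / rho0).

Definition bernoulli0 (gamma p0 u0 rho0 : R) : R :=
  u0 ^ 2 / 2 + gamma * p0 / ((gamma - 1) * rho0).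

(** * The Euler system *)

Definition dx (q : R * R -> R) (x y : R) : R := Derive (fun t => q (t, y)) x.
Definition dy (q : R * R -> R) (x y : R) : R := Derive (fun t => q (x, t)) y.

Definition euler_at (gamma b0 : R) (U : R * R -> state) (x y : R) : Prop :=
  dx (fun z => dens (U z) * velx (U z)) x y
    + dy (fun z => dens (U z) * vely (U z)) x y = 0 /\
  dx (fun z => dens (U z) * velx (U z) ^ 2 + pres (U z)) x y
    + dy (fun z => dens (U z) * velx (U z) * vely (U z)) x y = 0 /\
  dx (fun z => dens (U z) * velx (U z) * vely (U z)) x y
    + dy (fun z => dens (U z) * vely (U z) ^ 2 + pres (U z)) x y = 0 /\
  (velx (U (x, y)) ^ 2 + vely (U (x, y)) ^ 2) / 2
    + sonic_speed gamma (U (x, y)) ^ 2 / (gamma - 1) = b0.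

(** [Um] and [Up] are the states ahead of and behind the front [x = f y];
    [df] is [f' y]. *)
Definition rankine_hugoniot (df : R) (Um Up : state) : Prop :=
  (dens Up * velx Up - dens Um * velx Um)
    - df * (dens Up * vely Up - dens Um * vely Um) = 0 /\
  ((dens Up * velx Up ^ 2 + pres Up) - (dens Um * velx Um ^ 2 + pres Um))
    - df * (dens Up * velx Up * vely Up - dens Um * velx Um * vely Um) = 0 /\
  (dens Up * velx Up * vely Up - dens Um * velx Um * vely Um)
    - df * ((dens Up * vely Up ^ 2 + pres Up)
            - (dens Um * vely Um ^ 2 + pres Um)) = 0.

(** * Geometry *)

Definition cot (a : R) : R := cos a / sin a.

Definition domain (theta : R) (z : R * R) : Prop :=
  0 < fst z /\ snd z > fst z * tan theta.

Definition Dminus (theta : R) (f : R -> R) (z : R * R) : Prop :=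
  domain theta z /\ fst z < f (snd z).

Definition Dplus (theta : R) (f : R -> R) (z : R * R) : Prop :=
  domain theta z /\ fst z > f (snd z).

Definition front (f : R -> R) (z : R * R) : Prop :=
  0 < snd z /\ fst z = f (snd z).

Definition closure (A : R * R -> Prop) (z : R * R) : Prop :=
  forall P : R * R -> Prop, locally z P -> exists z', P z' /\ A z'.

(** * Regularity *)

(** Continuity up to the boundary of [A] for a function given on [closure A],
    and [C^1] regularity locally up to the boundary away from the origin: the
    first derivatives in [A] extend continuously to [closure A] minus the
    origin. *)
Definition regular_up_to_boundary (A : R * R -> Prop) (q : R * R -> R) : Prop :=
  continuous_on (closure A) q /\
  exists qx qy : R * R -> R,
    continuous_on (fun z => closure A z /\ z <> (0, 0)) qx /\
    continuous_on (fun z => closure A z /\ z <> (0, 0)) qy /\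
    forall x y : R, A (x, y) ->
      is_derive (fun t => q (t, y)) x (qx (x, y)) /\
      is_derive (fun t => q (x, t)) y (qy (x, y)).

Definition regular_flow (A : R * R -> Prop) (U : R * R -> state) : Prop :=
  regular_up_to_boundary A (fun z => pres (U z)) /\
  regular_up_to_boundary A (fun z => velx (U z)) /\
  regular_up_to_boundary A (fun z => vely (U z)) /\
  regular_up_to_boundary A (fun z => dens (U z)).

Definition regular_front (f : R -> R) : Prop :=
  continuous_on (fun y => 0 <= y) f /\
  forall y : R, 0 < y ->
    ex_derive_n f 1 y /\ ex_derive_n f 2 y /\ continuous (Derive_n f 2) y.

(** * Transonic shock solutions *)

(** A flow that may jump across the front is given by two fields: [Um] on
    [closure Dminus] and [Up] on [closure Dplus].  Their values at the points of
    the front and at the origin are the one-sided values from [Dminus] and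
    [Dplus]; values outside these closed sets are irrelevant.  Local boundedness
    follows from continuity on the closed sets. *)
Record transonic_shock_solution (gamma p0 u0 rho0 theta : R)
    (f : R -> R) (Um Up : R * R -> state) : Prop := {
  front_regular : regular_front f;
  front_origin : f 0 = 0;
  front_between : forall y : R, 0 < y -> 0 < f y < y * cot theta;
  ahead_regular : regular_flow (Dminus theta f) Um;
  behind_regular : regular_flow (Dplus theta f) Up;
  ahead_positive : forall z, closure (Dminus theta f) z ->
    0 < pres (Um z) /\ 0 < dens (Um z);
  behind_positive : forall z, closure (Dplus theta f) z ->
    0 < pres (Up z) /\ 0 < dens (Up z);
  ahead_supersonic : forall z, closure (Dminus theta f) z ->
    supersonic gamma (Um z);
  behind_subsonic : forall z, closure (Dplus theta f) z ->
    subsonic gamma (Up z);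
  ahead_euler : forall x y : R, Dminus theta f (x, y) ->
    euler_at gamma (bernoulli0 gamma p0 u0 rho0) Um x y;
  behind_euler : forall x y : R, Dplus theta f (x, y) ->
    euler_at gamma (bernoulli0 gamma p0 u0 rho0) Up x y;
  entry_data : forall y : R, 0 <= y -> Um (0, y) = mkState p0 u0 0 rho0;
  slip_condition : forall x : R, 0 < x ->
    slope (Up (x, x * tan theta)) = tan theta;
  jump_conditions : forall y : R, 0 < y ->
    rankine_hugoniot (Derive f y) (Um (f y, y)) (Up (f y, y));
  pressure_jump : forall y : R, 0 < y ->
    pres (Up (f y, y)) - pres (Um (f y, y)) > 0
}.

(** [p -> l] as [(x, y) -> infinity] in the union of [Dplus] and the front. *)
Definition pressure_at_infinity (theta : R) (f : R -> R) (Up : R * R -> state)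
    (l : R) : Prop :=
  forall eps : R, 0 < eps ->
  exists K : R, forall x y : R,
    Dplus theta f (x, y) \/ front f (x, y) ->
    K < sqrt (x ^ 2 + y ^ 2) ->
    Rabs (pres (Up (x, y)) - l) < eps.

(** * The shock polar *)

Section ShockPolar.

Variables gamma p0 u0 rho0 : R.

Let M0 := mach0 gamma p0 u0 rho0.

Definition p_plus : R := p0 * (1 + 2 * gamma / (gamma + 1) * (M0 ^ 2 - 1)).

Definition polar (p : R) : R :=
  (p / p0 - 1) / (gamma * M0 ^ 2 - (p / p0 - 1))
  * sqrt ((2 * gamma / (gamma + 1) * (M0 ^ 2 - 1) - (p / p0 - 1))
          / (p / p0 + (gamma - 1) / (gamma + 1))).

(** The state behind a shock with pressure [p] and flow slope [w]. *)
Definition state_behind (w p : R) : state :=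
  let u := u0 - (p - p0) / (rho0 * u0) in
  mkState p u (u * w)
    (rho0 * (((gamma + 1) * p + (gamma - 1) * p0)
             / ((gamma - 1) * p + (gamma + 1) * p0))).

Definition is_p_star (p : R) : Prop :=
  p0 < p < p_plus /\ forall q : R, p0 <= q <= p_plus -> polar q <= polar p.

Definition is_p_sonic (p_star p : R) : Prop :=
  p0 < p < p_star /\ mach gamma (state_behind (polar p) p) = 1.

Definition is_p_strong (p_star theta p : R) : Prop :=
  p_star <= p < p_plus /\ polar p = tan theta.

Definition is_p_weak (p_sonic p_star theta p : R) : Prop :=
  p_sonic < p < p_star /\ polar p = tan theta.

(** The solution [(f, Um, Up)] is the piecewise constant one with a straight
    front and pressure [pbar] behind it. *)
Definition is_special_solution (theta pbar : R)
    (f : R -> R) (Um Up : R * R -> state) : Prop :=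
  exists alpha : R,
    0 < alpha < PI / 2 /\
    sin alpha = 1 / M0 * sqrt ((gamma + 1) / (2 * gamma)
                               * (pbar / p0 + (gamma - 1) / (gamma + 1))) /\
    (forall y : R, 0 < y -> f y = y * cot alpha) /\
    (forall z, closure (Dminus theta f) z -> Um z = mkState p0 u0 0 rho0) /\
    (forall z, closure (Dplus theta f) z ->
       Up z = state_behind (tan theta) pbar).

End ShockPolar.

(* Main.v *)
From Stdlib Require Import Reals Lra Psatz Classical ClassicalEpsilon.
From Coquelicot Require Import Coquelicot.
Require Import Defs.
Open Scope R_scope.

(** Both parts are instances of [transonic_shock_unique], in which the pressure
    [pbar] prescribed at the vertex and at infinity is any value strictly between
    [p0] and the normal shock pressure [p_plus].  The argument
    does not look at the slope of the polar and treats both branches alike.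

    Ahead of the front the flow is supersonic and uniform on the entry line, and
    it stays uniform ([ahead_uniform]).  Entropy and the two Riemann invariants
    [atan (v / u) -+ nu], with [nu] the Prandtl-Meyer angle, are constant along
    streamlines and Mach lines.  The jump conditions with [[p] > 0] make the normal
    velocity ahead supersonic ([normal_supersonic]), so all three families of
    characteristics leave the region through the front, and backward
    characteristics end on the entry line.  Constancy then follows from a maximum
    argument: if [q] is transported, [q - eps * x] has no maximum with [x > 0]
    ([transport_le]).  The invariants are exact, not linearized, because
    the gradient of the flow may blow up at the vertex.

    Behind the front, pressure and flow slope [w = v / u] satisfy
    [(w_y, - w_x) = A grad p] with [A] symmetric, and positive definite because the
    flow is subsonic ([subsonic_elliptic]).  This says [div (A grad p) = 0] although
    [p] is only [C^1].  If [p + psi] has a maximum, then [div (A grad psi) <= 0]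
    there, since the mean of [p + psi] over small ellipses would otherwise grow
    with the radius: the part coming from [p] is the circulation of [dw], which
    vanishes ([touching_lemma]).  Barriers then give Hopf's boundary lemma
    ([hopf_disc]) and the strong maximum principle ([maximum_along_curve]).

    Suppose that [p] is not constant.  It has an extremal value different from
    [pbar], attained on the wall or on the front.  On the wall, [w] is constant,
    which by the system means that the normal derivative of [p] vanishes,
    contrary to Hopf.  At an extremum on the front the tangential derivative of [p]
    vanishes; if the shock is oblique there, [w] is along the front a smooth function
    of [p] and is stationary too, and ellipticity turns the two conditions into
    [grad p = 0], again contrary to Hopf ([extremum_at_normal_shock]).  There remains a
    maximum at a normal shock.  At every such point Hopf gives [p_x < 0], hence
    [w_y < 0], so [w], and with it the derivative of the front, passes from positive
    to negative values and can never return.  As [p] tends to [pbar], the shock is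
    oblique far out, so the derivative of the front is bounded away from zero and the
    front would leave the domain ([pressure_at_most]).

    Once [p] is constant, [w] is constant, the front is straight, and velocity and
    density are constant on the streamlines starting from the front ([behind_uniform]). *)

(** * Closures and continuity in the plane *)

Ltac Rmin_fact a b :=
  lazymatch goal with
  | _ : Rmin a b <= a |- _ => fail
  | _ => let H := fresh "Hmin" in assert (H := Rmin_l a b);
         let K := fresh "Hmin" in assert (K := Rmin_r a b)
  end.

Ltac Rmin_facts :=
  repeat match goal with
  | _ : context [Rmin ?a ?b] |- _ => Rmin_fact a b
  | _ := context [Rmin ?a ?b] |- _ => Rmin_fact a b
  | |- context [Rmin ?a ?b] => Rmin_fact a b
  end.

(** The vertex of the wedge is the origin; gradients are controlled only away from it. *)
Definition punctured_closure (A : R * R -> Prop) (z : R * R) : Prop :=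
  closure A z /\ z <> (0, 0).

Lemma locally_square (x y : R) (P : R * R -> Prop) :
  locally (x, y) P <->
  exists d : R, 0 < d /\
    forall x' y', Rabs (x' - x) < d -> Rabs (y' - y) < d -> P (x', y').
Proof.
split.
- intros [d Hd]. exists d; split; [apply cond_pos|].
  intros x' y' Hx Hy. apply Hd. split; assumption.
- intros (d & Hd & H). exists (mkposreal d Hd).
  intros [x' y'] [Hx Hy]. apply H; assumption.
Qed.

Lemma open_square (A : R * R -> Prop) (x y : R) :
  open A -> A (x, y) ->
  exists d : R, 0 < d /\
    forall x' y', Rabs (x' - x) < d -> Rabs (y' - y) < d -> A (x', y').
Proof. intros HA Hz. apply locally_square, HA, Hz. Qed.

Lemma subset_closure (A : R * R -> Prop) z : A z -> closure A z.
Proof. intros Hz P HP. exists z; split; [now apply locally_singleton|exact Hz]. Qed.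

Lemma subset_punctured (A : R * R -> Prop) z :
  ~ A (0, 0) -> A z -> punctured_closure A z.
Proof.
intros HO Hz; split; [now apply subset_closure|].
intros ->; exact (HO Hz).
Qed.

Lemma closure_near (A : R * R -> Prop) x y d :
  closure A (x, y) -> 0 < d ->
  exists x' y', A (x', y') /\ Rabs (x' - x) < d /\ Rabs (y' - y) < d.
Proof.
intros H Hd.
destruct (H (fun z => Rabs (fst z - x) < d /\ Rabs (snd z - y) < d)) as [[x' y'] [H1 H2]].
- apply locally_square. exists d; split; [exact Hd|]. intros; split; assumption.
- exists x', y'; split; [exact H2|exact H1].
Qed.

Lemma closure_intro (A : R * R -> Prop) x y :
  (forall d, 0 < d ->
     exists x' y', A (x', y') /\ Rabs (x' - x) < d /\ Rabs (y' - y) < d) ->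
  closure A (x, y).
Proof.
intros H P HP. apply locally_square in HP as (d & Hd & HP).
destruct (H d Hd) as (x' & y' & HA & H1 & H2).
exists (x', y'); split; [now apply HP|exact HA].
Qed.

Lemma continuous_on_eps (D : R * R -> Prop) (q : R * R -> R) x y eps :
  continuous_on D q -> D (x, y) -> 0 < eps ->
  exists d, 0 < d /\ forall x' y', D (x', y') ->
    Rabs (x' - x) < d -> Rabs (y' - y) < d -> Rabs (q (x', y') - q (x, y)) < eps.
Proof.
intros Hq Hz He.
assert (H := proj1 (filterlim_locally _ _) (Hq _ Hz) (mkposreal eps He)).
unfold within in H. apply locally_square in H as (d & Hd & H).
exists d; split; [exact Hd|]. intros x' y' HD H1 H2. exact (H x' y' H1 H2 HD).
Qed.

Lemma continuous_on_intro (D : R * R -> Prop) (q : R * R -> R) :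
  (forall x y eps, D (x, y) -> 0 < eps ->
   exists d, 0 < d /\ forall x' y', D (x', y') ->
    Rabs (x' - x) < d -> Rabs (y' - y) < d -> Rabs (q (x', y') - q (x, y)) < eps) ->
  continuous_on D q.
Proof.
intros H [x y] Hz. apply filterlim_locally. intros eps.
destruct (H x y eps Hz (cond_pos eps)) as (d & Hd & Hq).
unfold within. apply locally_square. exists d; split; [exact Hd|].
intros x' y' H1 H2 HD. exact (Hq x' y' HD H1 H2).
Qed.

Lemma continuous_on_opp (D : R * R -> Prop) (q : R * R -> R) :
  continuous_on D q -> continuous_on D (fun z => - q z).
Proof.
intros Hq z Hz. eapply filterlim_comp; [exact (Hq z Hz)|].
apply (filterlim_opp (q z)).
Qed.

Lemma continuous_on_const (D : R * R -> Prop) (c : R) :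
  continuous_on D (fun _ : R * R => c).
Proof. intros z Hz. apply filterlim_const. Qed.

Lemma continuous_on_fst (D : R * R -> Prop) : continuous_on D (fun z : R * R => fst z).
Proof.
apply continuous_on_intro. intros x y eps _ He. exists eps; split; [exact He|].
simpl; auto.
Qed.

Lemma continuous_on_snd (D : R * R -> Prop) : continuous_on D (fun z : R * R => snd z).
Proof.
apply continuous_on_intro. intros x y eps _ He. exists eps; split; [exact He|].
simpl; auto.
Qed.

Lemma continuous_on_plus (D : R * R -> Prop) (q r : R * R -> R) :
  continuous_on D q -> continuous_on D r -> continuous_on D (fun z => q z + r z).
Proof.
intros Hq Hr z Hz.
eapply filterlim_comp_2; [exact (Hq z Hz)|exact (Hr z Hz)|].
apply (filterlim_plus (q z) (r z)).
Qed.

Lemma continuous_on_minus (D : R * R -> Prop) (q r : R * R -> R) :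
  continuous_on D q -> continuous_on D r -> continuous_on D (fun z => q z - r z).
Proof.
intros Hq Hr. apply (continuous_on_plus D q (fun z => - r z)); [exact Hq|].
now apply continuous_on_opp.
Qed.

Lemma continuous_on_mult (D : R * R -> Prop) (q r : R * R -> R) :
  continuous_on D q -> continuous_on D r -> continuous_on D (fun z => q z * r z).
Proof.
intros Hq Hr z Hz.
eapply filterlim_comp_2; [exact (Hq z Hz)|exact (Hr z Hz)|].
apply (filterlim_mult (q z) (r z)).
Qed.

Lemma continuous_on_comp (D : R * R -> Prop) (g : R -> R) (q : R * R -> R) :
  (forall z, D z -> continuous g (q z)) ->
  continuous_on D q -> continuous_on D (fun z => g (q z)).
Proof.
intros Hg Hq z Hz. eapply filterlim_comp; [exact (Hq z Hz)|]. exact (Hg z Hz).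
Qed.

Lemma continuous_on_inv (D : R * R -> Prop) (q : R * R -> R) :
  (forall z, D z -> q z <> 0) ->
  continuous_on D q -> continuous_on D (fun z => / q z).
Proof.
intros Hn Hq. apply (continuous_on_comp D Rinv q); [|exact Hq].
intros z Hz. apply (ex_derive_continuous Rinv). exists (- / (q z) ^ 2).
auto_derive; [now apply Hn|]. field. now apply Hn.
Qed.

Lemma continuous_on_div (D : R * R -> Prop) (q r : R * R -> R) :
  (forall z, D z -> r z <> 0) ->
  continuous_on D q -> continuous_on D r -> continuous_on D (fun z => q z / r z).
Proof.
intros Hn Hq Hr. apply (continuous_on_mult D q (fun z => / r z)); [exact Hq|].
now apply continuous_on_inv.
Qed.

Ltac cont_on :=
  lazymatch goal with
  | |- continuous_on _ (@fst _ _) => apply continuous_on_fst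
  | |- continuous_on _ (@snd _ _) => apply continuous_on_snd
  | |- continuous_on _ (fun z => fst z) => apply continuous_on_fst
  | |- continuous_on _ (fun z => snd z) => apply continuous_on_snd
  | |- continuous_on _ (fun z => ?q z) => try assumption
  | |- continuous_on _ (fun _ => _ + _) => apply continuous_on_plus; cont_on
  | |- continuous_on _ (fun _ => _ - _) => apply continuous_on_minus; cont_on
  | |- continuous_on _ (fun _ => _ * _) => apply continuous_on_mult; cont_on
  | |- continuous_on _ (fun _ => - _) => apply continuous_on_opp; cont_on
  | |- continuous_on _ (fun _ => ?c) => apply continuous_on_const
  | |- _ => try assumption
  end.

Lemma le_closure (A D : R * R -> Prop) (q r : R * R -> R) :
  (forall z, A z -> D z) -> (forall z, D z -> closure A z) ->
  continuous_on D q -> continuous_on D r ->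
  (forall z, A z -> q z <= r z) -> forall z, D z -> q z <= r z.
Proof.
intros HAD HDA Hq Hr H [x y] Hz.
apply Rnot_lt_le; intros Hlt.
assert (He : 0 < (q (x, y) - r (x, y)) / 2) by lra.
destruct (continuous_on_eps _ _ _ _ _ Hq Hz He) as (d1 & Hd1 & H1).
destruct (continuous_on_eps _ _ _ _ _ Hr Hz He) as (d2 & Hd2 & H2).
destruct (closure_near A x y (Rmin d1 d2) (HDA _ Hz)) as (x' & y' & HA & Hx & Hy).
{ now apply Rmin_pos. }
Rmin_facts.
specialize (H1 x' y' (HAD _ HA) ltac:(lra) ltac:(lra)).
specialize (H2 x' y' (HAD _ HA) ltac:(lra) ltac:(lra)).
specialize (H _ HA).
apply Rabs_def2 in H1. apply Rabs_def2 in H2. lra.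
Qed.

Lemma eq_closure (A D : R * R -> Prop) (q r : R * R -> R) :
  (forall z, A z -> D z) -> (forall z, D z -> closure A z) ->
  continuous_on D q -> continuous_on D r ->
  (forall z, A z -> q z = r z) -> forall z, D z -> q z = r z.
Proof.
intros HAD HDA Hq Hr H z Hz. apply Rle_antisym.
- apply (le_closure A D q r); auto. intros; apply Req_le; auto.
- apply (le_closure A D r q); auto. intros; apply Req_le; symmetry; auto.
Qed.

(** * Functions that are [C^1] up to the boundary *)

(** [regular_up_to_boundary] with the gradient explicit, so that it can be computed. *)
Definition C1_up (A : R * R -> Prop) (q qx qy : R * R -> R) : Prop :=
  continuous_on (closure A) q /\
  continuous_on (punctured_closure A) qx /\
  continuous_on (punctured_closure A) qy /\
  forall x y : R, A (x, y) ->
    is_derive (fun t => q (t, y)) x (qx (x, y)) /\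
    is_derive (fun t => q (x, t)) y (qy (x, y)).

Lemma C1_up_of_regular A q : regular_up_to_boundary A q -> exists qx qy, C1_up A q qx qy.
Proof. intros [Hc (qx & qy & H1 & H2 & H3)]. exists qx, qy. repeat split; auto; apply H3; auto. Qed.

Lemma C1_up_cont0 A q qx qy : C1_up A q qx qy -> continuous_on (punctured_closure A) q.
Proof. intros [H _]. revert H. apply continuous_on_subset. intros z Hz; apply Hz. Qed.

Lemma C1_up_ext A q qx qy q' qx' qy' :
  C1_up A q qx qy -> ~ A (0, 0) ->
  (forall z, closure A z -> q z = q' z) ->
  (forall z, punctured_closure A z -> qx z = qx' z) ->
  (forall z, punctured_closure A z -> qy z = qy' z) ->
  open A -> C1_up A q' qx' qy'.
Proof.
intros (H1 & H2 & H3 & H4) HO E1 E2 E3 HA.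
split; [now apply (continuous_on_ext _ q)|].
split; [now apply (continuous_on_ext _ qx)|].
split; [now apply (continuous_on_ext _ qy)|].
intros x y Hz. destruct (H4 x y Hz) as [D1 D2].
rewrite <- E2, <- E3 by (apply subset_punctured; auto).
destruct (open_square A x y HA Hz) as (d & Hd & Hs).
split.
- apply (is_derive_ext_loc (fun t => q (t, y))); [|exact D1].
  exists (mkposreal d Hd). intros t Ht. apply E1, subset_closure, Hs; [exact Ht|].
  rewrite Rminus_diag, Rabs_R0; exact Hd.
- apply (is_derive_ext_loc (fun t => q (x, t))); [|exact D2].
  exists (mkposreal d Hd). intros t Ht. apply E1, subset_closure, Hs; [|exact Ht].
  rewrite Rminus_diag, Rabs_R0; exact Hd.
Qed.

Lemma C1_up_const A c : C1_up A (fun _ => c) (fun _ => 0) (fun _ => 0).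
Proof.
split; [|split; [|split]]; try apply continuous_on_const.
intros x y _; split; apply (is_derive_const (V := R_NormedModule) c).
Qed.

Lemma C1_up_plus A q qx qy r rx ry :
  C1_up A q qx qy -> C1_up A r rx ry ->
  C1_up A (fun z => q z + r z) (fun z => qx z + rx z) (fun z => qy z + ry z).
Proof.
intros (H1 & H2 & H3 & H4) (K1 & K2 & K3 & K4).
split; [|split; [|split; [|intros x y Hz; split]]]; cont_on.
- apply (is_derive_plus (fun t => q (t, y)) (fun t => r (t, y))); [apply H4|apply K4]; auto.
- apply (is_derive_plus (fun t => q (x, t)) (fun t => r (x, t))); [apply H4|apply K4]; auto.
Qed.

Lemma C1_up_mult A q qx qy r rx ry :
  C1_up A q qx qy -> C1_up A r rx ry ->
  C1_up A (fun z => q z * r z)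
    (fun z => qx z * r z + q z * rx z) (fun z => qy z * r z + q z * ry z).
Proof.
intros H K. assert (Hq := C1_up_cont0 _ _ _ _ H). assert (Kr := C1_up_cont0 _ _ _ _ K).
destruct H as (H1 & H2 & H3 & H4). destruct K as (K1 & K2 & K3 & K4).
split; [|split; [|split; [|intros x y Hz; split]]]; cont_on.
- apply (is_derive_mult (fun t => q (t, y)) (fun t => r (t, y)));
    [apply H4|apply K4|exact Rmult_comm]; auto.
- apply (is_derive_mult (fun t => q (x, t)) (fun t => r (x, t)));
    [apply H4|apply K4|exact Rmult_comm]; auto.
Qed.

Lemma C1_up_comp A (g g' : R -> R) q qx qy :
  (forall z, closure A z -> is_derive g (q z) (g' (q z)) /\ continuous g' (q z)) ->
  C1_up A q qx qy ->
  C1_up A (fun z => g (q z)) (fun z => g' (q z) * qx z) (fun z => g' (q z) * qy z).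
Proof.
intros Hg H. assert (Hq := C1_up_cont0 _ _ _ _ H).
destruct H as (H1 & H2 & H3 & H4).
assert (Hc : continuous_on (punctured_closure A) (fun z => g' (q z))).
{ apply continuous_on_comp; [|exact Hq]. intros z Hz; apply Hg, Hz. }
split; [|split; [|split; [|intros x y Hz; split]]]; cont_on.
- apply continuous_on_comp; [|exact H1]. intros z Hz.
  apply (ex_derive_continuous g). exists (g' (q z)). apply Hg, Hz.
- rewrite Rmult_comm. apply (is_derive_comp g (fun t => q (t, y))); [|apply H4; auto].
  apply Hg, subset_closure; auto.
- rewrite Rmult_comm. apply (is_derive_comp g (fun t => q (x, t))); [|apply H4; auto].
  apply Hg, subset_closure; auto.
Qed.

Lemma C1_up_scal A c q qx qy :
  C1_up A q qx qy -> C1_up A (fun z => c * q z) (fun z => c * qx z) (fun z => c * qy z).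
Proof.
intros H. apply (C1_up_comp A (fun t => c * t) (fun _ => c)); [|exact H].
intros z _; split; [auto_derive; [exact I|ring]|apply continuous_const].
Qed.

Lemma C1_up_inv A q qx qy :
  (forall z, closure A z -> q z <> 0) -> C1_up A q qx qy ->
  C1_up A (fun z => / q z)
    (fun z => (- / (q z) ^ 2) * qx z) (fun z => (- / (q z) ^ 2) * qy z).
Proof.
intros Hn H. apply (C1_up_comp A Rinv (fun t => - / t ^ 2)); [|exact H].
intros z Hz; specialize (Hn z Hz); split.
- auto_derive; [exact Hn|]. field; exact Hn.
- apply (ex_derive_continuous (fun t => - / t ^ 2)). auto_derive.
  simpl. rewrite Rmult_1_r. now apply Rmult_integral_contrapositive.
Qed.

(** * Differentiation up to the boundary *)

Lemma Rabs_between a b t : Rmin a b <= t <= Rmax a b -> Rabs (t - a) <= Rabs (b - a).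
Proof.
unfold Rmin, Rmax. destruct (Rle_dec a b); intros Ht.
- rewrite !Rabs_pos_eq; lra.
- rewrite !Rabs_left1; lra.
Qed.

Lemma right_derivative_le (h : R -> R) l c s0 : is_derive h 0 l -> 0 < s0 ->
  (forall s, 0 < s < s0 -> h s <= h 0 + c * s) -> l <= c.
Proof.
intros Hh Hs0 Hle. apply Rnot_lt_le; intros Hlt. apply is_derive_Reals in Hh.
destruct (Hh (l - c) ltac:(lra)) as [d Hd]. assert (Pd := cond_pos d).
set (s := Rmin (d / 2) (s0 / 2)). assert (Hs : 0 < s) by (apply Rmin_pos; lra).
assert (N1 : s <= d / 2) by apply Rmin_l. assert (N2 : s <= s0 / 2) by apply Rmin_r.
specialize (Hd s ltac:(lra) ltac:(rewrite Rabs_pos_eq; lra)).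
rewrite Rplus_0_l in Hd. apply Rabs_def2 in Hd. specialize (Hle s ltac:(lra)).
assert (Hlow : c * s < (h s - h 0) / s * s) by (apply Rmult_lt_compat_r; lra).
replace ((h s - h 0) / s * s) with (h s - h 0) in Hlow by (field; lra). lra.
Qed.

Lemma C1_up_differentiable A q qx qy x y :
  open A -> ~ A (0, 0) -> C1_up A q qx qy -> A (x, y) ->
  differentiable_pt_lim (fun u v => q (u, v)) x y (qx (x, y)) (qy (x, y)).
Proof.
intros HA HO (H1 & H2 & H3 & H4) Hz eps.
destruct (open_square A x y HA Hz) as (d & Hd & Hs).
assert (He : 0 < eps / 2) by (generalize (cond_pos eps); lra).
assert (Hp := subset_punctured A _ HO Hz).
destruct (continuous_on_eps _ _ _ _ _ H2 Hp He) as (d1 & Hd1 & K1).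
destruct (continuous_on_eps _ _ _ _ _ H3 Hp He) as (d2 & Hd2 & K2).
assert (Hm : 0 < Rmin d (Rmin d1 d2)) by (repeat apply Rmin_pos; assumption).
exists (mkposreal _ Hm). simpl. intros u v Hu Hv.
Rmin_facts.
assert (Hin : forall t s, Rabs (t - x) <= Rabs (u - x) -> Rabs (s - y) <= Rabs (v - y) -> A (t, s)).
{ intros; apply Hs; lra. }
assert (B1 := Rabs_between x u). assert (B2 := Rabs_between y v).
destruct (MVT_gen (fun t => q (t, v)) x u (fun t => qx (t, v))) as (c1 & Hc1 & E1).
{ intros t Ht. apply H4, Hin; [apply B1|]; lra. }
{ intros t Ht. apply continuity_pt_filterlim, (ex_derive_continuous (fun t => q (t, v))).
  exists (qx (t, v)). apply H4, Hin; [apply B1; lra|lra]. }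
destruct (MVT_gen (fun t => q (x, t)) y v (fun t => qy (x, t))) as (c2 & Hc2 & E2).
{ intros t Ht. apply H4, Hin; [rewrite Rminus_diag, Rabs_R0; apply Rabs_pos|apply B2; lra]. }
{ intros t Ht. apply continuity_pt_filterlim, (ex_derive_continuous (fun t => q (x, t))).
  exists (qy (x, t)). apply H4, Hin; [rewrite Rminus_diag, Rabs_R0; apply Rabs_pos|apply B2; lra]. }
specialize (B1 _ Hc1). specialize (B2 _ Hc2).
assert (F1 : Rabs (qx (c1, v) - qx (x, y)) < eps / 2).
{ apply K1; [apply subset_punctured, Hin| |]; auto; lra. }
assert (F2 : Rabs (qy (x, c2) - qy (x, y)) < eps / 2).
{ assert (Z : Rabs (x - x) = 0) by (rewrite Rminus_diag; apply Rabs_R0).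
  assert (P := Rabs_pos (u - x)).
  apply K2; [apply subset_punctured, Hin| |]; auto; lra. }
assert (E1' : q (u, v) - q (x, v) = qx (c1, v) * (u - x)) by exact E1.
assert (E2' : q (x, v) - q (x, y) = qy (x, c2) * (v - y)) by exact E2.
change (Rabs (q (u, v) - q (x, y) - (qx (x, y) * (u - x) + qy (x, y) * (v - y))) <=
  eps * Rmax (Rabs (u - x)) (Rabs (v - y))).
replace (q (u, v) - q (x, y)) with (q (u, v) - q (x, v) + (q (x, v) - q (x, y))) by ring.
rewrite E1', E2'.
match goal with |- Rabs ?e <= _ =>
  replace e with ((qx (c1, v) - qx (x, y)) * (u - x) + (qy (x, c2) - qy (x, y)) * (v - y)) by ring end.
eapply Rle_trans; [apply Rabs_triang|]. rewrite !Rabs_mult.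
assert (N1 := Rmax_l (Rabs (u - x)) (Rabs (v - y))).
assert (N2 := Rmax_r (Rabs (u - x)) (Rabs (v - y))).
assert (P1 := Rabs_pos (u - x)). assert (P2 := Rabs_pos (v - y)).
assert (Q1 := Rabs_pos (qx (c1, v) - qx (x, y))). assert (Q2 := Rabs_pos (qy (x, c2) - qy (x, y))).
nra.
Qed.

Lemma C1_up_chain A q qx qy (X Y : R -> R) s lx ly :
  open A -> ~ A (0, 0) -> C1_up A q qx qy -> A (X s, Y s) ->
  is_derive X s lx -> is_derive Y s ly ->
  is_derive (fun t => q (X t, Y t)) s (qx (X s, Y s) * lx + qy (X s, Y s) * ly).
Proof.
intros HA HO Hq Hz HX HY. apply is_derive_Reals.
apply (derivable_pt_lim_comp_2d (fun u v => q (u, v)) X Y).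
- now apply (C1_up_differentiable A).
- now apply is_derive_Reals.
- now apply is_derive_Reals.
Qed.

Lemma continuous_on_curve (D : R * R -> Prop) (q : R * R -> R) (X Y : R -> R) s :
  continuous_on D q -> D (X s, Y s) -> locally s (fun t => D (X t, Y t)) ->
  continuous X s -> continuous Y s -> continuous (fun t => q (X t, Y t)) s.
Proof.
intros Hq Hz HD HX HY. apply filterlim_locally. intros eps.
destruct (continuous_on_eps _ _ _ _ _ Hq Hz (cond_pos eps)) as (d & Hd & H).
assert (KX := proj1 (filterlim_locally _ _) HX (mkposreal d Hd)).
assert (KY := proj1 (filterlim_locally _ _) HY (mkposreal d Hd)).
generalize (filter_and _ _ HD (filter_and _ _ KX KY)). apply filter_imp.
intros t (T1 & T2 & T3). exact (H _ _ T1 T2 T3).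
Qed.

Lemma mvt_open (h h' : R -> R) a b : a < b ->
  (forall s, a < s < b -> is_derive h s (h' s)) ->
  (forall s, a <= s <= b -> continuity_pt h s) ->
  exists s, a < s < b /\ h b - h a = h' s * (b - a).
Proof.
intros Hab Hd Hc.
assert (pr1 : forall c, a < c < b -> derivable_pt h c).
{ intros c Hcc. exists (h' c). apply is_derive_Reals, Hd, Hcc. }
assert (pr2 : forall c, a < c < b -> derivable_pt (fun t => t) c).
{ intros c _. exists 1. apply derivable_pt_lim_id. }
destruct (MVT h (fun t => t) a b pr1 pr2 Hab Hc) as (c & P & E).
{ intros c _. apply derivable_continuous_pt, derivable_pt_id. }
exists c; split; [exact P|].
rewrite !Derive_Reals in E. rewrite (is_derive_unique h c (h' c)) in E by (apply Hd, P).
assert (D : Derive (fun t : R => t) c = 1) by exact (Derive_id c).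
rewrite D in E.
lra.
Qed.

(** The initial point may lie on the boundary.  Clamping the parameter at 0 makes
    the restriction to the segment continuous there. *)
Lemma segment_mvt A q qx qy x y a b :
  open A -> ~ A (0, 0) -> C1_up A q qx qy -> closure A (x, y) ->
  (forall s, 0 < s <= 1 -> A (x + s * a, y + s * b)) ->
  exists s, 0 < s < 1 /\
    q (x + a, y + b) - q (x, y) =
      a * qx (x + s * a, y + s * b) + b * qy (x + s * a, y + s * b).
Proof.
intros HA HO Hq Hz Hin.
set (h := fun s => q (x + Rmax 0 s * a, y + Rmax 0 s * b)).
set (h' := fun s => a * qx (x + s * a, y + s * b) + b * qy (x + s * a, y + s * b)).
assert (Hd : forall s, 0 < s <= 1 -> is_derive h s (h' s)).
{ intros s Hs.
  apply (is_derive_ext_loc (fun s => q (x + s * a, y + s * b))).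
  - exists (mkposreal s (proj1 Hs)). intros t Ht. unfold h.
    apply Rabs_def2 in Ht. simpl in Ht. unfold minus, plus, opp in Ht; simpl in Ht.
    rewrite Rmax_right; [reflexivity|lra].
  - replace (h' s) with (qx (x + s * a, y + s * b) * a + qy (x + s * a, y + s * b) * b)
      by (unfold h'; ring).
    apply (C1_up_chain A q qx qy (fun s => x + s * a) (fun s => y + s * b)); auto.
    + auto_derive; [exact I|ring].
    + auto_derive; [exact I|ring]. }
assert (Hc : forall s, 0 <= s <= 1 -> continuity_pt h s).
{ intros s Hs. destruct (Rle_lt_or_eq_dec 0 s (proj1 Hs)) as [H0|H0].
  - apply continuity_pt_filterlim, (ex_derive_continuous h). exists (h' s). apply Hd; lra.
  - subst s. apply continuity_pt_filterlim.
    assert (Hm : forall s0 : R, continuous (fun s => Rmax 0 s) s0).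
    { intros s0. apply (continuous_ext (fun s => (0 + s + Rabs (0 - s)) / 2)).
      - intros t. unfold Rmax. destruct (Rle_dec 0 t).
        + rewrite Rabs_left1; lra.
        + rewrite Rabs_pos_eq; lra.
      - apply (continuous_mult (fun s => 0 + s + Rabs (0 - s)) (fun _ => / 2));
          [|apply continuous_const].
        apply (continuous_plus (fun s => 0 + s) (fun s => Rabs (0 - s))).
        + apply (continuous_plus (fun _ => 0) (fun s => s)); [apply continuous_const|apply continuous_id].
        + apply continuous_comp; [|apply continuous_Rabs].
          apply (continuous_minus (fun _ => 0) (fun s => s)); [apply continuous_const|apply continuous_id]. }
    apply (continuous_on_curve (closure A) q (fun s => x + Rmax 0 s * a) (fun s => y + Rmax 0 s * b)).
    + apply Hq.
    + rewrite Rmax_left by lra. rewrite !Rmult_0_l, !Rplus_0_r. exact Hz.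
    + exists (mkposreal 1 Rlt_0_1). intros t Ht.
      apply Rabs_def2 in Ht. simpl in Ht. unfold minus, plus, opp in Ht; simpl in Ht.
      destruct (Rle_dec t 0).
      * rewrite Rmax_left by lra. rewrite !Rmult_0_l, !Rplus_0_r. exact Hz.
      * rewrite Rmax_right by lra. apply subset_closure, Hin; lra.
    + apply (continuous_plus (fun _ => x) (fun s => Rmax 0 s * a)); [apply continuous_const|].
      apply (continuous_mult (fun s => Rmax 0 s) (fun _ => a)); [apply Hm|apply continuous_const].
    + apply (continuous_plus (fun _ => y) (fun s => Rmax 0 s * b)); [apply continuous_const|].
      apply (continuous_mult (fun s => Rmax 0 s) (fun _ => b)); [apply Hm|apply continuous_const]. }
destruct (mvt_open h h' 0 1 Rlt_0_1) as (c & Hcc & Ec).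
- intros s Hs. apply Hd; lra.
- exact Hc.
- exists c; split; [exact Hcc|].
  unfold h in Ec. rewrite Rmax_right, Rmax_left in Ec by lra.
  rewrite !Rmult_0_l, !Rplus_0_r, !Rmult_1_l in Ec. rewrite Ec. unfold h'. ring.
Qed.

(** One-sided derivatives at a boundary point, packaged as two-sided
    derivatives of an extended function so that the ordinary calculus of
    derivatives applies to them. *)
Lemma ray_derivative A q qx qy x y a b s0 :
  open A -> ~ A (0, 0) -> C1_up A q qx qy -> punctured_closure A (x, y) -> 0 < s0 ->
  (forall s, 0 < s < s0 -> A (x + s * a, y + s * b)) ->
  exists H : R -> R,
    is_derive H 0 (a * qx (x, y) + b * qy (x, y)) /\
    forall s, 0 <= s -> H s = q (x + s * a, y + s * b).
Proof.
intros HA HO Hq Hz Hs0 Hin.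
set (l := a * qx (x, y) + b * qy (x, y)).
set (H := fun s => if Rle_dec 0 s then q (x + s * a, y + s * b) else q (x, y) + s * l).
exists H; split.
2:{ intros s Hs. unfold H. destruct (Rle_dec 0 s); [reflexivity|lra]. }
assert (H0 : H 0 = q (x, y)).
{ unfold H. destruct (Rle_dec 0 0); [|lra]. now rewrite !Rmult_0_l, !Rplus_0_r. }
assert (HL : continuous_on (punctured_closure A) (fun z => a * qx z + b * qy z)).
{ destruct Hq as (Q1 & Q2 & Q3 & Q4). cont_on. }
apply is_derive_Reals. intros eps Heps.
destruct (continuous_on_eps _ _ x y eps HL Hz Heps) as (d & Hd & HK).
set (M := 1 + Rabs a + Rabs b).
assert (HM : 0 < M) by (unfold M; generalize (Rabs_pos a), (Rabs_pos b); lra).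
assert (Hdd : 0 < Rmin s0 (d / M)).
{ apply Rmin_pos; [exact Hs0|]. now apply Rdiv_lt_0_compat. }
exists (mkposreal _ Hdd). intros s Hn Hs. simpl in Hs.
Rmin_facts.
rewrite Rplus_0_l, H0. unfold H. destruct (Rle_dec 0 s) as [Hp|Hp].
2:{ replace ((q (x, y) + s * l - q (x, y)) / s - l) with 0 by (field; exact Hn).
    rewrite Rabs_R0; exact Heps. }
assert (Hsp : 0 < s) by lra.
rewrite Rabs_pos_eq in Hs by lra.
destruct (segment_mvt A q qx qy x y (s * a) (s * b)) as (t & Ht & E); auto.
{ apply Hz. }
{ intros t Ht. replace (t * (s * a)) with ((t * s) * a) by ring.
  replace (t * (s * b)) with ((t * s) * b) by ring. apply Hin. nra. }
rewrite E.
assert (Hts : 0 < t * s < s) by nra.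
replace (t * (s * a)) with ((t * s) * a) in * by ring.
replace (t * (s * b)) with ((t * s) * b) in * by ring.
match goal with |- Rabs ?e < _ =>
  replace e with ((a * qx (x + t * s * a, y + t * s * b) + b * qy (x + t * s * a, y + t * s * b)) - l)
    by (field; exact Hn) end.
assert (Hbd : t * s * M < d).
{ apply Rlt_le_trans with (s * M); [nra|].
  apply Rle_trans with (d / M * M); [nra|]. right; field. lra. }
assert (Pa := Rabs_pos a). assert (Pb := Rabs_pos b).
apply HK.
- apply subset_punctured; [exact HO|]. apply Hin. lra.
- replace (x + t * s * a - x) with (t * s * a) by ring.
  rewrite Rabs_mult, (Rabs_pos_eq (t * s)) by lra. unfold M in Hbd. nra.
- replace (y + t * s * b - y) with (t * s * b) by ring.
  rewrite Rabs_mult, (Rabs_pos_eq (t * s)) by lra. unfold M in Hbd. nra.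
Qed.

(** Tangential derivative along a boundary arc [x = g y]: the arc is pushed into
    [A] horizontally, where the chain rule holds, and the resulting increment
    estimate survives the limit. *)
Lemma boundary_arc_derivative A q qx qy (g g' : R -> R) sgn y0 r :
  open A -> ~ A (0, 0) -> C1_up A q qx qy -> 0 < r ->
  (forall y, Rabs (y - y0) < r -> punctured_closure A (g y, y)) ->
  (forall y, Rabs (y - y0) < r -> is_derive g y (g' y)) ->
  continuous g' y0 -> Rabs sgn = 1 ->
  (forall y, Rabs (y - y0) < r -> exists e0, 0 < e0 /\
     forall y' e, Rabs (y' - y0) <= Rabs (y - y0) -> 0 < e < e0 -> A (g y' + sgn * e, y')) ->
  is_derive (fun y => q (g y, y)) y0 (g' y0 * qx (g y0, y0) + qy (g y0, y0)).
Proof.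
intros HA HO Hq Hr Hcl Hg Hg' Hsgn Hpush.
set (l := g' y0 * qx (g y0, y0) + qy (g y0, y0)).
assert (Hy0 : Rabs (y0 - y0) < r) by (rewrite Rminus_diag, Rabs_R0; exact Hr).
assert (Q := Hq). destruct Q as (Q1 & Q2 & Q3 & Q4).
apply is_derive_Reals. intros eps Heps.
assert (Hnear : exists d, 0 < d /\ d <= r /\ forall y e, Rabs (y - y0) < d -> Rabs e < d ->
   A (g y + e, y) -> Rabs (g' y * qx (g y + e, y) + qy (g y + e, y) - l) <= eps / 2).
{ set (Bx := Rabs (qx (g y0, y0)) + 1). set (Bg := Rabs (g' y0) + 1).
  assert (HBx : 0 < Bx) by (unfold Bx; generalize (Rabs_pos (qx (g y0, y0))); lra).
  assert (HBg : 0 < Bg) by (unfold Bg; generalize (Rabs_pos (g' y0)); lra).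
  set (e1 := Rmin 1 (eps / 8 / Bg)). set (e2 := Rmin 1 (eps / 8 / Bx)).
  assert (He1 : 0 < e1). { apply Rmin_pos; [lra|]. apply Rdiv_lt_0_compat; lra. }
  assert (He2 : 0 < e2). { apply Rmin_pos; [lra|]. apply Rdiv_lt_0_compat; lra. }
  destruct (continuous_on_eps _ _ _ _ e1 Q2 (Hcl y0 Hy0) He1) as (d1 & Hd1 & K1).
  assert (He8 : 0 < eps / 8) by lra.
  destruct (continuous_on_eps _ _ _ _ (eps / 8) Q3 (Hcl y0 Hy0) He8) as (d2 & Hd2 & K2).
  destruct (proj1 (filterlim_locally _ _) Hg' (mkposreal e2 He2)) as (d3 & K3).
  assert (Hgc : continuous g y0) by (apply (ex_derive_continuous g); exists (g' y0); apply Hg, Hy0).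
  set (dd := Rmin d1 d2 / 2).
  assert (Hdd : 0 < dd) by (unfold dd; generalize (Rmin_pos _ _ Hd1 Hd2); lra).
  destruct (proj1 (filterlim_locally _ _) Hgc (mkposreal dd Hdd)) as (d4 & K4).
  exists (Rmin r (Rmin dd (Rmin d3 d4))).
  assert (P3 := cond_pos d3). assert (P4 := cond_pos d4).
  split; [repeat apply Rmin_pos; auto|]. split; [apply Rmin_l|].
  intros y e Hy He HAz.
  Rmin_facts.
  assert (Hdd' : 2 * dd = Rmin d1 d2) by (unfold dd; field).
  assert (T3 : Rabs (g' y - g' y0) < e2) by (apply (K3 y); change (Rabs (y - y0) < d3); lra).
  assert (T4 : Rabs (g y - g y0) < dd) by (apply (K4 y); change (Rabs (y - y0) < d4); lra).
  assert (T5 : Rabs (g y + e - g y0) < 2 * dd).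
  { replace (g y + e - g y0) with ((g y - g y0) + e) by ring.
    eapply Rle_lt_trans; [apply Rabs_triang|]. lra. }
  assert (Hp := subset_punctured A _ HO HAz).
  assert (T1 := K1 _ _ Hp ltac:(lra) ltac:(lra)).
  assert (T2 := K2 _ _ Hp ltac:(lra) ltac:(lra)).
  unfold l.
  set (X := qx (g y + e, y)) in *. set (X0 := qx (g y0, y0)) in *.
  set (Y := qy (g y + e, y)) in *. set (Y0 := qy (g y0, y0)) in *.
  replace (g' y * X + Y - (g' y0 * X0 + Y0))
    with (((g' y - g' y0) * X0 + g' y * (X - X0)) + (Y - Y0)) by ring.
  eapply Rle_trans; [apply Rabs_triang|].
  assert (S1 : Rabs ((g' y - g' y0) * X0) <= eps / 8).
  { rewrite Rabs_mult. apply Rle_trans with (eps / 8 / Bx * Bx); [|right; field; lra].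
    assert (e2 <= eps / 8 / Bx) by apply Rmin_r.
    apply Rmult_le_compat; try apply Rabs_pos; [lra|unfold Bx, X0; lra]. }
  assert (S2 : Rabs (g' y * (X - X0)) <= eps / 8).
  { rewrite Rabs_mult. apply Rle_trans with (Bg * (eps / 8 / Bg)); [|right; field; lra].
    assert (e1 <= eps / 8 / Bg) by apply Rmin_r. assert (e2 <= 1) by apply Rmin_l.
    apply Rmult_le_compat; try apply Rabs_pos; [|lra].
    unfold Bg. replace (g' y) with ((g' y - g' y0) + g' y0) by ring.
    eapply Rle_trans; [apply Rabs_triang|]. lra. }
  eapply Rle_trans; [apply Rplus_le_compat; [apply Rabs_triang|apply Rlt_le, T2]|]. lra. }
destruct Hnear as (d & Hd & Hdr & Hnear).
exists (mkposreal d Hd). intros t Ht0 Ht. simpl in Ht.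
set (y := y0 + t). assert (Hyt : y - y0 = t) by (unfold y; ring).
assert (Hy : Rabs (y - y0) < d) by (rewrite Hyt; exact Ht).
destruct (Hpush y ltac:(lra)) as (e0 & He0 & Hin).
assert (Hinc : forall e, 0 < e < Rmin e0 d ->
   Rabs (q (g y + sgn * e, y) - q (g y0 + sgn * e, y0) - t * l) <= eps / 2 * Rabs t).
{ intros e He. Rmin_facts.
  assert (HI : forall s, Rmin y0 y <= s <= Rmax y0 y ->
     Rabs (s - y0) <= Rabs (y - y0) /\ A (g s + sgn * e, s)).
  { intros s Hs. assert (Hb := Rabs_between _ _ _ Hs). split; [exact Hb|]. apply Hin; [exact Hb|lra]. }
  assert (HD : forall s, Rmin y0 y <= s <= Rmax y0 y ->
     is_derive (fun s => q (g s + sgn * e, s)) s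
       (g' s * qx (g s + sgn * e, s) + qy (g s + sgn * e, s))).
  { intros s Hs. destruct (HI s Hs) as [I1 I2].
    replace (g' s * qx (g s + sgn * e, s) + qy (g s + sgn * e, s))
      with (qx (g s + sgn * e, s) * g' s + qy (g s + sgn * e, s) * 1) by ring.
    apply (C1_up_chain A q qx qy (fun s => g s + sgn * e) (fun s => s)); auto.
    - replace (g' s) with (g' s + 0) by ring.
      apply (is_derive_plus g (fun _ => sgn * e)); [apply Hg; lra|].
      apply (is_derive_const (V := R_NormedModule)).
    - apply (is_derive_id (K := R_AbsRing)). }
  destruct (MVT_gen (fun s => q (g s + sgn * e, s)) y0 y
    (fun s => g' s * qx (g s + sgn * e, s) + qy (g s + sgn * e, s))) as (s & Hs & E).
  - intros s Hs. apply HD; lra.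
  - intros s Hs. apply continuity_pt_filterlim, (ex_derive_continuous (fun s => q (g s + sgn * e, s))).
    eexists. apply HD; lra.
  - destruct (HI s Hs) as [I1 I2]. rewrite E, Hyt.
    match goal with |- Rabs ?u <= _ =>
      replace u with ((g' s * qx (g s + sgn * e, s) + qy (g s + sgn * e, s) - l) * t) by ring end.
    rewrite Rabs_mult. apply Rmult_le_compat_r; [apply Rabs_pos|].
    apply Hnear; auto; [lra|]. rewrite Rabs_mult, Hsgn, Rabs_pos_eq; lra. }
assert (Hlim : Rabs (q (g y, y) - q (g y0, y0) - t * l) <= eps / 2 * Rabs t).
{ apply Rnot_lt_le; intros Hlt.
  set (gap := (Rabs (q (g y, y) - q (g y0, y0) - t * l) - eps / 2 * Rabs t) / 2).
  assert (Hgap : 0 < gap) by (unfold gap; lra).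
  destruct (continuous_on_eps _ _ (g y) y gap Q1 (proj1 (Hcl y ltac:(lra))) Hgap) as (k1 & Hk1 & C1).
  destruct (continuous_on_eps _ _ (g y0) y0 gap Q1 (proj1 (Hcl y0 Hy0)) Hgap) as (k2 & Hk2 & C2).
  set (m := Rmin (Rmin e0 d) (Rmin k1 k2)).
  assert (Hm : 0 < m) by (repeat apply Rmin_pos; auto).
  assert (L1 : m <= Rmin e0 d) by apply Rmin_l.
  assert (L2 : m <= Rmin k1 k2) by apply Rmin_r.
  Rmin_facts.
  assert (Hb : forall u, Rabs (u + sgn * (m / 2) - u) < m).
  { intros u. replace (u + sgn * (m / 2) - u) with (sgn * (m / 2)) by ring.
    rewrite Rabs_mult, Hsgn, Rabs_pos_eq; lra. }
  assert (Hb0 : forall u : R, Rabs (u - u) < m) by (intros u; rewrite Rminus_diag, Rabs_R0; exact Hm).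
  specialize (Hinc (m / 2) ltac:(lra)).
  assert (A1 := C1 (g y + sgn * (m / 2)) y
     ltac:(apply subset_closure, Hin; lra) ltac:(specialize (Hb (g y)); lra) ltac:(specialize (Hb0 y); lra)).
  assert (A2 := C2 (g y0 + sgn * (m / 2)) y0
     ltac:(apply subset_closure, Hin; [rewrite Rminus_diag, Rabs_R0; apply Rabs_pos|lra])
     ltac:(specialize (Hb (g y0)); lra) ltac:(specialize (Hb0 y0); lra)).
  assert (Rabs (q (g y, y) - q (g y0, y0) - t * l) < eps / 2 * Rabs t + gap + gap); [|unfold gap in *; lra].
  set (a1 := q (g y + sgn * (m / 2), y)) in *. set (a2 := q (g y0 + sgn * (m / 2), y0)) in *.
  replace (q (g y, y) - q (g y0, y0) - t * l)
    with (((a1 - a2 - t * l) + - (a1 - q (g y, y))) + (a2 - q (g y0, y0))) by ring.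
  eapply Rle_lt_trans; [apply Rabs_triang|].
  eapply Rle_lt_trans; [apply Rplus_le_compat_r, Rabs_triang|]. rewrite Rabs_Ropp. lra. }
assert (Pt : 0 < Rabs t) by (apply Rabs_pos_lt; exact Ht0).
change (Rabs ((q (g y, y) - q (g y0, y0)) / t - l) < eps).
replace ((q (g y, y) - q (g y0, y0)) / t - l)
  with ((q (g y, y) - q (g y0, y0) - t * l) / t) by (field; exact Ht0).
unfold Rdiv. rewrite Rabs_mult, Rabs_inv.
apply Rle_lt_trans with (eps / 2 * Rabs t * / Rabs t).
- apply Rmult_le_compat_r; [|exact Hlim]. apply Rlt_le, Rinv_0_lt_compat, Pt.
- rewrite Rmult_assoc, Rinv_r by lra. lra.
Qed.

(** * Compactness in the plane *)

(** Lebesgue number plus dyadic subdivision: local validity of [P] reaches all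
    squares of a grid that is fine enough. *)
Lemma square_induction (P : R -> R -> R -> Prop) (a b l : R) :
  0 < l ->
  (forall x y s, 0 < s -> P x y s -> P (x + s) y s -> P x (y + s) s -> P (x + s) (y + s) s ->
     P x y (2 * s)) ->
  (forall x y, exists d, 0 < d /\
     forall x' y' s, 0 < s < d -> Rabs (x' - x) < d -> Rabs (y' - y) < d -> P x' y' s) ->
  P a b l.
Proof.
intros Hl Hquad Hloc.
set (delta := fun x y : R =>
  let w := constructive_indefinite_description _ (Hloc x y) in
  mkposreal (proj1_sig w) (proj1 (proj2_sig w))).
destruct (compactness_value_2d a (a + l) b (b + l) delta) as [d Hd].
assert (Hsmall : forall x y s, 0 < s < d -> a <= x <= a + l -> b <= y <= b + l -> P x y s).
{ intros x y s Hs Hx Hy. apply NNPP; intros HnP. apply (Hd x y Hx Hy).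
  intros (u & v & Hu & Hv & H1 & H2 & H3). apply HnP.
  unfold delta in H1, H2, H3. simpl in H1, H2, H3.
  destruct (constructive_indefinite_description _ (Hloc u v)) as [e [He HP]].
  simpl in H1, H2, H3. apply HP; auto. lra. }
assert (Hdy : forall n s x y, 0 < s -> s < d -> a <= x -> x + 2 ^ n * s <= a + l ->
   b <= y -> y + 2 ^ n * s <= b + l -> P x y (2 ^ n * s)).
{ induction n as [|n IH]; intros s x y Hs Hsd H1 H2 H3 H4.
  - simpl in *. rewrite Rmult_1_l. apply Hsmall; lra.
  - assert (Hp : 0 < 2 ^ n * s) by (apply Rmult_lt_0_compat; [apply pow_lt; lra|exact Hs]).
    replace (2 ^ S n * s) with (2 * (2 ^ n * s)) in * by (simpl; ring).
    apply Hquad; [exact Hp| | | |]; apply IH; lra. }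
assert (Hdp : 0 < d) by apply cond_pos.
destruct (Pow_x_infinity 2 ltac:(rewrite Rabs_pos_eq; lra) (l / d + 1)) as [n Hn].
specialize (Hn n (le_n n)). rewrite Rabs_pos_eq in Hn by (apply pow_le; lra).
assert (Hp : 0 < 2 ^ n) by (apply pow_lt; lra).
assert (Hld : l < 2 ^ n * d).
{ assert (l / d * d = l) by (field; lra). nra. }
replace l with (2 ^ n * (l / 2 ^ n)) by (field; lra).
apply Hdy; try lra.
- now apply Rdiv_lt_0_compat.
- apply Rmult_lt_reg_r with (2 ^ n); [exact Hp|]. unfold Rdiv.
  rewrite Rmult_assoc, Rinv_l by lra. lra.
- right; field; lra.
- right; field; lra.
Qed.

Definition closed_planar (D : R * R -> Prop) : Prop :=
  forall x y, ~ D (x, y) ->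
  exists d, 0 < d /\ forall x' y', Rabs (x' - x) < d -> Rabs (y' - y) < d -> ~ D (x', y').

(** Without a maximum every point of [D] is beaten by another one, and one point
    can be chosen to beat a whole neighbourhood; the best of four points beats a
    square if each beats a quarter.  [square_induction] yields a point that beats all
    of [D], itself included. *)
Lemma compact_max (D : R * R -> Prop) (q : R * R -> R) (M : R) (z0 : R * R) :
  D z0 -> closed_planar D ->
  (forall x y, D (x, y) -> Rabs x < M /\ Rabs y < M) ->
  continuous_on D q ->
  exists x y, D (x, y) /\ forall z, D z -> q z <= q (x, y).
Proof.
intros Hz0 Hcl Hbd Hq.
apply NNPP; intros Hno.
assert (Hup : forall z, D z -> exists z', D z' /\ q z < q z').
{ intros [x y] Hz. apply NNPP; intros Hn. apply Hno. exists x, y; split; [exact Hz|].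
  intros z' Hz'. apply Rnot_lt_le; intros Hlt. apply Hn. exists z'; auto. }
assert (HM : 0 < M).
{ destruct z0 as [x y]. destruct (Hbd x y Hz0). generalize (Rabs_pos x); lra. }
set (P := fun a b s => exists z', D z' /\
   forall x y, a <= x <= a + s -> b <= y <= b + s -> D (x, y) -> q (x, y) < q z').
assert (HP : P (- M) (- M) (2 * M)).
{ apply square_induction; [lra| |].
  - intros a b s Hs (z1 & D1 & B1) (z2 & D2 & B2) (z3 & D3 & B3) (z4 & D4 & B4).
    assert (Hmax : exists z', D z' /\ q z1 <= q z' /\ q z2 <= q z' /\ q z3 <= q z' /\ q z4 <= q z').
    { destruct (Rle_dec (q z1) (q z2)), (Rle_dec (q z3) (q z4)).
      - destruct (Rle_dec (q z2) (q z4)); [exists z4|exists z2]; repeat split; auto; lra.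
      - destruct (Rle_dec (q z2) (q z3)); [exists z3|exists z2]; repeat split; auto; lra.
      - destruct (Rle_dec (q z1) (q z4)); [exists z4|exists z1]; repeat split; auto; lra.
      - destruct (Rle_dec (q z1) (q z3)); [exists z3|exists z1]; repeat split; auto; lra. }
    destruct Hmax as (z' & Dz & G1 & G2 & G3 & G4). exists z'; split; [exact Dz|].
    intros x y Hx Hy HD.
    destruct (Rle_dec x (a + s)), (Rle_dec y (b + s)).
    + specialize (B1 x y ltac:(lra) ltac:(lra) HD). lra.
    + specialize (B3 x y ltac:(lra) ltac:(lra) HD). lra.
    + specialize (B2 x y ltac:(lra) ltac:(lra) HD). lra.
    + specialize (B4 x y ltac:(lra) ltac:(lra) HD). lra.
  - intros x y. destruct (classic (D (x, y))) as [HD|HD].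
    + destruct (Hup _ HD) as (z' & Dz & Hlt).
      destruct (continuous_on_eps D q x y (q z' - q (x, y)) Hq HD ltac:(lra)) as (d & Hd & H).
      exists (d / 2); split; [lra|]. intros a b s Hs Ha Hb. exists z'; split; [exact Dz|].
      intros x' y' Hx Hy HD'. apply Rabs_def2 in Ha. apply Rabs_def2 in Hb.
      specialize (H x' y' HD' ltac:(apply Rabs_def1; lra) ltac:(apply Rabs_def1; lra)).
      apply Rabs_def2 in H. lra.
    + destruct (Hcl x y HD) as (d & Hd & H).
      exists (d / 2); split; [lra|]. intros a b s Hs Ha Hb. exists z0; split; [exact Hz0|].
      intros x' y' Hx Hy HD'. apply Rabs_def2 in Ha. apply Rabs_def2 in Hb.
      destruct (H x' y' ltac:(apply Rabs_def1; lra) ltac:(apply Rabs_def1; lra) HD'). }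
destruct HP as (z' & Dz & H). destruct (Hup _ Dz) as ([x y] & Dz2 & Hlt).
destruct (Hbd x y Dz2) as [Bx By]. apply Rabs_def2 in Bx. apply Rabs_def2 in By.
destruct (Hbd (fst z') (snd z')) as [Bx' By']; [destruct z'; exact Dz|].
specialize (H x y ltac:(lra) ltac:(lra) Dz2). lra.
Qed.

Lemma closed_set_le (D : R * R -> Prop) (q r : R * R -> R) :
  closed_planar D -> continuous_on D q -> continuous_on D r ->
  closed_planar (fun z => D z /\ q z <= r z).
Proof.
intros Hcl Hq Hr x y Hn.
destruct (classic (D (x, y))) as [HD|HD].
- assert (Hlt : r (x, y) < q (x, y)) by (apply Rnot_le_lt; intros H; apply Hn; split; auto).
  assert (He : 0 < (q (x, y) - r (x, y)) / 2) by lra.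
  destruct (continuous_on_eps _ _ _ _ _ Hq HD He) as (d1 & Hd1 & H1).
  destruct (continuous_on_eps _ _ _ _ _ Hr HD He) as (d2 & Hd2 & H2).
  exists (Rmin d1 d2); split; [now apply Rmin_pos|].
  intros x' y' Hx Hy [HD' Hle].
  Rmin_facts.
  specialize (H1 x' y' HD' ltac:(lra) ltac:(lra)). specialize (H2 x' y' HD' ltac:(lra) ltac:(lra)).
  apply Rabs_def2 in H1. apply Rabs_def2 in H2. lra.
- destruct (Hcl x y HD) as (d & Hd & H). exists d; split; [exact Hd|].
  intros x' y' Hx Hy [HD' _]. exact (H x' y' Hx Hy HD').
Qed.

Lemma closed_set_everything : closed_planar (fun _ => True).
Proof. intros x y H. destruct (H I). Qed.

Lemma closed_set_inter (D E : R * R -> Prop) :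
  closed_planar D -> closed_planar E -> closed_planar (fun z => D z /\ E z).
Proof.
intros HD HE x y Hn. destruct (classic (D (x, y))) as [Hd|Hd].
- destruct (HE x y ltac:(intros He; apply Hn; auto)) as (d & Hdp & H).
  exists d; split; [exact Hdp|]. intros x' y' Hx Hy [_ He]. exact (H x' y' Hx Hy He).
- destruct (HD x y Hd) as (d & Hdp & H).
  exists d; split; [exact Hdp|]. intros x' y' Hx Hy [He _]. exact (H x' y' Hx Hy He).
Qed.

Lemma closed_set_closure (A : R * R -> Prop) : closed_planar (closure A).
Proof.
intros x y Hn. apply NNPP; intros Hno. apply Hn, closure_intro. intros d Hd.
apply NNPP; intros Hfar. apply Hno. exists (d / 2); split; [lra|].
intros x' y' Hx Hy Hc.
destruct (closure_near A x' y' (d / 2) Hc ltac:(lra)) as (x2 & y2 & H1 & H2 & H3).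
apply Hfar. exists x2, y2; split; [exact H1|].
apply Rabs_def2 in Hx. apply Rabs_def2 in Hy. apply Rabs_def2 in H2. apply Rabs_def2 in H3.
split; apply Rabs_def1; lra.
Qed.

Lemma closed_set_ext (D E : R * R -> Prop) :
  (forall z, D z <-> E z) -> closed_planar D -> closed_planar E.
Proof.
intros H HD x y Hn. destruct (HD x y) as (d & Hd & K); [now rewrite H|].
exists d; split; [exact Hd|]. intros x' y' Hx Hy He. apply H in He. exact (K x' y' Hx Hy He).
Qed.

(** * Touching comparison functions at a maximum *)

(** A function together with the two functions that are meant to be its partial
    derivatives; [C1_field] says that they are. *)
Record diff_field : Type := mkField { fv : R * R -> R; fx : R * R -> R; fy : R * R -> R }.

Definition C1_field (A : R * R -> Prop) (F : diff_field) : Prop := C1_up A (fv F) (fx F) (fy F).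

(** The equation [div (A grad P) = 0] for the matrix [A] with rows [(a, b)] and
    [(b, d)], written with its stream function [W] so that no second derivative of
    [P] occurs. *)
Record elliptic_system (A : R * R -> Prop) (P W a b d : diff_field) : Prop := {
  es_open : open A;
  es_origin : ~ A (0, 0);
  es_P : C1_field A P;
  es_W : C1_field A W;
  es_a : C1_field A a;
  es_b : C1_field A b;
  es_d : C1_field A d;
  es_eqy : forall z, punctured_closure A z -> fy W z = fv a z * fx P z + fv b z * fy P z;
  es_eqx : forall z, punctured_closure A z -> - fx W z = fv b z * fx P z + fv d z * fy P z;
  es_pos : forall z, closure A z -> 0 < fv a z;
  es_det : forall z, closure A z -> 0 < fv a z * fv d z - fv b z ^ 2
}.

Arguments es_open {_ _ _ _ _ _} _.
Arguments es_origin {_ _ _ _ _ _} _.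
Arguments es_P {_ _ _ _ _ _} _.
Arguments es_W {_ _ _ _ _ _} _.
Arguments es_a {_ _ _ _ _ _} _.
Arguments es_b {_ _ _ _ _ _} _.
Arguments es_d {_ _ _ _ _ _} _.
Arguments es_eqy {_ _ _ _ _ _} _.
Arguments es_eqx {_ _ _ _ _ _} _.
Arguments es_pos {_ _ _ _ _ _} _.
Arguments es_det {_ _ _ _ _ _} _.

Lemma continuity_2d_comp (A : R * R -> Prop) (q : R * R -> R) (X Y : R -> R -> R) r t :
  open A -> ~ A (0, 0) -> continuous_on (punctured_closure A) q -> A (X r t, Y r t) ->
  continuity_2d_pt X r t -> continuity_2d_pt Y r t ->
  continuity_2d_pt (fun r t => q (X r t, Y r t)) r t.
Proof.
intros HA HO Hq Hz HX HY eps.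
destruct (continuous_on_eps _ _ _ _ _ Hq (subset_punctured A _ HO Hz) (cond_pos eps)) as (d & Hd & H).
destruct (open_square A _ _ HA Hz) as (d' & Hd' & Hs).
assert (Hm : 0 < Rmin d d') by (now apply Rmin_pos).
destruct (HX (mkposreal _ Hm)) as [e1 H1]. destruct (HY (mkposreal _ Hm)) as [e2 H2].
assert (Hn : 0 < Rmin e1 e2) by (apply Rmin_pos; apply cond_pos).
exists (mkposreal _ Hn). intros u v Hu Hv. simpl in Hu, Hv.
Rmin_facts.
specialize (H1 u v ltac:(lra) ltac:(lra)). specialize (H2 u v ltac:(lra) ltac:(lra)).
simpl in H1, H2. apply H; [|lra|lra]. apply subset_punctured; [exact HO|]. apply Hs; lra.
Qed.

Lemma interior_max_gradient (A : R * R -> Prop) (F : diff_field) x y rho :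
  open A -> ~ A (0, 0) -> C1_field A F -> A (x, y) -> 0 < rho ->
  (forall x' y', Rabs (x' - x) < rho -> Rabs (y' - y) < rho -> fv F (x', y') <= fv F (x, y)) ->
  fx F (x, y) = 0 /\ fy F (x, y) = 0.
Proof.
intros HA HO (_ & _ & _ & HF) Hz Hr Hmax. destruct (HF x y Hz) as [Dx Dy].
assert (aux : forall (h : R -> R) c l, is_derive h c l ->
  (forall t, Rabs (t - c) < rho -> h t <= h c) -> l = 0).
{ intros h c l Hh Hm. apply is_derive_Reals in Hh.
  assert (pr : derivable_pt h c) by (exists l; exact Hh).
  rewrite <- (derive_pt_eq_0 h c l pr Hh).
  apply (deriv_maximum h (c - rho) (c + rho)); [lra|lra|].
  intros t Ht1 Ht2. apply Hm. apply Rabs_def1; lra. }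
split.
- apply (aux (fun t => fv F (t, y)) x _ Dx). intros t Ht. apply Hmax; [exact Ht|].
  rewrite Rminus_diag, Rabs_R0; exact Hr.
- apply (aux (fun t => fv F (x, t)) y _ Dy). intros t Ht. apply Hmax; [|exact Ht].
  rewrite Rminus_diag, Rabs_R0; exact Hr.
Qed.

Lemma Rabs_trig_le u v t : Rabs (u * cos t + v * sin t) <= Rabs u + Rabs v.
Proof.
eapply Rle_trans; [apply Rabs_triang|]. rewrite !Rabs_mult.
assert (Rabs (cos t) <= 1) by (apply Rabs_le; apply COS_bound).
assert (Rabs (sin t) <= 1) by (apply Rabs_le; apply SIN_bound).
generalize (Rabs_pos u), (Rabs_pos v), (Rabs_pos (cos t)), (Rabs_pos (sin t)). nra.
Qed.

(** The ellipse is the image of a circle of radius [r] under the matrix with rows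
    [(S, 0)] and [(b1, T)], a square root of the coefficient matrix at the centre;
    [c] and [s] are the cosine and the sine of the parameter.  On the right is the radial
    derivative of [P + psi], up to the factor [S * T].  On the left, the first line is
    [1 / r] times the parameter derivative of [W], the next two come from the affine
    part of the conormal field [V] of [psi], and [eta] absorbs the remainder of [V] and
    the variation of the coefficients. *)
Lemma ellipse_flux_bound (S T b1 c s r eta Lam L e1 e2 : R)
  (a b d V1 V2 Px Py Gx Gy Wx Wy V10 V20 V1x V1y V2x V2y : R) :
  0 < r -> 1 <= L -> 0 < Lam ->
  Wy = a * Px + b * Py -> - Wx = b * Px + d * Py ->
  V1 = a * (Gx - Px) + b * (Gy - Py) -> V2 = b * (Gx - Px) + d * (Gy - Py) ->
  Rabs (T * c - b1 * s) <= Lam -> Rabs (S * s) <= Lam ->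
  Rabs (V1 - V10 - (V1x * (r * (S * c)) + V1y * (r * (b1 * c + T * s)))) <= e1 * (r * Lam) ->
  Rabs (V2 - V20 - (V2x * (r * (S * c)) + V2y * (r * (b1 * c + T * s)))) <= e1 * (r * Lam) ->
  Rabs (S ^ 2 - a) <= L * (r * Lam) -> Rabs (b1 * S - b) <= L * (r * Lam) ->
  Rabs (b1 ^ 2 + T ^ 2 - d) <= L * (r * Lam) ->
  Rabs Gx <= e2 -> Rabs Gy <= e2 ->
  2 * Lam ^ 2 * e1 + 4 * Lam ^ 2 * L * e2 <= eta ->
  (Wy * (T * c - b1 * s) - Wx * (S * s))
  + (V10 * (T * c - b1 * s) + V20 * (S * s))
  + r * ((T * c - b1 * s) * (V1x * (S * c) + V1y * (b1 * c + T * s))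
         + S * s * (V2x * (S * c) + V2y * (b1 * c + T * s)))
  - eta * r
  <= S * T * (Gx * (S * c) + Gy * (b1 * c + T * s)).
Proof.
intros Hr HL HLam EW1 EW2 EV1 EV2 N1 N2 B1 B2 Ba Bb Bd BX BY Heta.
set (n1 := T * c - b1 * s) in *. set (n2 := S * s) in *.
set (E1 := V1 - V10 - (V1x * (r * (S * c)) + V1y * (r * (b1 * c + T * s)))) in *.
set (E2 := V2 - V20 - (V2x * (r * (S * c)) + V2y * (r * (b1 * c + T * s)))) in *.
set (Da := S ^ 2 - a) in *. set (Db := b1 * S - b) in *. set (Dd := b1 ^ 2 + T ^ 2 - d) in *.
assert (Hid : S * T * (Gx * (S * c) + Gy * (b1 * c + T * s))
  = (Wy * n1 - Wx * n2) + (V10 * n1 + V20 * n2)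
    + r * (n1 * (V1x * (S * c) + V1y * (b1 * c + T * s)) + S * s * (V2x * (S * c) + V2y * (b1 * c + T * s)))
    + (n1 * E1 + n2 * E2) + (n1 * (Da * Gx + Db * Gy) + n2 * (Db * Gx + Dd * Gy))).
{ replace (Wy * n1 - Wx * n2) with (Wy * n1 + (- Wx) * n2) by ring.
  unfold E1, E2. rewrite EW1, EW2, EV1, EV2. unfold n1, n2, Da, Db, Dd. ring. }
rewrite Hid.
assert (prod : forall u v A B, Rabs u <= A -> Rabs v <= B -> - (A * B) <= u * v).
{ intros u v A0 B0 Hu Hv. assert (Rabs (u * v) <= A0 * B0).
  { rewrite Rabs_mult. apply Rmult_le_compat; auto using Rabs_pos. }
  generalize (Rle_abs (- (u * v))). rewrite Rabs_Ropp. lra. }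
assert (sum2 : forall u v A B, Rabs u <= A -> Rabs v <= B -> Rabs (u + v) <= A + B).
{ intros. eapply Rle_trans; [apply Rabs_triang|]. lra. }
assert (prod2 : forall u v A B, Rabs u <= A -> Rabs v <= B -> Rabs (u * v) <= A * B).
{ intros u v A0 B0 Hu Hv. rewrite Rabs_mult. apply Rmult_le_compat; auto using Rabs_pos. }
assert (I1 := prod n1 E1 _ _ N1 B1). assert (I2 := prod n2 E2 _ _ N2 B2).
assert (I3 := prod n1 _ _ _ N1 (sum2 _ _ _ _ (prod2 _ _ _ _ Ba BX) (prod2 _ _ _ _ Bb BY))).
assert (I4 := prod n2 _ _ _ N2 (sum2 _ _ _ _ (prod2 _ _ _ _ Bb BX) (prod2 _ _ _ _ Bd BY))).
assert (Htot : (2 * Lam ^ 2 * e1 + 4 * Lam ^ 2 * L * e2) * r <= eta * r) by nra.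
fold n2. lra.
Qed.

(** The conormal flux of [P] through a closed curve is the circulation of [dW],
    hence zero; if the conormal field [V] of [psi] had positive divergence at a
    maximum of [P + psi], the mean of [P + psi] over the ellipses attached to the
    coefficient matrix at that point would increase with the radius. *)
Lemma touching_lemma A P W a b d (psi V1 V2 : diff_field) x0 y0 rho :
  elliptic_system A P W a b d ->
  C1_field A psi -> C1_field A V1 -> C1_field A V2 ->
  (forall z, A z -> fv V1 z = fv a z * fx psi z + fv b z * fy psi z) ->
  (forall z, A z -> fv V2 z = fv b z * fx psi z + fv d z * fy psi z) ->
  0 < rho ->
  (forall x y, Rabs (x - x0) < rho -> Rabs (y - y0) < rho -> A (x, y) /\
     fv P (x, y) + fv psi (x, y) <= fv P (x0, y0) + fv psi (x0, y0)) ->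
  fx V1 (x0, y0) + fy V2 (x0, y0) <= 0.
Proof.
intros HS Hpsi HV1 HV2 EV1 EV2 Hrho Hmax.
assert (HA := es_open HS). assert (HO := es_origin HS).
assert (HP := es_P HS). assert (HW := es_W HS).
assert (Hz0 : A (x0, y0)) by (apply Hmax; rewrite Rminus_diag, Rabs_R0; exact Hrho).
apply Rnot_lt_le; intros Hdelta.
set (delta := fx V1 (x0, y0) + fy V2 (x0, y0)) in *.
set (G := mkField (fun z => fv P z + fv psi z) (fun z => fx P z + fx psi z) (fun z => fy P z + fy psi z)).
assert (HG : C1_field A G) by (apply C1_up_plus; assumption).
destruct (interior_max_gradient A G x0 y0 rho HA HO HG Hz0 Hrho) as [Gx0 Gy0].
{ intros x y Hx Hy. apply (Hmax x y Hx Hy). }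
assert (Ha0 := es_pos HS _ (subset_closure A _ Hz0)).
assert (Hd0 := es_det HS _ (subset_closure A _ Hz0)).
set (a0 := fv a (x0, y0)) in *. set (b0 := fv b (x0, y0)) in *. set (d0 := fv d (x0, y0)) in *.
(* Cholesky factor of the coefficient matrix at the point: rows (S, 0) and (b1, T) *)
set (S := sqrt a0). assert (HSp : 0 < S) by now apply sqrt_lt_R0.
assert (HS2 : S ^ 2 = a0) by (apply pow2_sqrt; lra).
set (b1 := b0 / S). assert (Hb1 : b1 * S = b0) by (unfold b1; field; lra).
assert (HT0 : 0 < d0 - b1 ^ 2).
{ apply Rmult_lt_reg_l with a0; [exact Ha0|]. rewrite Rmult_0_r, Rmult_minus_distr_l.
  replace (a0 * b1 ^ 2) with (b0 ^ 2) by (rewrite <- Hb1, <- HS2; ring). exact Hd0. }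
set (T := sqrt (d0 - b1 ^ 2)). assert (HTp : 0 < T) by now apply sqrt_lt_R0.
assert (HT2 : b1 ^ 2 + T ^ 2 = d0) by (unfold T; rewrite pow2_sqrt; lra).
set (Lam := 1 + S + Rabs b1 + T).
assert (Pb1 := Rabs_pos b1). assert (HLam : 1 < Lam) by (unfold Lam; lra).
set (X := fun r t => x0 + r * (S * cos t)).
set (Y := fun r t => y0 + r * (b1 * cos t + T * sin t)).
assert (HX : forall r t, Rabs (X r t - x0) <= Rabs r * Lam).
{ intros r t. unfold X. replace (x0 + r * (S * cos t) - x0) with (r * (S * cos t + 0 * sin t)) by ring.
  rewrite Rabs_mult. apply Rmult_le_compat_l; [apply Rabs_pos|].
  eapply Rle_trans; [apply Rabs_trig_le|]. rewrite Rabs_R0, Rabs_pos_eq; unfold Lam; lra. }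
assert (HY : forall r t, Rabs (Y r t - y0) <= Rabs r * Lam).
{ intros r t. unfold Y.
  replace (y0 + r * (b1 * cos t + T * sin t) - y0) with (r * (b1 * cos t + T * sin t)) by ring.
  rewrite Rabs_mult. apply Rmult_le_compat_l; [apply Rabs_pos|].
  eapply Rle_trans; [apply Rabs_trig_le|]. rewrite (Rabs_pos_eq T); unfold Lam; lra. }
assert (HN1 : forall t, Rabs (T * cos t - b1 * sin t) <= Lam).
{ intros t. replace (T * cos t - b1 * sin t) with (T * cos t + (- b1) * sin t) by ring.
  eapply Rle_trans; [apply Rabs_trig_le|]. rewrite Rabs_Ropp, (Rabs_pos_eq T); unfold Lam; lra. }
assert (HN2 : forall t, Rabs (S * sin t) <= Lam).
{ intros t. replace (S * sin t) with (0 * cos t + S * sin t) by ring.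
  eapply Rle_trans; [apply Rabs_trig_le|]. rewrite Rabs_R0, Rabs_pos_eq; unfold Lam; lra. }
(* the total error [2 * PI * eta * r] is then half of the main term [PI * S * T * delta * r] *)
set (eta := S * T * delta / 4).
assert (Heta : 0 < eta) by (unfold eta; apply Rmult_lt_0_compat; [|lra]; repeat apply Rmult_lt_0_compat; lra).
set (L := 1 + (Rabs (fx a (x0, y0)) + Rabs (fy a (x0, y0))) + (Rabs (fx b (x0, y0)) + Rabs (fy b (x0, y0)))
   + (Rabs (fx d (x0, y0)) + Rabs (fy d (x0, y0)))).
assert (HL : 1 <= L).
{ unfold L. generalize (Rabs_pos (fx a (x0, y0))), (Rabs_pos (fy a (x0, y0))), (Rabs_pos (fx b (x0, y0))),
   (Rabs_pos (fy b (x0, y0))), (Rabs_pos (fx d (x0, y0))), (Rabs_pos (fy d (x0, y0))). lra. }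
assert (HLam2 : 0 < Lam ^ 2) by nra.
(* half of [eta] for the remainder of [V], half for the variation of the coefficients *)
set (e1 := eta / (4 * Lam ^ 2)). set (e2 := eta / (8 * Lam ^ 2 * L)).
assert (He1 : 0 < e1) by (apply Rdiv_lt_0_compat; nra).
assert (He2 : 0 < e2) by (apply Rdiv_lt_0_compat; nra).
assert (Hbud : 2 * Lam ^ 2 * e1 + 4 * Lam ^ 2 * L * e2 <= eta).
{ unfold e1, e2. right. field. lra. }
assert (Hdiff : forall F, C1_field A F -> forall e, 0 < e -> exists k, 0 < k /\ forall x y,
   Rabs (x - x0) < k -> Rabs (y - y0) < k -> forall mx, Rabs (x - x0) <= mx -> Rabs (y - y0) <= mx ->
   Rabs (fv F (x, y) - fv F (x0, y0) - (fx F (x0, y0) * (x - x0) + fy F (x0, y0) * (y - y0))) <= e * mx).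
{ intros F HF e He.
  destruct (C1_up_differentiable A _ _ _ x0 y0 HA HO HF Hz0 (mkposreal e He)) as [k Hk].
  exists k; split; [apply cond_pos|]. intros x y Hx Hy mx Hmx1 Hmx2.
  eapply Rle_trans; [apply (Hk x y Hx Hy)|]. apply Rmult_le_compat_l; [simpl; lra|].
  now apply Rmax_lub. }
assert (Hlip : forall F, C1_field A F -> Rabs (fx F (x0, y0)) + Rabs (fy F (x0, y0)) + 1 <= L ->
   exists k, 0 < k /\ forall x y,
   Rabs (x - x0) < k -> Rabs (y - y0) < k -> forall mx, Rabs (x - x0) <= mx -> Rabs (y - y0) <= mx ->
   Rabs (fv F (x0, y0) - fv F (x, y)) <= L * mx).
{ intros F HF HLF. destruct (Hdiff F HF 1 Rlt_0_1) as (k & Hk & H).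
  exists k; split; [exact Hk|]. intros x y Hx Hy mx M1 M2. specialize (H x y Hx Hy mx M1 M2).
  rewrite Rabs_minus_sym.
  replace (fv F (x, y) - fv F (x0, y0)) with
    ((fv F (x, y) - fv F (x0, y0) - (fx F (x0, y0) * (x - x0) + fy F (x0, y0) * (y - y0)))
     + (fx F (x0, y0) * (x - x0) + fy F (x0, y0) * (y - y0))) by ring.
  eapply Rle_trans; [apply Rabs_triang|].
  assert (Rabs (fx F (x0, y0) * (x - x0) + fy F (x0, y0) * (y - y0))
     <= Rabs (fx F (x0, y0)) * mx + Rabs (fy F (x0, y0)) * mx).
  { eapply Rle_trans; [apply Rabs_triang|]. rewrite !Rabs_mult.
    apply Rplus_le_compat; apply Rmult_le_compat_l; auto using Rabs_pos. }
  assert (0 <= mx) by (eapply Rle_trans; [apply Rabs_pos|exact M1]). nra. }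
assert (PP : forall F, 0 <= Rabs (fx F (x0, y0)) /\ 0 <= Rabs (fy F (x0, y0))) by (intros; split; apply Rabs_pos).
assert (Pa := PP a). assert (Pb := PP b). assert (Pd := PP d).
destruct (Hlip a (es_a HS)) as (ka & Hka & La); [unfold L; lra|].
destruct (Hlip b (es_b HS)) as (kb & Hkb & Lb); [unfold L; lra|].
destruct (Hlip d (es_d HS)) as (kd & Hkd & Ld); [unfold L; lra|].
destruct (Hdiff V1 HV1 e1 He1) as (k1 & Hk1 & D1).
destruct (Hdiff V2 HV2 e1 He1) as (k2 & Hk2 & D2).
assert (Hp0 := subset_punctured A _ HO Hz0).
destruct (continuous_on_eps _ _ _ _ e2 (proj1 (proj2 HG)) Hp0 He2) as (k3 & Hk3 & G1).
destruct (continuous_on_eps _ _ _ _ e2 (proj1 (proj2 (proj2 HG))) Hp0 He2) as (k4 & Hk4 & G2).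
assert (Hk : exists k, 0 < k /\ k <= rho /\ k <= ka /\ k <= kb /\ k <= kd /\ k <= k1 /\ k <= k2 /\ k <= k3 /\ k <= k4).
{ exists (Rmin rho (Rmin (Rmin (Rmin ka kb) (Rmin kd k1)) (Rmin k2 (Rmin k3 k4)))).
  split; [repeat apply Rmin_pos; assumption|].
  Rmin_facts. repeat split; lra. }
destruct Hk as (k & Hk0 & Kr & Ka & Kb & Kd & K1 & K2 & K3 & K4).
set (r1 := k / Lam). assert (Hr1 : 0 < r1) by (apply Rdiv_lt_0_compat; lra).
assert (Hin : forall r t, Rabs r < r1 -> Rabs (X r t - x0) < k /\ Rabs (Y r t - y0) < k).
{ intros r t Hr. assert (Rabs r * Lam < k).
  { apply Rlt_le_trans with (r1 * Lam); [apply Rmult_lt_compat_r; lra|]. unfold r1. right; field; lra. }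
  specialize (HX r t). specialize (HY r t). lra. }
assert (HAin : forall r t, Rabs r < r1 -> A (X r t, Y r t)).
{ intros r t Hr. destruct (Hin r t Hr). apply Hmax; lra. }
set (I := fun r t => fx G (X r t, Y r t) * (S * cos t) + fy G (X r t, Y r t) * (b1 * cos t + T * sin t)).
assert (HdX : forall r t, is_derive (fun r => X r t) r (S * cos t)).
{ intros r t. unfold X. auto_derive; [exact Logic.I|ring]. }
assert (HdY : forall r t, is_derive (fun r => Y r t) r (b1 * cos t + T * sin t)).
{ intros r t. unfold Y. auto_derive; [exact Logic.I|ring]. }
assert (HI : forall r t, Rabs r < r1 -> is_derive (fun r => fv G (X r t, Y r t)) r (I r t)).
{ intros r t Hr.
  apply (C1_up_chain A _ _ _ (fun r => X r t) (fun r => Y r t)); auto. }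
assert (HcX : forall r t, continuity_2d_pt X r t).
{ intros r t. unfold X. apply continuity_2d_pt_plus; [apply continuity_2d_pt_const|].
  apply continuity_2d_pt_mult; [apply continuity_2d_pt_id1|].
  apply continuity_2d_pt_mult; [apply continuity_2d_pt_const|].
  apply (continuity_1d_2d_pt_comp cos (fun _ t => t)); [apply continuity_cos|apply continuity_2d_pt_id2]. }
assert (HcT : forall u v r t, continuity_2d_pt (fun _ t => u * cos t + v * sin t) r t).
{ intros u v r t. apply continuity_2d_pt_plus; apply continuity_2d_pt_mult; try apply continuity_2d_pt_const.
  - apply (continuity_1d_2d_pt_comp cos (fun _ t => t)); [apply continuity_cos|apply continuity_2d_pt_id2].
  - apply (continuity_1d_2d_pt_comp sin (fun _ t => t)); [apply continuity_sin|apply continuity_2d_pt_id2]. }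
assert (HcY : forall r t, continuity_2d_pt Y r t).
{ intros r t. unfold Y. apply continuity_2d_pt_plus; [apply continuity_2d_pt_const|].
  apply continuity_2d_pt_mult; [apply continuity_2d_pt_id1|]. apply HcT. }
assert (HcI : forall r t, Rabs r < r1 -> continuity_2d_pt I r t).
{ intros r t Hr. unfold I. apply continuity_2d_pt_plus; apply continuity_2d_pt_mult.
  - apply (continuity_2d_comp A); auto. apply HG.
  - apply (continuity_2d_pt_ext (fun _ t => S * cos t + 0 * sin t)); [intros; ring|apply HcT].
  - apply (continuity_2d_comp A); auto. apply HG.
  - apply HcT. }
assert (Hsec : forall (f : R -> R -> R) r t, continuity_2d_pt f r t -> continuous (f r) t).
{ intros f r t Hf. apply filterlim_locally. intros eps. destruct (Hf eps) as [e He].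
  exists e. intros t' Ht'. apply (He r t'); [|exact Ht']. rewrite Rminus_diag, Rabs_R0. apply cond_pos. }
set (m := fun r => RInt (fun t => fv G (X r t, Y r t)) 0 (2 * PI)).
assert (HexG : forall r, Rabs r < r1 -> ex_RInt (fun t => fv G (X r t, Y r t)) 0 (2 * PI)).
{ intros r Hr. apply (ex_RInt_continuous (V := R_CompleteNormedModule)). intros t _.
  apply (Hsec (fun r t => fv G (X r t, Y r t))).
  apply (continuity_2d_comp A); auto. apply (C1_up_cont0 _ _ _ _ HG). }
assert (Hball : forall r, Rabs r < r1 -> exists e : posreal, forall u, Rabs (u - r) < e -> Rabs u < r1).
{ intros r Hr. assert (He : 0 < r1 - Rabs r) by lra. exists (mkposreal _ He). intros u Hu. simpl in Hu.
  replace u with ((u - r) + r) by ring. eapply Rle_lt_trans; [apply Rabs_triang|]. lra. }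
assert (Hm : forall r, Rabs r < r1 -> is_derive m r (RInt (I r) 0 (2 * PI))).
{ intros r Hr. destruct (Hball r Hr) as [e He].
  replace (RInt (I r) 0 (2 * PI))
    with (RInt (fun t => Derive (fun u => fv G (X u t, Y u t)) r) 0 (2 * PI)).
  2:{ apply RInt_ext. intros t _. apply is_derive_unique, HI, Hr. }
  apply (is_derive_RInt_param (fun r t => fv G (X r t, Y r t))).
  - exists e. intros u Hu t _. exists (I u t). apply HI, He, Hu.
  - intros t _. apply (continuity_2d_pt_ext_loc I); [|apply HcI, Hr].
    exists e. intros u v Hu _. symmetry. apply is_derive_unique, HI, He, Hu.
  - exists e. intros u Hu. apply HexG, He, Hu. }
assert (Hgrow : forall r, 0 < r < r1 -> 0 < RInt (I r) 0 (2 * PI)).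
{ intros r [Hr0 Hr]. assert (Hra : Rabs r < r1) by (rewrite Rabs_pos_eq; lra).
  set (V10 := fv V1 (x0, y0)) in *. set (V20 := fv V2 (x0, y0)) in *.
  set (V1x := fx V1 (x0, y0)) in *. set (V1y := fy V1 (x0, y0)) in *.
  set (V2x := fx V2 (x0, y0)) in *. set (V2y := fy V2 (x0, y0)) in *.
  set (F' := fun t =>
    (fy W (X r t, Y r t) * (T * cos t - b1 * sin t) - fx W (X r t, Y r t) * (S * sin t))
    + (V10 * (T * cos t - b1 * sin t) + V20 * (S * sin t))
    + r * ((T * cos t - b1 * sin t) * (V1x * (S * cos t) + V1y * (b1 * cos t + T * sin t))
         + S * sin t * (V2x * (S * cos t) + V2y * (b1 * cos t + T * sin t)))
    - eta * r).
  set (c1 := T * (V1x * S + V1y * b1)).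
  set (c2 := T * (V1y * T) - b1 * (V1x * S + V1y * b1) + S * (V2x * S + V2y * b1)).
  set (c3 := S * (V2y * T) - b1 * (V1y * T)).
  set (F0 := fun t => V10 * (T * sin t + b1 * cos t) - V20 * (S * cos t)
    + r * (c1 * ((t + sin t * cos t) / 2) + c2 * (sin t ^ 2 / 2) + c3 * ((t - sin t * cos t) / 2))
    - eta * r * t).
  set (F := fun t => / r * fv W (X r t, Y r t) + F0 t).
  assert (HF : forall t, is_derive F t (F' t)).
  { intros t.
    assert (D1W : is_derive (fun t => fv W (X r t, Y r t)) t
      (fx W (X r t, Y r t) * (- r * (S * sin t)) + fy W (X r t, Y r t) * (r * (T * cos t - b1 * sin t)))).
    { apply (C1_up_chain A _ _ _ (X r) (Y r)); auto.
      - unfold X. auto_derive; [exact Logic.I|ring].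
      - unfold Y. auto_derive; [exact Logic.I|ring]. }
    assert (D0 : is_derive F0 t (F' t - (fy W (X r t, Y r t) * (T * cos t - b1 * sin t) - fx W (X r t, Y r t) * (S * sin t)))).
    { unfold F0. auto_derive; [exact Logic.I|]. unfold F', c1, c2, c3.
      assert (Hcs : sin t * sin t = 1 - cos t * cos t) by (generalize (sin2_cos2 t); unfold Rsqr; lra).
      simpl. field_simplify. rewrite ?Rmult_1_r.
      replace (sin t ^ 2) with (1 - cos t * cos t) by (simpl; lra). field. }
    replace (F' t) with (plus (scal (/ r) (fx W (X r t, Y r t) * (- r * (S * sin t)) + fy W (X r t, Y r t) * (r * (T * cos t - b1 * sin t))))
      (F' t - (fy W (X r t, Y r t) * (T * cos t - b1 * sin t) - fx W (X r t, Y r t) * (S * sin t)))).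
    2:{ unfold plus, scal; simpl. unfold mult; simpl. field. lra. }
    apply (is_derive_plus (fun t => / r * fv W (X r t, Y r t)) F0); [|exact D0].
    apply (is_derive_scal (fun t => fv W (X r t, Y r t))). exact D1W. }
  assert (HcF : forall t, continuous F' t).
  { intros t.
    assert (Hc1 : continuous (fun t => fx W (X r t, Y r t)) t).
    { apply (Hsec (fun r t => fx W (X r t, Y r t))). apply (continuity_2d_comp A); auto. apply HW. }
    assert (Hc2 : continuous (fun t => fy W (X r t, Y r t)) t).
    { apply (Hsec (fun r t => fy W (X r t, Y r t))). apply (continuity_2d_comp A); auto. apply HW. }
    set (N := fun t => (V10 * (T * cos t - b1 * sin t) + V20 * (S * sin t))
    + r * ((T * cos t - b1 * sin t) * (V1x * (S * cos t) + V1y * (b1 * cos t + T * sin t))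
         + S * sin t * (V2x * (S * cos t) + V2y * (b1 * cos t + T * sin t)))
    - eta * r).
    apply (continuous_ext (fun t => (fy W (X r t, Y r t) * (T * cos t - b1 * sin t) - fx W (X r t, Y r t) * (S * sin t)) + N t)).
    { assert (E : forall u : R, (fy W (X r u, Y r u) * (T * cos u - b1 * sin u) - fx W (X r u, Y r u) * (S * sin u)) + N u = F' u)
        by (intros u; unfold N, F'; ring). exact E. }
    apply (continuous_plus (fun t => fy W (X r t, Y r t) * (T * cos t - b1 * sin t) - fx W (X r t, Y r t) * (S * sin t)) N).
    - apply (continuous_minus (fun t => fy W (X r t, Y r t) * (T * cos t - b1 * sin t)) (fun t => fx W (X r t, Y r t) * (S * sin t))).
      + apply (continuous_mult (fun t => fy W (X r t, Y r t)) (fun t => T * cos t - b1 * sin t)); [exact Hc2|].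
        apply (ex_derive_continuous (fun t => T * cos t - b1 * sin t)). auto_derive; exact Logic.I.
      + apply (continuous_mult (fun t => fx W (X r t, Y r t)) (fun t => S * sin t)); [exact Hc1|].
        apply (ex_derive_continuous (fun t => S * sin t)). auto_derive; exact Logic.I.
    - apply (ex_derive_continuous N). unfold N. auto_derive; exact Logic.I. }
  assert (HRF : is_RInt F' 0 (2 * PI) (F (2 * PI) - F 0)).
  { apply (is_RInt_derive F F'); intros; auto. }
  assert (Hval : F (2 * PI) - F 0 = r * (PI * (S * T * delta) - 2 * PI * eta)).
  { unfold F, F0, X, Y. rewrite cos_2PI, sin_2PI, cos_0, sin_0.
    unfold c1, c2, c3, delta. fold V1x V2y. field. lra. }
  assert (Hle : F (2 * PI) - F 0 <= RInt (fun t => S * T * I r t) 0 (2 * PI)).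
  { rewrite <- (is_RInt_unique _ _ _ _ HRF). apply RInt_le.
    - generalize PI_RGT_0; lra.
    - exists (F (2 * PI) - F 0); exact HRF.
    - apply (ex_RInt_continuous (V := R_CompleteNormedModule)). intros t _.
      apply (continuous_mult (fun _ => S * T) (I r)); [apply continuous_const|].
      apply (Hsec I), HcI, Hra.
    - intros t _. destruct (Hin r t Hra) as [I1 I2].
      assert (HAz := HAin r t Hra). assert (Hpz := subset_punctured A _ HO HAz).
      assert (MX := HX r t). assert (MY := HY r t). rewrite (Rabs_pos_eq r) in MX, MY by lra.
      unfold F', I.
      apply (ellipse_flux_bound S T b1 (cos t) (sin t) r eta Lam L e1 e2
        (fv a (X r t, Y r t)) (fv b (X r t, Y r t)) (fv d (X r t, Y r t))
        (fv V1 (X r t, Y r t)) (fv V2 (X r t, Y r t))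
        (fx P (X r t, Y r t)) (fy P (X r t, Y r t))); try lra; auto.
      + apply (es_eqy HS _ Hpz).
      + apply (es_eqx HS _ Hpz).
      + rewrite (EV1 _ HAz). unfold G; simpl. ring.
      + rewrite (EV2 _ HAz). unfold G; simpl. ring.
      + replace (r * (S * cos t)) with (X r t - x0) by (unfold X; ring).
        replace (r * (b1 * cos t + T * sin t)) with (Y r t - y0) by (unfold Y; ring).
        apply D1; lra.
      + replace (r * (S * cos t)) with (X r t - x0) by (unfold X; ring).
        replace (r * (b1 * cos t + T * sin t)) with (Y r t - y0) by (unfold Y; ring).
        apply D2; lra.
      + rewrite HS2. apply La; lra.
      + rewrite Hb1. apply Lb; lra.
      + rewrite HT2. apply Ld; lra.
      + apply Rlt_le. replace (fx G (X r t, Y r t)) with (fx G (X r t, Y r t) - fx G (x0, y0)) by (rewrite Gx0; ring).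
        apply G1; auto; lra.
      + apply Rlt_le. replace (fy G (X r t, Y r t)) with (fy G (X r t, Y r t) - fy G (x0, y0)) by (rewrite Gy0; ring).
        apply G2; auto; lra. }
  assert (Hsc : RInt (fun t => S * T * I r t) 0 (2 * PI) = S * T * RInt (I r) 0 (2 * PI)).
  { apply (RInt_scal (V := R_CompleteNormedModule) (I r)).
    apply (ex_RInt_continuous (V := R_CompleteNormedModule)). intros t _. apply (Hsec I), HcI, Hra. }
  rewrite Hsc, Hval in Hle.
  assert (HST : 0 < S * T) by (apply Rmult_lt_0_compat; assumption).
  assert (HPI := PI_RGT_0).
  assert (Hpos : 0 < r * (PI * (S * T * delta) - 2 * PI * eta)).
  { replace (r * (PI * (S * T * delta) - 2 * PI * eta)) with (r * PI * (S * T) * delta / 2)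
      by (unfold eta; field).
    assert (0 < r * PI) by (apply Rmult_lt_0_compat; lra).
    assert (0 < r * PI * (S * T)) by (apply Rmult_lt_0_compat; lra).
    assert (0 < r * PI * (S * T) * delta) by (apply Rmult_lt_0_compat; lra). lra. }
  apply Rmult_lt_reg_l with (S * T); [exact HST|]. lra. }
destruct (mvt_open m (fun r => RInt (I r) 0 (2 * PI)) 0 (r1 / 2)) as (r & Hr & E); [lra| | |].
{ intros s Hs. apply Hm. rewrite Rabs_pos_eq; lra. }
{ intros s Hs. apply continuity_pt_filterlim, (ex_derive_continuous m). eexists. apply Hm. rewrite Rabs_pos_eq; lra. }
specialize (Hgrow r ltac:(lra)).
assert (Hm0 : m 0 = 2 * PI * fv G (x0, y0)).
{ unfold m. rewrite (RInt_ext _ (fun _ => fv G (x0, y0))).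
  - rewrite RInt_const. unfold scal; simpl; unfold mult; simpl. ring.
  - intros t _. unfold X, Y. now rewrite !Rmult_0_l, !Rplus_0_r. }
assert (Hm1 : m (r1 / 2) <= 2 * PI * fv G (x0, y0)).
{ assert (Hrr : Rabs (r1 / 2) < r1) by (rewrite Rabs_pos_eq; lra).
  replace (2 * PI * fv G (x0, y0)) with (RInt (fun _ => fv G (x0, y0)) 0 (2 * PI)).
  - apply RInt_le; [generalize PI_RGT_0; lra|apply HexG, Hrr|apply ex_RInt_const|].
    intros t _. destruct (Hin (r1 / 2) t Hrr). apply Hmax; lra.
  - rewrite RInt_const. unfold scal; simpl; unfold mult; simpl. ring. }
assert (0 < RInt (I r) 0 (2 * PI) * (r1 / 2 - 0)) by (apply Rmult_lt_0_compat; lra).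
lra.
Qed.

(** * Hopf's boundary point lemma *)

Definition dist2 (x1 y1 : R) (z : R * R) : R := (fst z - x1) ^ 2 + (snd z - y1) ^ 2.

Lemma continuous_on_dist2 D x1 y1 : continuous_on D (dist2 x1 y1).
Proof.
apply (continuous_on_ext D (fun z => (fst z - x1) * (fst z - x1) + (snd z - y1) * (snd z - y1))).
- intros [x y] _. change ((x - x1) * (x - x1) + (y - y1) * (y - y1) = (x - x1) ^ 2 + (y - y1) ^ 2). ring.
- cont_on.
Qed.

Lemma dist2_ge0 x1 y1 z : 0 <= dist2 x1 y1 z.
Proof. apply Rplus_le_le_0_compat; apply pow2_ge_0. Qed.

Lemma disc_bounded x1 y1 r x y : 0 < r -> dist2 x1 y1 (x, y) <= r ^ 2 ->
  Rabs (x - x1) <= r /\ Rabs (y - y1) <= r.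
Proof.
unfold dist2; simpl fst; simpl snd. intros Hr H.
assert (H1 := pow2_ge_0 (x - x1)). assert (H2 := pow2_ge_0 (y - y1)).
rewrite <- (Rabs_pos_eq r) by lra.
split; apply Rsqr_le_abs_0; rewrite !Rsqr_pow2; lra.
Qed.

Lemma closed_set_disc x1 y1 (r : R) : closed_planar (fun z => dist2 x1 y1 z <= r).
Proof.
apply (closed_set_ext (fun z => True /\ dist2 x1 y1 z <= (fun _ : R * R => r) z)); [tauto|].
apply (closed_set_le (fun _ => True) (dist2 x1 y1) (fun _ => r)); [apply closed_set_everything|apply continuous_on_dist2|apply continuous_on_const].
Qed.

Lemma disc_compact_max D x1 y1 r q z0 :
  0 < r -> closed_planar D -> (forall z, D z -> dist2 x1 y1 z <= r ^ 2) -> D z0 ->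
  continuous_on D q ->
  exists x y, D (x, y) /\ forall z, D z -> q z <= q (x, y).
Proof.
intros Hr HD Hb Hz Hq. apply (compact_max D q (Rabs x1 + Rabs y1 + r + 1) z0 Hz HD); [|exact Hq].
intros x y Hxy. destruct (disc_bounded x1 y1 r x y Hr (Hb _ Hxy)) as [Bx By].
assert (P1 := Rabs_pos x1). assert (P2 := Rabs_pos y1). split.
- replace x with ((x - x1) + x1) by ring. eapply Rle_lt_trans; [apply Rabs_triang|]. lra.
- replace y with ((y - y1) + y1) by ring. eapply Rle_lt_trans; [apply Rabs_triang|]. lra.
Qed.

Lemma C1_up_fst A : C1_up A (fun z => fst z) (fun _ => 1) (fun _ => 0).
Proof.
split; [|split; [|split; [|intros x y Hz; split]]]; cont_on; simpl.
- apply (is_derive_id (K := R_AbsRing)).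
- apply (is_derive_const (V := R_NormedModule) x).
Qed.

Lemma C1_up_snd A : C1_up A (fun z => snd z) (fun _ => 0) (fun _ => 1).
Proof.
split; [|split; [|split; [|intros x y Hz; split]]]; cont_on; simpl.
- apply (is_derive_const (V := R_NormedModule) y).
- apply (is_derive_id (K := R_AbsRing)).
Qed.

(** A Gaussian: away from its centre its conormal divergence is positive once [K]
    is large. *)
Definition bump (e K x1 y1 : R) : diff_field :=
  mkField (fun z => e * exp (- K * dist2 x1 y1 z))
    (fun z => - 2 * K * (fst z - x1) * (e * exp (- K * dist2 x1 y1 z)))
    (fun z => - 2 * K * (snd z - y1) * (e * exp (- K * dist2 x1 y1 z))).

Lemma C1_bump A e K x1 y1 : C1_field A (bump e K x1 y1).
Proof.
assert (Hc : forall D, continuous_on D (fun z => e * exp (- K * dist2 x1 y1 z))).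
{ intros D. apply continuous_on_mult; [cont_on|].
  apply (continuous_on_comp D exp (fun z => - K * dist2 x1 y1 z)).
  - intros z _. apply (ex_derive_continuous exp). auto_derive; exact I.
  - apply continuous_on_mult; [cont_on|apply continuous_on_dist2]. }
split; [|split; [|split]]; simpl.
- apply Hc.
- apply continuous_on_mult; [cont_on|apply Hc].
- apply continuous_on_mult; [cont_on|apply Hc].
- intros x y _. unfold dist2; simpl fst; simpl snd. split; auto_derive; try exact I; simpl; unfold Rminus; ring.
Qed.

(** Hopf's boundary point lemma.  On the annulus between the radii [r / 2] and [r] a
    small multiple of [bump] keeps [P + psi] below its value on the outer circle, as an
    interior maximum would contradict [touching_lemma].  At the point where [P = m] the
    inward derivative of [P] is therefore at most that of [- psi], which is negative. *)
Lemma hopf_disc A P W a b d x1 y1 r m x0 y0 :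
  elliptic_system A P W a b d -> 0 < r ->
  (forall x y, dist2 x1 y1 (x, y) < r ^ 2 -> A (x, y) /\ fv P (x, y) < m) ->
  (forall z, dist2 x1 y1 z <= r ^ 2 -> punctured_closure A z /\ fv P z <= m) ->
  dist2 x1 y1 (x0, y0) = r ^ 2 -> fv P (x0, y0) = m ->
  (x1 - x0) * fx P (x0, y0) + (y1 - y0) * fy P (x0, y0) < 0.
Proof.
intros HS Hr Hin Hcl Hz0 Hm.
assert (HA := es_open HS). assert (HO := es_origin HS).
assert (HP := es_P HS).
assert (Ca := es_a HS). assert (Cb := es_b HS). assert (Cd := es_d HS).
set (D := fun z => dist2 x1 y1 z <= r ^ 2).
assert (HDcl : closed_planar D) by apply closed_set_disc.
assert (Hr2 : 0 < r ^ 2) by (apply pow_lt; exact Hr).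
assert (HDc : D (x1, y1)) by (unfold D, dist2; simpl; nra).
assert (Hsub : forall q : R * R -> R, continuous_on (punctured_closure A) q -> continuous_on D q).
{ intros q. apply continuous_on_subset. intros z Hz; apply (Hcl z Hz). }
assert (ca := Hsub _ (C1_up_cont0 _ _ _ _ Ca)). assert (cb := Hsub _ (C1_up_cont0 _ _ _ _ Cb)).
assert (cd := Hsub _ (C1_up_cont0 _ _ _ _ Cd)).
assert (cax := Hsub _ (proj1 (proj2 Ca))). assert (cay := Hsub _ (proj1 (proj2 (proj2 Ca)))).
assert (cbx := Hsub _ (proj1 (proj2 Cb))). assert (cby := Hsub _ (proj1 (proj2 (proj2 Cb)))).
assert (cdx := Hsub _ (proj1 (proj2 Cd))). assert (cdy := Hsub _ (proj1 (proj2 (proj2 Cd)))).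
assert (Hell : forall z, D z -> 0 < fv a z /\ 0 < fv d z /\ 0 < fv a z * fv d z - fv b z ^ 2).
{ intros z Hz. assert (Hc : closure A z) by (apply (Hcl z Hz)).
  assert (H1 := es_pos HS z Hc). assert (H2 := es_det HS z Hc).
  split; [exact H1|]. split; [|exact H2]. nra. }
(* the least eigenvalue is at least the determinant divided by the trace *)
assert (Hlam : exists lam, 0 < lam /\ forall z, D z -> forall u v,
  lam * (u ^ 2 + v ^ 2) <= fv a z * u ^ 2 + 2 * fv b z * u * v + fv d z * v ^ 2).
{ set (q := fun z => - ((fv a z * fv d z - fv b z * fv b z) / (fv a z + fv d z))).
  destruct (disc_compact_max D x1 y1 r q (x1, y1) Hr HDcl (fun z Hz => Hz) HDc) as (xm & ym & HDm & Hmx).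
  { unfold q. apply continuous_on_opp, continuous_on_div; cont_on.
    intros z Hz. destruct (Hell z Hz) as (H1 & H2 & _). lra. }
  exists (- q (xm, ym)). split.
  - unfold q. rewrite Ropp_involutive. destruct (Hell _ HDm) as (H1 & H2 & H3).
    apply Rdiv_lt_0_compat; [simpl in H3; lra|lra].
  - intros z Hz u v. destruct (Hell z Hz) as (H1 & H2 & H3). specialize (Hmx z Hz).
    assert (Hq : - q z * (u ^ 2 + v ^ 2) <= fv a z * u ^ 2 + 2 * fv b z * u * v + fv d z * v ^ 2).
    { apply Rmult_le_reg_l with (fv a z + fv d z); [lra|].
      unfold q. rewrite Ropp_involutive.
      replace ((fv a z + fv d z) * ((fv a z * fv d z - fv b z * fv b z) / (fv a z + fv d z) * (u ^ 2 + v ^ 2)))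
        with ((fv a z * fv d z - fv b z * fv b z) * (u ^ 2 + v ^ 2)) by (field; lra).
      replace ((fv a z + fv d z) * (fv a z * u ^ 2 + 2 * fv b z * u * v + fv d z * v ^ 2))
        with ((fv a z * fv d z - fv b z * fv b z) * (u ^ 2 + v ^ 2)
          + ((fv a z * u + fv b z * v) ^ 2 + (fv b z * u + fv d z * v) ^ 2)) by ring.
      generalize (pow2_ge_0 (fv a z * u + fv b z * v)), (pow2_ge_0 (fv b z * u + fv d z * v)). lra. }
    eapply Rle_trans; [|exact Hq]. apply Rmult_le_compat_r; [|lra].
    generalize (pow2_ge_0 u), (pow2_ge_0 v). lra. }
destruct Hlam as (lam & Hlam0 & Hlam).
set (tr := fun z => fv a z + fv d z + (fx a z + fy b z) * (fst z - x1) + (fx b z + fy d z) * (snd z - y1)).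
assert (HC : exists C, 0 < C /\ forall z, D z -> tr z <= C).
{ destruct (disc_compact_max D x1 y1 r tr (x1, y1) Hr HDcl (fun z Hz => Hz) HDc) as (xm & ym & HDm & Hmx).
  { unfold tr. cont_on. }
  exists (Rabs (tr (xm, ym)) + 1). split; [generalize (Rabs_pos (tr (xm, ym))); lra|].
  intros z Hz. specialize (Hmx z Hz). generalize (Rle_abs (tr (xm, ym))). lra. }
destruct HC as (C & HC0 & HC).
(* on the annulus the second-order part is at least [K * lam * r ^ 2 / 2], which is [2 * C] *)
set (K := 4 * C / (lam * r ^ 2)).
assert (Hlr : 0 < lam * r ^ 2) by (apply Rmult_lt_0_compat; assumption).
assert (HK : 0 < K) by (apply Rdiv_lt_0_compat; lra).
assert (HKr : K * (lam * r ^ 2) = 4 * C) by (unfold K; field; split; nra).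
assert (Hgap : exists dl, 0 < dl /\ forall z, dist2 x1 y1 z <= (r / 2) ^ 2 -> fv P z <= m - dl).
{ destruct (disc_compact_max (fun z => dist2 x1 y1 z <= (r / 2) ^ 2) x1 y1 (r / 2) (fv P) (x1, y1))
    as (xm & ym & HDm & Hmx); [lra|apply closed_set_disc|auto|unfold dist2; simpl; nra| |].
  { revert Hsub. intros Hs. apply (continuous_on_subset D); [intros z Hz; unfold D; nra|].
    apply Hs, (C1_up_cont0 _ _ _ _ HP). }
  exists (m - fv P (xm, ym)). split.
  - assert (H := proj2 (Hin xm ym ltac:(nra))). lra.
  - intros z Hz. specialize (Hmx z Hz). lra. }
destruct Hgap as (dl & Hdl & Hgap).
set (psi := bump dl K x1 y1).
set (lev := dl * exp (- K * r ^ 2)).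
assert (Hlev : 0 < lev) by (apply Rmult_lt_0_compat; [exact Hdl|apply exp_pos]).
assert (Hpsi1 : forall z, fv psi z <= dl).
{ intros z. simpl. rewrite <- (Rmult_1_r dl) at 2. apply Rmult_le_compat_l; [lra|].
  rewrite <- exp_0. destruct (Rle_lt_or_eq_dec (- K * dist2 x1 y1 z) 0) as [Hl|Hl].
  - generalize (dist2_ge0 x1 y1 z). nra.
  - left. now apply exp_increasing.
  - rewrite Hl. lra. }
assert (Cpsi : C1_field A psi) by apply C1_bump.
set (V1 := mkField
  (fun z => (fv a z * (fst z - x1) + fv b z * (snd z - y1)) * (- 2 * K * fv psi z))
  (fun z => (fx a z * (fst z - x1) + fv a z + fx b z * (snd z - y1)) * (- 2 * K * fv psi z)
     + (fv a z * (fst z - x1) + fv b z * (snd z - y1)) * (- 2 * K * fx psi z))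
  (fun z => (fy a z * (fst z - x1) + fv b z + fy b z * (snd z - y1)) * (- 2 * K * fv psi z)
     + (fv a z * (fst z - x1) + fv b z * (snd z - y1)) * (- 2 * K * fy psi z))).
set (V2 := mkField
  (fun z => (fv b z * (fst z - x1) + fv d z * (snd z - y1)) * (- 2 * K * fv psi z))
  (fun z => (fx b z * (fst z - x1) + fv b z + fx d z * (snd z - y1)) * (- 2 * K * fv psi z)
     + (fv b z * (fst z - x1) + fv d z * (snd z - y1)) * (- 2 * K * fx psi z))
  (fun z => (fy b z * (fst z - x1) + fv d z + fy d z * (snd z - y1)) * (- 2 * K * fv psi z)
     + (fv b z * (fst z - x1) + fv d z * (snd z - y1)) * (- 2 * K * fy psi z))).
assert (CX : C1_up A (fun z => fst z - x1) (fun _ => 1) (fun _ => 0)).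
{ apply (C1_up_ext A _ _ _ _ _ _ (C1_up_plus A _ _ _ _ _ _ (C1_up_fst A) (C1_up_const A (- x1)))); auto;
  intros; ring. }
assert (CY : C1_up A (fun z => snd z - y1) (fun _ => 0) (fun _ => 1)).
{ apply (C1_up_ext A _ _ _ _ _ _ (C1_up_plus A _ _ _ _ _ _ (C1_up_snd A) (C1_up_const A (- y1)))); auto;
  intros; ring. }
assert (CV1 : C1_field A V1).
{ unfold C1_field.
  refine (C1_up_ext A _ _ _ _ _ _ (C1_up_mult A _ _ _ _ _ _
    (C1_up_plus A _ _ _ _ _ _ (C1_up_mult A _ _ _ _ _ _ Ca CX) (C1_up_mult A _ _ _ _ _ _ Cb CY))
    (C1_up_scal A (- 2 * K) _ _ _ Cpsi)) HO _ _ _ HA); intros z _; simpl; ring. }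
assert (CV2 : C1_field A V2).
{ unfold C1_field.
  refine (C1_up_ext A _ _ _ _ _ _ (C1_up_mult A _ _ _ _ _ _
    (C1_up_plus A _ _ _ _ _ _ (C1_up_mult A _ _ _ _ _ _ Cb CX) (C1_up_mult A _ _ _ _ _ _ Cd CY))
    (C1_up_scal A (- 2 * K) _ _ _ Cpsi)) HO _ _ _ HA); intros z _; simpl; ring. }
assert (Hcmp : forall z, (r / 2) ^ 2 <= dist2 x1 y1 z -> dist2 x1 y1 z <= r ^ 2 ->
  fv P z + fv psi z <= m + lev).
{ intros zb Hzb1 Hzb2. apply Rnot_lt_le; intros Hlt.
  set (An := fun z => D z /\ (fun _ => (r / 2) ^ 2) z <= dist2 x1 y1 z).
  destruct (disc_compact_max An x1 y1 r (fun z => fv P z + fv psi z) zb) as (xm & ym & [HDm HDm'] & Hmx); auto.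
  { apply closed_set_le; [exact HDcl|apply continuous_on_const|apply continuous_on_dist2]. }
  { intros z [Hz _]; exact Hz. }
  { split; auto. }
  { apply (continuous_on_subset D); [intros z Hz; apply Hz|]. apply Hsub.
    apply continuous_on_plus; [apply (C1_up_cont0 _ _ _ _ HP)|apply (C1_up_cont0 _ _ _ _ Cpsi)]. }
  assert (Hbig : m + lev < fv P (xm, ym) + fv psi (xm, ym)).
  { eapply Rlt_le_trans; [exact Hlt|]. apply Hmx. split; auto. }
  assert (Hout : dist2 x1 y1 (xm, ym) < r ^ 2).
  { destruct (Rle_lt_or_eq_dec _ _ HDm) as [H|H]; [exact H|exfalso].
    assert (fv psi (xm, ym) = lev) by (simpl; rewrite H; reflexivity).
    assert (H2 := proj2 (Hcl _ HDm)). lra. }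
  assert (Hinn : (r / 2) ^ 2 < dist2 x1 y1 (xm, ym)).
  { destruct (Rle_lt_or_eq_dec _ _ HDm') as [H|H]; [exact H|exfalso].
    assert (H2 := Hgap (xm, ym) ltac:(lra)). assert (H3 := Hpsi1 (xm, ym)). lra. }
  set (gap := Rmin (r ^ 2 - dist2 x1 y1 (xm, ym)) (dist2 x1 y1 (xm, ym) - (r / 2) ^ 2)).
  assert (Hgp : 0 < gap) by (apply Rmin_pos; lra).
  destruct (continuous_on_eps (fun _ => True) (dist2 x1 y1) xm ym gap (continuous_on_dist2 _ _ _) I Hgp)
    as (rho & Hrho & Hnear).
  assert (HdivV := touching_lemma A P W a b d psi V1 V2 xm ym rho HS Cpsi CV1 CV2).
  assert (Hfin : fx V1 (xm, ym) + fy V2 (xm, ym) <= 0).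
  { apply HdivV; [| |exact Hrho|].
    - intros z _. simpl. ring.
    - intros z _. simpl. ring.
    - intros x y Hx Hy. assert (Hd := Hnear x y I Hx Hy). apply Rabs_def2 in Hd.
      assert (G1 : gap <= r ^ 2 - dist2 x1 y1 (xm, ym)) by apply Rmin_l.
      assert (G2 : gap <= dist2 x1 y1 (xm, ym) - (r / 2) ^ 2) by apply Rmin_r.
      split; [apply Hin; lra|]. apply (Hmx (x, y)). unfold An, D; lra. }
  assert (Hpp : 0 < fv psi (xm, ym)) by (simpl; apply Rmult_lt_0_compat; [exact Hdl|apply exp_pos]).
  assert (HQ := Hlam _ HDm (xm - x1) (ym - y1)). assert (HT := HC _ HDm).
  set (Q := fv a (xm, ym) * (xm - x1) ^ 2 + 2 * fv b (xm, ym) * (xm - x1) * (ym - y1) + fv d (xm, ym) * (ym - y1) ^ 2) in *.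
  assert (Heq : fx V1 (xm, ym) + fy V2 (xm, ym) = fv psi (xm, ym) * (2 * K) * (2 * K * Q - tr (xm, ym))).
  { unfold Q, tr. simpl. ring. }
  rewrite Heq in Hfin.
  assert (HQ2 : lam * (r / 2) ^ 2 < Q).
  { eapply Rlt_le_trans; [|exact HQ]. apply Rmult_lt_compat_l; [exact Hlam0|]. exact Hinn. }
  assert (Hpos : 0 < 2 * K * Q - tr (xm, ym)).
  { assert (K * (lam * (r / 2) ^ 2) < K * Q) by (apply Rmult_lt_compat_l; assumption).
    replace (K * (lam * (r / 2) ^ 2)) with (K * (lam * r ^ 2) / 4) in H by field. lra. }
  assert (0 < fv psi (xm, ym) * (2 * K) * (2 * K * Q - tr (xm, ym))).
  { apply Rmult_lt_0_compat; [|exact Hpos]. apply Rmult_lt_0_compat; lra. }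
  lra. }
unfold dist2 in Hz0; simpl fst in Hz0; simpl snd in Hz0.
destruct (ray_derivative A (fv P) (fx P) (fy P) x0 y0 (x1 - x0) (y1 - y0) 1) as (H & HdH & HH); auto; try lra.
{ apply Hcl. unfold dist2; simpl fst; simpl snd. lra. }
{ intros s Hs. apply Hin. unfold dist2; simpl fst; simpl snd.
  replace (x0 + s * (x1 - x0) - x1) with ((1 - s) * (x0 - x1)) by ring.
  replace (y0 + s * (y1 - y0) - y1) with ((1 - s) * (y0 - y1)) by ring.
  rewrite !Rpow_mult_distr, <- Rmult_plus_distr_l, Hz0. nra. }
set (B := fun s => m + lev - dl * exp (- K * ((1 - s) ^ 2 * r ^ 2))).
assert (HdB : is_derive B 0 (- (2 * K * r ^ 2 * lev))).
{ unfold B, lev. auto_derive; [exact I|].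
  replace ((1 + - 0) * ((1 + - 0) * 1) * (r * (r * 1))) with (r ^ 2) by ring. ring. }
assert (HHB : forall s, 0 <= s <= 1 / 2 -> H s <= B s).
{ intros s Hs. rewrite (HH s) by lra.
  assert (E : dist2 x1 y1 (x0 + s * (x1 - x0), y0 + s * (y1 - y0)) = (1 - s) ^ 2 * r ^ 2).
  { unfold dist2; simpl fst; simpl snd. rewrite <- Hz0. ring. }
  assert (Hcm := Hcmp (x0 + s * (x1 - x0), y0 + s * (y1 - y0))). rewrite E in Hcm.
  assert ((r / 2) ^ 2 <= (1 - s) ^ 2 * r ^ 2).
  { replace ((r / 2) ^ 2) with (/ 4 * r ^ 2) by field. apply Rmult_le_compat_r; [lra|nra]. }
  assert ((1 - s) ^ 2 * r ^ 2 <= r ^ 2).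
  { rewrite <- (Rmult_1_l (r ^ 2)) at 2. apply Rmult_le_compat_r; [lra|nra]. }
  specialize (Hcm ltac:(lra) ltac:(lra)). simpl fv in Hcm. rewrite E in Hcm. unfold B. lra. }
assert (HH0 : H 0 = m) by (rewrite HH by lra; rewrite !Rmult_0_l, !Rplus_0_r; exact Hm).
assert (HB0 : B 0 = m).
{ unfold B, lev. replace ((1 - 0) ^ 2 * r ^ 2) with (r ^ 2) by ring. ring. }
assert (Hle : (x1 - x0) * fx P (x0, y0) + (y1 - y0) * fy P (x0, y0) <= - (2 * K * r ^ 2 * lev)).
{ set (l := (x1 - x0) * fx P (x0, y0) + (y1 - y0) * fy P (x0, y0)) in *.
  assert (Hd : is_derive (fun s => H s - B s) 0 (l - - (2 * K * r ^ 2 * lev))) by (apply (is_derive_minus H B); assumption).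
  assert (l - - (2 * K * r ^ 2 * lev) <= 0); [|lra].
  apply (right_derivative_le _ _ _ (1 / 2) Hd); [lra|]. intros s Hs. specialize (HHB s ltac:(lra)). lra. }
assert (0 < K * r ^ 2) by (apply Rmult_lt_0_compat; assumption).
assert (0 < K * r ^ 2 * lev) by (apply Rmult_lt_0_compat; assumption).
lra.
Qed.

(** * The strong maximum principle *)

(** Otherwise, around a point close by where [P < m], the largest disc free of
    maximum points touches one of them, where the gradient vanishes; this contradicts
    [hopf_disc]. *)
Lemma maximum_spreads A P W a b d m x0 y0 :
  elliptic_system A P W a b d -> (forall z, A z -> fv P z <= m) ->
  A (x0, y0) -> fv P (x0, y0) = m ->
  exists rho, 0 < rho /\ forall x y, Rabs (x - x0) < rho -> Rabs (y - y0) < rho -> fv P (x, y) = m.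
Proof.
intros HS Hle Hz0 Hm.
assert (HA := es_open HS). assert (HO := es_origin HS).
assert (HP := es_P HS).
destruct (open_square A x0 y0 HA Hz0) as (k & Hk & Hsq).
exists (k / 4); split; [lra|]. intros x1 y1 Hx1 Hy1. apply NNPP; intros Hne.
assert (Hz1 : A (x1, y1)) by (apply Hsq; lra).
assert (Hlt : fv P (x1, y1) < m) by (specialize (Hle _ Hz1); lra).
assert (Hd0 : dist2 x1 y1 (x0, y0) <= (k / 2) ^ 2).
{ unfold dist2; simpl fst; simpl snd.
  replace ((x0 - x1) ^ 2) with (Rsqr (x1 - x0)) by (unfold Rsqr; ring).
  replace ((y0 - y1) ^ 2) with (Rsqr (y1 - y0)) by (unfold Rsqr; ring).
  assert (B : forall u, Rabs u < k / 4 -> Rsqr u <= Rsqr (k / 4)).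
  { intros u Hu. apply Rsqr_le_abs_1. rewrite (Rabs_pos_eq (k / 4)); lra. }
  assert (B1 := B _ Hx1). assert (B2 := B _ Hy1). unfold Rsqr in *.
  assert (0 < k * k) by (apply Rmult_lt_0_compat; lra). lra. }
assert (Hdisc : forall x y, dist2 x1 y1 (x, y) <= (k / 2) ^ 2 -> A (x, y)).
{ intros x y Hxy. destruct (disc_bounded x1 y1 (k / 2) x y ltac:(lra) Hxy) as [B1 B2].
  apply Hsq.
  - replace (x - x0) with ((x - x1) + (x1 - x0)) by ring. eapply Rle_lt_trans; [apply Rabs_triang|]. lra.
  - replace (y - y0) with ((y - y1) + (y1 - y0)) by ring. eapply Rle_lt_trans; [apply Rabs_triang|]. lra. }
set (E := fun z => dist2 x1 y1 z <= (k / 2) ^ 2 /\ (fun _ => m) z <= fv P z).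
assert (HcP : continuous_on (fun z => dist2 x1 y1 z <= (k / 2) ^ 2) (fv P)).
{ apply (continuous_on_subset (punctured_closure A)); [|apply (C1_up_cont0 _ _ _ _ HP)].
  intros [x y] Hz. apply subset_punctured; auto. }
destruct (disc_compact_max E x1 y1 (k / 2) (fun z => - dist2 x1 y1 z) (x0, y0)) as (xs & ys & [Es1 Es2] & Hmin).
- lra.
- apply closed_set_le; [apply closed_set_disc|apply continuous_on_const|exact HcP].
- intros z [Hz _]; exact Hz.
- split; [exact Hd0|lra].
- apply continuous_on_opp, continuous_on_dist2.
- assert (HAs := Hdisc _ _ Es1). assert (Hms : fv P (xs, ys) = m) by (specialize (Hle _ HAs); lra).
  assert (Hpos : 0 < dist2 x1 y1 (xs, ys)).
  { destruct (Rle_lt_or_eq_dec _ _ (dist2_ge0 x1 y1 (xs, ys))) as [H|H]; [exact H|exfalso].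
    unfold dist2 in H; simpl fst in H; simpl snd in H.
    assert (P1 := pow2_ge_0 (xs - x1)). assert (P2 := pow2_ge_0 (ys - y1)).
    assert (E1 : (xs - x1) ^ 2 = 0) by lra. assert (E2 : (ys - y1) ^ 2 = 0) by lra.
    rewrite <- Rsqr_pow2 in E1, E2. apply Rsqr_0_uniq in E1. apply Rsqr_0_uniq in E2.
    replace xs with x1 in Hms by lra. replace ys with y1 in Hms by lra. lra. }
  set (r := sqrt (dist2 x1 y1 (xs, ys))).
  assert (Hr : 0 < r) by now apply sqrt_lt_R0.
  assert (Hr2 : r ^ 2 = dist2 x1 y1 (xs, ys)) by (apply pow2_sqrt; lra).
  assert (Hh := hopf_disc A P W a b d x1 y1 r m xs ys HS Hr).
  rewrite Hr2 in Hh.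
  destruct (open_square A xs ys HA HAs) as (e & He & Hes).
  destruct (interior_max_gradient A P xs ys e HA HO HP HAs He) as [G1 G2].
  { intros x y Hx Hy. rewrite Hms. apply Hle, Hes; assumption. }
  rewrite G1, G2, !Rmult_0_r, Rplus_0_r in Hh.
  apply (Rlt_irrefl 0), Hh; auto.
  + intros x y Hd. assert (HAx : A (x, y)) by (apply Hdisc; lra). split; [exact HAx|].
    apply Rnot_le_lt; intros Hge. specialize (Hmin (x, y)). 
    assert (- dist2 x1 y1 (x, y) <= - dist2 x1 y1 (xs, ys)) by (apply Hmin; split; [lra|exact Hge]). lra.
  + intros [x y] Hd. assert (HAx : A (x, y)) by (apply Hdisc; lra).
    split; [now apply subset_punctured|now apply Hle].
Qed.

(** The parameters up to which the maximum is attained form a set that is closed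
    by continuity and open by [maximum_spreads]. *)
Lemma maximum_along_curve A P W a b d m (X Y : R -> R) s0 s1 :
  elliptic_system A P W a b d -> (forall z, A z -> fv P z <= m) -> s0 <= s1 ->
  (forall s, s0 <= s <= s1 -> A (X s, Y s) /\ continuous X s /\ continuous Y s) ->
  fv P (X s0, Y s0) = m -> fv P (X s1, Y s1) = m.
Proof.
intros HS Hle Hs01 Hcurve H0.
assert (HP := es_P HS). assert (HA := es_open HS).
assert (HO := es_origin HS).
set (S := fun s => s0 <= s <= s1 /\ forall t, s0 <= t <= s -> fv P (X t, Y t) = m).
assert (HS0 : S s0).
{ split; [lra|]. intros t Ht. replace t with s0 by lra. exact H0. }
destruct (completeness S) as [c [Hub Hlub]].
{ exists s1. intros s [Hs _]; lra. }
{ exists s0; exact HS0. }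
assert (Hc : s0 <= c <= s1).
{ split; [apply Hub, HS0|]. apply Hlub. intros s [Hs _]; lra. }
destruct (Hcurve c Hc) as (HAc & CX & CY).
assert (Hbelow : forall t, s0 <= t < c -> fv P (X t, Y t) = m).
{ intros t Ht. apply NNPP; intros Hne.
  assert (c <= t); [|lra]. apply Hlub. intros s [Hs Hst].
  apply Rnot_lt_le; intros Hlt. apply Hne, Hst. lra. }
assert (Hcm : fv P (X c, Y c) = m).
{ destruct (Req_dec s0 c) as [<-|Hne]; [exact H0|].
  assert (Hcle := Hle _ HAc). apply Rle_antisym; [exact Hcle|]. apply Rnot_lt_le; intros Hlt.
  destruct (continuous_on_eps _ _ _ _ (m - fv P (X c, Y c)) (C1_up_cont0 _ _ _ _ HP)
    (subset_punctured A _ HO HAc) ltac:(lra)) as (k & Hk & Hnear).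
  destruct (proj1 (filterlim_locally _ _) CX (mkposreal k Hk)) as [e1 E1].
  destruct (proj1 (filterlim_locally _ _) CY (mkposreal k Hk)) as [e2 E2].
  assert (P1 := cond_pos e1). assert (P2 := cond_pos e2).
  set (e := Rmin (Rmin (e1 / 2) (e2 / 2)) (c - s0)).
  assert (He : 0 < e) by (repeat apply Rmin_pos; lra).
  assert (L1 : e <= Rmin (e1 / 2) (e2 / 2)) by apply Rmin_l.
  assert (L2 : e <= c - s0) by apply Rmin_r.
  Rmin_facts.
  set (t := c - e). assert (Ht : s0 <= t < c) by (unfold t; lra).
  assert (Habs : Rabs (t - c) = e) by (unfold t; replace (c - e - c) with (- e) by ring; rewrite Rabs_Ropp; apply Rabs_pos_eq; lra).
  assert (B1 : Rabs (X t - X c) < k) by (apply (E1 t); change (Rabs (t - c) < e1); lra).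
  assert (B2 : Rabs (Y t - Y c) < k) by (apply (E2 t); change (Rabs (t - c) < e2); lra).
  assert (HAt : A (X t, Y t)) by (apply Hcurve; lra).
  specialize (Hnear _ _ (subset_punctured A _ HO HAt) B1 B2). rewrite (Hbelow t Ht) in Hnear.
  rewrite Rabs_pos_eq in Hnear; lra. }
destruct (Req_dec c s1) as [<-|Hne]; [exact Hcm|exfalso].
destruct (maximum_spreads A P W a b d m (X c) (Y c) HS Hle HAc Hcm) as (k & Hk & Hloc).
destruct (proj1 (filterlim_locally _ _) CX (mkposreal k Hk)) as [e1 E1].
destruct (proj1 (filterlim_locally _ _) CY (mkposreal k Hk)) as [e2 E2].
assert (P1 := cond_pos e1). assert (P2 := cond_pos e2).
set (e := Rmin (Rmin (e1 / 2) (e2 / 2)) (s1 - c)).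
assert (He : 0 < e) by (repeat apply Rmin_pos; lra).
assert (L1 : e <= Rmin (e1 / 2) (e2 / 2)) by apply Rmin_l.
assert (L2 : e <= s1 - c) by apply Rmin_r.
Rmin_facts.
assert (S (c + e)); [|assert (c + e <= c) by (apply Hub; assumption); lra].
split; [lra|]. intros t Ht. destruct (Rlt_le_dec t c) as [Htc|Htc]; [apply Hbelow; lra|].
assert (Habs : Rabs (t - c) <= e) by (rewrite Rabs_pos_eq; lra).
apply Hloc.
- apply (E1 t); change (Rabs (t - c) < e1); lra.
- apply (E2 t); change (Rabs (t - c) < e2); lra.
Qed.

(** [hopf_disc] in local coordinates: [(n1, n2)] is an inward normal and [k] times
    it leads to the centre of the tangent disc. *)
Lemma hopf_tangent_disc A P W a b d m x0 y0 k n1 n2 :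
  elliptic_system A P W a b d -> punctured_closure A (x0, y0) ->
  (forall z, A z -> fv P z < m) -> fv P (x0, y0) = m ->
  0 < k -> 0 < n1 ^ 2 + n2 ^ 2 ->
  (forall xi eta, xi <> 0 \/ eta <> 0 -> xi ^ 2 + eta ^ 2 <= 2 * k * (n1 * xi + n2 * eta) ->
     A (x0 + xi, y0 + eta)) ->
  n1 * fx P (x0, y0) + n2 * fy P (x0, y0) < 0.
Proof.
intros HS Hz0 Hlt Hm Hk Hn Hin.
assert (HO := es_origin HS).
set (r := k * sqrt (n1 ^ 2 + n2 ^ 2)).
assert (Hr : 0 < r) by (apply Rmult_lt_0_compat; [exact Hk|now apply sqrt_lt_R0]).
assert (Hr2 : r ^ 2 = k ^ 2 * (n1 ^ 2 + n2 ^ 2)).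
{ unfold r. rewrite Rpow_mult_distr, pow2_sqrt by lra. reflexivity. }
assert (Hdist : forall x y, dist2 (x0 + k * n1) (y0 + k * n2) (x, y) =
  (x - x0) ^ 2 + (y - y0) ^ 2 - 2 * k * (n1 * (x - x0) + n2 * (y - y0)) + r ^ 2).
{ intros x y. rewrite Hr2. unfold dist2; simpl fst; simpl snd. ring. }
assert (HinA : forall x y, dist2 (x0 + k * n1) (y0 + k * n2) (x, y) <= r ^ 2 ->
   x <> x0 \/ y <> y0 -> A (x, y)).
{ intros x y Hd Hne. rewrite Hdist in Hd.
  replace x with (x0 + (x - x0)) by ring. replace y with (y0 + (y - y0)) by ring.
  apply Hin; [|lra]. destruct Hne as [H|H]; [left|right]; lra. }
assert (H := hopf_disc A P W a b d (x0 + k * n1) (y0 + k * n2) r m x0 y0 HS Hr).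
assert (Hfin : (x0 + k * n1 - x0) * fx P (x0, y0) + (y0 + k * n2 - y0) * fy P (x0, y0) < 0).
{ apply H; [| | |exact Hm].
  - intros x y Hd. assert (HAx : A (x, y)).
    { apply HinA; [lra|]. apply NNPP; intros Hc. apply not_or_and in Hc. destruct Hc as [E1 E2].
      apply NNPP in E1. apply NNPP in E2. subst x y. rewrite Hdist in Hd.
      replace (x0 - x0) with 0 in Hd by ring. replace (y0 - y0) with 0 in Hd by ring. lra. }
    split; [exact HAx|now apply Hlt].
  - intros [x y] Hd. destruct (classic (x <> x0 \/ y <> y0)) as [Hne|Heq].
    + assert (HAx := HinA _ _ Hd Hne). split; [now apply subset_punctured|]. apply Rlt_le; now apply Hlt.
    + apply not_or_and in Heq. destruct Heq as [E1 E2]. apply NNPP in E1. apply NNPP in E2. subst x y.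
      split; [exact Hz0|lra].
  - rewrite Hdist. ring. }
replace ((x0 + k * n1 - x0) * fx P (x0, y0) + (y0 + k * n2 - y0) * fy P (x0, y0))
  with (k * (n1 * fx P (x0, y0) + n2 * fy P (x0, y0))) in Hfin by ring.
apply Rnot_le_lt; intros Hc. assert (0 <= k * (n1 * fx P (x0, y0) + n2 * fy P (x0, y0))); [|lra].
apply Rmult_le_pos; lra.
Qed.

(** * The wedge and the front *)

(** The geometric part of [transonic_shock_solution]. *)
Record front_in_wedge (theta : R) (f : R -> R) : Prop := {
  fw_angle : 0 < theta < PI / 2;
  fw_regular : regular_front f;
  fw_origin : f 0 = 0;
  fw_between : forall y : R, 0 < y -> 0 < f y < y * cot theta
}.

Arguments fw_angle {_ _} _.
Arguments fw_regular {_ _} _.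
Arguments fw_origin {_ _} _.
Arguments fw_between {_ _} _.

Lemma fw_tan theta f : front_in_wedge theta f -> 0 < tan theta.
Proof. intros H. destruct (fw_angle H). apply tan_gt_0; lra. Qed.

Lemma fw_cot theta f : front_in_wedge theta f -> cot theta = / tan theta.
Proof.
intros H. destruct (fw_angle H). unfold cot, tan.
assert (0 < sin theta) by (apply sin_gt_0; lra). assert (0 < cos theta) by (apply cos_gt_0; lra).
field. lra.
Qed.

Lemma fw_below theta f y : front_in_wedge theta f -> 0 < y -> 0 < f y /\ f y * tan theta < y.
Proof.
intros H Hy. assert (Ht := fw_tan _ _ H). destruct (fw_between H y Hy) as [H1 H2].
split; [exact H1|]. rewrite (fw_cot _ _ H) in H2.
apply (Rmult_lt_compat_r (tan theta)) in H2; [|exact Ht].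
rewrite Rmult_assoc, Rinv_l, Rmult_1_r in H2 by lra. exact H2.
Qed.

Lemma fw_derive theta f y : front_in_wedge theta f -> 0 < y -> is_derive f y (Derive f y).
Proof. intros H Hy. apply Derive_correct. apply (proj2 (fw_regular H) y Hy). Qed.

Lemma fw_derive2 theta f y : front_in_wedge theta f -> 0 < y -> ex_derive (Derive f) y.
Proof. intros H Hy. apply (proj2 (fw_regular H) y Hy). Qed.

Lemma fw_continuous theta f y eps : front_in_wedge theta f -> 0 <= y -> 0 < eps ->
  exists d, 0 < d /\ forall y', 0 <= y' -> Rabs (y' - y) < d -> Rabs (f y' - f y) < eps.
Proof.
intros H Hy He. destruct (proj1 (filterlim_locally _ _) (proj1 (fw_regular H) y Hy) (mkposreal eps He)) as [d Hd].
exists d; split; [apply cond_pos|]. intros y' Hy' Hyd. apply (Hd y' Hyd Hy').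
Qed.

Lemma Dplus_iff theta f x y : front_in_wedge theta f ->
  Dplus theta f (x, y) <-> 0 < y /\ f y < x /\ x * tan theta < y.
Proof.
intros H. assert (Ht := fw_tan _ _ H). unfold Dplus, Defs.domain; simpl. split.
- intros [[H1 H2] H3]. assert (0 < x * tan theta) by (apply Rmult_lt_0_compat; lra). lra.
- intros (H1 & H2 & H3). destruct (fw_below theta f y H H1). lra.
Qed.

Lemma Dminus_iff theta f x y : front_in_wedge theta f ->
  Dminus theta f (x, y) <-> 0 < y /\ 0 < x < f y.
Proof.
intros H. assert (Ht := fw_tan _ _ H). unfold Dminus, Defs.domain; simpl. split.
- intros [[H1 H2] H3]. assert (0 < x * tan theta) by (apply Rmult_lt_0_compat; lra). lra.
- intros (H1 & H2 & H3). destruct (fw_below theta f y H H1).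
  assert (x * tan theta < f y * tan theta) by (apply Rmult_lt_compat_r; lra). lra.
Qed.

Lemma open_Dplus theta f : front_in_wedge theta f -> open (Dplus theta f).
Proof.
intros H [x y] Hz. assert (Ht := fw_tan _ _ H). apply (Dplus_iff _ _ _ _ H) in Hz as (H1 & H2 & H3).
apply locally_square.
destruct (fw_continuous theta f y ((x - f y) / 2) H ltac:(lra) ltac:(lra)) as (d & Hd & Hf).
set (g := (y - x * tan theta) / (2 * (1 + tan theta))).
assert (Hg : 0 < g) by (apply Rdiv_lt_0_compat; lra).
assert (Hg2 : g * (1 + tan theta) * 2 = y - x * tan theta) by (unfold g; field; lra).
exists (Rmin (Rmin d y) (Rmin ((x - f y) / 2) g)). split; [repeat apply Rmin_pos; lra|].
intros x' y' Hx Hy.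
Rmin_facts.
apply (Dplus_iff _ _ _ _ H).
assert (Hy2 := Hy). apply Rabs_def2 in Hy2. apply Rabs_def2 in Hx.
specialize (Hf y' ltac:(lra) ltac:(lra)). apply Rabs_def2 in Hf.
split; [lra|]. split; [lra|]. nra.
Qed.

Lemma open_Dminus theta f : front_in_wedge theta f -> open (Dminus theta f).
Proof.
intros H [x y] Hz. apply (Dminus_iff _ _ _ _ H) in Hz as (H1 & H2 & H3).
apply locally_square.
destruct (fw_continuous theta f y ((f y - x) / 2) H ltac:(lra) ltac:(lra)) as (d & Hd & Hf).
exists (Rmin (Rmin d y) (Rmin ((f y - x) / 2) x)). split; [repeat apply Rmin_pos; lra|].
intros x' y' Hx Hy.
Rmin_facts.
apply (Dminus_iff _ _ _ _ H).
assert (Hy2 := Hy). apply Rabs_def2 in Hy2. apply Rabs_def2 in Hx.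
specialize (Hf y' ltac:(lra) ltac:(lra)). apply Rabs_def2 in Hf. lra.
Qed.

Lemma Dplus_origin theta f : ~ Dplus theta f (0, 0).
Proof. intros [[H _] _]. simpl in H. lra. Qed.

Lemma Dminus_origin theta f : ~ Dminus theta f (0, 0).
Proof. intros [[H _] _]. simpl in H. lra. Qed.

(** Both regions lie between two graphs [l <= x <= u] that meet only at the origin.
    A boundary point off the origin is approached from the midpoint of its horizontal
    section. *)
Lemma closure_between_graphs (A : R * R -> Prop) (l u : R -> R) x y :
  (forall x y, A (x, y) <-> 0 < y /\ l y < x < u y) ->
  (forall y, 0 < y -> l y < u y) -> l 0 = 0 -> u 0 = 0 ->
  (forall y eps, 0 <= y -> 0 < eps -> exists d, 0 < d /\ forall y', 0 <= y' -> Rabs (y' - y) < d ->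
     Rabs (l y' - l y) < eps /\ Rabs (u y' - u y) < eps) ->
  closure A (x, y) <-> 0 <= y /\ l y <= x <= u y.
Proof.
intros HA Hlu Hl0 Hu0 Hc. split.
- intros Hcl.
  assert (Hy : 0 <= y).
  { apply Rnot_lt_le; intros Hy. destruct (closure_near A x y (- y) Hcl ltac:(lra)) as (x' & y' & H1 & H2 & H3).
    apply HA in H1. apply Rabs_def2 in H3. lra. }
  split; [exact Hy|]. split; apply Rnot_lt_le; intros Hlt.
  + destruct (Hc y ((l y - x) / 2) Hy ltac:(lra)) as (d & Hd & Hcd).
    destruct (closure_near A x y (Rmin d ((l y - x) / 2)) Hcl) as (x' & y' & H1 & H2 & H3); [apply Rmin_pos; lra|].
    Rmin_facts.
    apply HA in H1. destruct (Hcd y' ltac:(lra) ltac:(lra)) as [C1 C2].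
    apply Rabs_def2 in H2. apply Rabs_def2 in C1. lra.
  + destruct (Hc y ((x - u y) / 2) Hy ltac:(lra)) as (d & Hd & Hcd).
    destruct (closure_near A x y (Rmin d ((x - u y) / 2)) Hcl) as (x' & y' & H1 & H2 & H3); [apply Rmin_pos; lra|].
    Rmin_facts.
    apply HA in H1. destruct (Hcd y' ltac:(lra) ltac:(lra)) as [C1 C2].
    apply Rabs_def2 in H2. apply Rabs_def2 in C2. lra.
- intros (Hy & Hx1 & Hx2). apply closure_intro. intros d Hd.
  destruct (Rle_lt_or_eq_dec 0 y Hy) as [Hyp|<-].
  + assert (Hm := Hlu y Hyp). set (xm := (l y + u y) / 2).
    set (s := Rmin 1 (d / (1 + Rabs (xm - x)))).
    assert (Ha := Rabs_pos (xm - x)).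
    assert (Hs : 0 < s) by (apply Rmin_pos; [lra|apply Rdiv_lt_0_compat; lra]).
    assert (Hs1 : s <= 1) by apply Rmin_l.
    assert (Hs2 : s * (1 + Rabs (xm - x)) <= d).
    { apply Rle_trans with (d / (1 + Rabs (xm - x)) * (1 + Rabs (xm - x))); [|right; field; lra].
      apply Rmult_le_compat_r; [lra|apply Rmin_r]. }
    exists (x + s * (xm - x)), y. split; [|split].
    * apply HA. assert (E : xm * 2 = l y + u y) by (unfold xm; field). split; [exact Hyp|]. nra.
    * replace (x + s * (xm - x) - x) with (s * (xm - x)) by ring.
      rewrite Rabs_mult, (Rabs_pos_eq s) by lra. nra.
    * rewrite Rminus_diag, Rabs_R0. exact Hd.
  + rewrite Hl0 in Hx1. rewrite Hu0 in Hx2. replace x with 0 by lra.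
    destruct (Hc 0 d ltac:(lra) Hd) as (e & He & Hcd).
    set (y' := Rmin (e / 2) (d / 2)). assert (Hy' : 0 < y') by (apply Rmin_pos; lra).
    assert (L1 : y' <= e / 2) by apply Rmin_l. assert (L2 : y' <= d / 2) by apply Rmin_r.
    assert (Hlu' := Hlu y' Hy').
    destruct (Hcd y' ltac:(lra)) as [C1 C2]; [rewrite Rabs_pos_eq; lra|].
    rewrite Hl0 in C1. rewrite Hu0 in C2. apply Rabs_def2 in C1. apply Rabs_def2 in C2.
    exists ((l y' + u y') / 2), y'. split; [|split].
    * apply HA. lra.
    * apply Rabs_def1; lra.
    * rewrite Rabs_pos_eq; lra.
Qed.

Lemma closure_Dplus_iff theta f x y : front_in_wedge theta f ->
  closure (Dplus theta f) (x, y) <-> 0 <= y /\ f y <= x /\ x * tan theta <= y.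
Proof.
intros H. assert (Ht := fw_tan _ _ H).
assert (Hdiv : forall a b, a * tan theta < b <-> a < b / tan theta).
{ intros a b. split; intros Hab.
  - apply Rmult_lt_reg_r with (tan theta); [exact Ht|]. unfold Rdiv. rewrite Rmult_assoc, Rinv_l; lra.
  - apply (Rmult_lt_compat_r (tan theta)) in Hab; [|exact Ht]. unfold Rdiv in Hab.
    rewrite Rmult_assoc, Rinv_l in Hab; lra. }
rewrite (closure_between_graphs (Dplus theta f) f (fun y => y / tan theta) x y).
- split; intros (H1 & H2 & H3); repeat split; auto.
  + apply Rnot_lt_le; intros Hlt. assert (~ x < y / tan theta) by (rewrite <- Hdiv; lra).
    assert (x = y / tan theta) by lra. subst x. unfold Rdiv in Hlt. rewrite Rmult_assoc, Rinv_l in Hlt; lra.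
  + apply Rnot_lt_le; intros Hlt. assert (~ x * tan theta < y) by (rewrite Hdiv; lra).
    assert (E : y = x * tan theta) by lra. rewrite E in Hlt. unfold Rdiv in Hlt. rewrite Rmult_assoc, Rinv_r in Hlt; lra.
- intros x' y'. rewrite (Dplus_iff _ _ _ _ H), Hdiv. tauto.
- intros y' Hy'. apply Hdiv. apply (fw_below _ _ _ H Hy').
- apply (fw_origin H).
- unfold Rdiv. ring.
- intros y' eps Hy' He. destruct (fw_continuous theta f y' eps H Hy' He) as (d & Hd & Hf).
  exists (Rmin d (eps * tan theta)). split; [apply Rmin_pos; [exact Hd|apply Rmult_lt_0_compat; lra]|].
  intros y2 Hy2 Hyd. Rmin_facts.
  split; [apply Hf; lra|].
  replace (y2 / tan theta - y' / tan theta) with ((y2 - y') / tan theta) by (field; lra).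
  unfold Rdiv. rewrite Rabs_mult, Rabs_inv, (Rabs_pos_eq (tan theta)) by lra.
  apply Rmult_lt_reg_r with (tan theta); [exact Ht|]. rewrite Rmult_assoc, Rinv_l; lra.
Qed.

Lemma closure_Dminus_iff theta f x y : front_in_wedge theta f ->
  closure (Dminus theta f) (x, y) <-> 0 <= y /\ 0 <= x <= f y.
Proof.
intros H. apply (closure_between_graphs (Dminus theta f) (fun _ => 0) f).
- intros x' y'. apply (Dminus_iff _ _ _ _ H).
- intros y' Hy'. apply (fw_below _ _ _ H Hy').
- reflexivity.
- apply (fw_origin H).
- intros y' eps Hy' He. destruct (fw_continuous theta f y' eps H Hy' He) as (d & Hd & Hf).
  exists d; split; [exact Hd|]. intros y2 H2 H3. split; [|now apply Hf].
  rewrite Rminus_diag, Rabs_R0. exact He.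
Qed.

(** This yields the interior tangent disc at a point of the front. *)
Lemma quadratic_bound (f f' : R -> R) y0 :
  locally y0 (fun y => is_derive f y (f' y)) -> ex_derive f' y0 ->
  exists C d, 0 < C /\ 0 < d /\ forall e, Rabs e < d -> Rabs (f (y0 + e) - f y0 - f' y0 * e) <= C * e ^ 2.
Proof.
intros [d0 Hd0] [l Hl]. apply is_derive_Reals in Hl. destruct (Hl 1 Rlt_0_1) as [d1 Hd1].
assert (P0 := cond_pos d0). assert (P1 := cond_pos d1).
exists (Rabs l + 1), (Rmin d0 d1). split; [generalize (Rabs_pos l); lra|]. split; [now apply Rmin_pos|].
intros e He. Rmin_facts.
destruct (Req_dec e 0) as [->|Hne].
{ rewrite Rplus_0_r. replace (f y0 - f y0 - f' y0 * 0) with 0 by ring. rewrite Rabs_R0. lra. }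
assert (HB : forall y, Rmin y0 (y0 + e) <= y <= Rmax y0 (y0 + e) -> Rabs (y - y0) <= Rabs e).
{ intros y Hy. replace e with (y0 + e - y0) by ring. now apply Rabs_between. }
destruct (MVT_gen f y0 (y0 + e) f') as (c & Hc & E).
- intros y Hy. apply Hd0. change (Rabs (y - y0) < d0). specialize (HB y ltac:(lra)). lra.
- intros y Hy. apply continuity_pt_filterlim, (ex_derive_continuous f). exists (f' y).
  apply Hd0. change (Rabs (y - y0) < d0). specialize (HB y ltac:(lra)). lra.
- rewrite E. replace (f' c * (y0 + e - y0) - f' y0 * e) with ((f' c - f' y0) * e) by ring.
  rewrite Rabs_mult. assert (Hce := HB c Hc).
  assert (Hlip : Rabs (f' c - f' y0) <= (Rabs l + 1) * Rabs (c - y0)).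
  { destruct (Req_dec c y0) as [->|Hcn].
    - rewrite Rminus_diag, Rabs_R0, Rminus_diag, Rabs_R0. lra.
    - specialize (Hd1 (c - y0) ltac:(lra) ltac:(lra)).
      replace (y0 + (c - y0)) with c in Hd1 by ring.
      replace (f' c - f' y0) with (((f' c - f' y0) / (c - y0) - l + l) * (c - y0)) by (field; lra).
      rewrite Rabs_mult. apply Rmult_le_compat_r; [apply Rabs_pos|].
      eapply Rle_trans; [apply Rabs_triang|]. lra. }
  replace (e ^ 2) with (Rabs e * Rabs e) by (rewrite <- Rabs_mult, Rabs_pos_eq; nra).
  rewrite <- Rmult_assoc. apply Rmult_le_compat_r; [apply Rabs_pos|].
  eapply Rle_trans; [exact Hlip|]. apply Rmult_le_compat_l; [generalize (Rabs_pos l); lra|exact Hce].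
Qed.

Lemma tangent_disc_small k n1 n2 xi eta : 0 < k -> 
  xi ^ 2 + eta ^ 2 <= 2 * k * (n1 * xi + n2 * eta) ->
  Rabs xi <= 2 * k * (Rabs n1 + Rabs n2) /\ Rabs eta <= 2 * k * (Rabs n1 + Rabs n2).
Proof.
intros Hk H.
set (M := Rmax (Rabs xi) (Rabs eta)).
assert (H1 : Rabs xi <= M) by apply Rmax_l. assert (H2 : Rabs eta <= M) by apply Rmax_r.
assert (Hp1 := Rabs_pos xi). assert (Hp2 := Rabs_pos eta).
assert (Hn1 := Rabs_pos n1). assert (Hn2 := Rabs_pos n2).
assert (HM : M ^ 2 <= xi ^ 2 + eta ^ 2).
{ rewrite <- (pow2_abs xi), <- (pow2_abs eta). unfold M, Rmax. destruct (Rle_dec (Rabs xi) (Rabs eta)); nra. }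
assert (Hlin : n1 * xi + n2 * eta <= (Rabs n1 + Rabs n2) * M).
{ assert (n1 * xi <= Rabs n1 * M) by (eapply Rle_trans; [apply Rle_abs|]; rewrite Rabs_mult; nra).
  assert (n2 * eta <= Rabs n2 * M) by (eapply Rle_trans; [apply Rle_abs|]; rewrite Rabs_mult; nra). lra. }
assert (M <= 2 * k * (Rabs n1 + Rabs n2)); [|lra].
apply Rnot_lt_le; intros Hlt.
assert (0 <= 2 * k * (Rabs n1 + Rabs n2)) by (apply Rmult_le_pos; lra).
assert (2 * k * (n1 * xi + n2 * eta) <= 2 * k * ((Rabs n1 + Rabs n2) * M)) by (apply Rmult_le_compat_l; lra).
nra.
Qed.

(** The front has a second derivative, so a small disc tangent to it from behind
    meets it only at the point of contact. *)
Lemma hopf_front theta f P W a b d m y0 :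
  front_in_wedge theta f -> elliptic_system (Dplus theta f) P W a b d -> 0 < y0 ->
  (forall z, Dplus theta f z -> fv P z < m) -> fv P (f y0, y0) = m ->
  fx P (f y0, y0) - Derive f y0 * fy P (f y0, y0) < 0.
Proof.
intros H HS Hy Hlt Hm. assert (Ht := fw_tan _ _ H). destruct (fw_below _ _ _ H Hy) as [B1 B2].
set (p := Derive f y0).
destruct (quadratic_bound f (Derive f) y0) as (C & dl & HC & Hdl & HQ).
{ exists (mkposreal y0 Hy). intros y Hyy. apply (fw_derive theta); [exact H|].
  change (Rabs (y - y0) < y0) in Hyy. apply Rabs_def2 in Hyy. lra. }
{ apply (fw_derive2 theta); assumption. }
set (g := (y0 - f y0 * tan theta) / (2 * (1 + tan theta))).
assert (Hg : 0 < g) by (apply Rdiv_lt_0_compat; lra).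
assert (Hg2 : g * (1 + tan theta) * 2 = y0 - f y0 * tan theta) by (unfold g; field; lra).
set (e := Rmin dl (Rmin g y0)). assert (He : 0 < e) by (repeat apply Rmin_pos; assumption).
assert (L1 : e <= dl) by apply Rmin_l. assert (L2 : e <= Rmin g y0) by apply Rmin_r.
Rmin_facts.
assert (Pp := Rabs_pos p).
set (k := Rmin (/ (4 * C)) (e / (4 * (1 + Rabs p)))).
assert (Hk : 0 < k) by (apply Rmin_pos; [apply Rinv_0_lt_compat; lra|apply Rdiv_lt_0_compat; lra]).
assert (Hk1 : k * C <= / 4).
{ apply Rle_trans with (/ (4 * C) * C); [apply Rmult_le_compat_r; [lra|apply Rmin_l]|right; field; lra]. }
assert (Hk2 : 2 * k * (Rabs 1 + Rabs (- p)) < e).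
{ rewrite Rabs_R1, Rabs_Ropp.
  assert (k * (4 * (1 + Rabs p)) <= e); [|lra].
  apply Rle_trans with (e / (4 * (1 + Rabs p)) * (4 * (1 + Rabs p))); [apply Rmult_le_compat_r; [lra|apply Rmin_r]|right; field; lra]. }
replace (fx P (f y0, y0) - p * fy P (f y0, y0)) with (1 * fx P (f y0, y0) + (- p) * fy P (f y0, y0)) by ring.
apply (hopf_tangent_disc (Dplus theta f) P W a b d m (f y0) y0 k 1 (- p) HS); auto.
- split; [apply (closure_Dplus_iff _ _ _ _ H); lra|]. intros E; injection E; lra.
- generalize (pow2_ge_0 (- p)); lra.
- intros xi eta Hne Hd. destruct (tangent_disc_small k 1 (- p) xi eta Hk Hd) as [S1 S2].
  assert (S3 : Rabs xi < e) by lra. assert (S4 : Rabs eta < e) by lra.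
  apply (Dplus_iff _ _ _ _ H). specialize (HQ eta ltac:(lra)). fold p in HQ.
  assert (HQ' := Rle_trans _ _ _ (Rle_abs _) HQ).
  apply Rabs_def2 in S3. apply Rabs_def2 in S4.
  split; [lra|]. split.
  + assert (Hk3 : 2 * k * (C * eta ^ 2) <= eta ^ 2 / 2).
    { generalize (pow2_ge_0 eta). nra. }
    assert (Hpos : 0 < xi ^ 2 + eta ^ 2 / 2).
    { destruct Hne as [Hn|Hn]; [generalize (pow2_gt_0 _ Hn), (pow2_ge_0 eta)|generalize (pow2_gt_0 _ Hn), (pow2_ge_0 xi)]; lra. }
    assert (0 < 2 * k * (xi - p * eta - C * eta ^ 2)) by lra.
    assert (0 < xi - p * eta - C * eta ^ 2).
    { apply Rmult_lt_reg_l with (2 * k); lra. }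
    lra.
  + assert (xi * tan theta <= g * tan theta) by (apply Rmult_le_compat_r; lra). lra.
Qed.

(** The wall is straight and lies at a positive distance from the front near each of
    its points, so small tangent discs fit in. *)
Lemma hopf_wall theta f P W a b d m x0 :
  front_in_wedge theta f -> elliptic_system (Dplus theta f) P W a b d -> 0 < x0 ->
  (forall z, Dplus theta f z -> fv P z < m) -> fv P (x0, x0 * tan theta) = m ->
  - tan theta * fx P (x0, x0 * tan theta) + fy P (x0, x0 * tan theta) < 0.
Proof.
intros H HS Hx Hlt Hm. assert (Ht := fw_tan _ _ H).
set (t := tan theta) in *. set (y0 := x0 * t) in *.
assert (Hy : 0 < y0) by (apply Rmult_lt_0_compat; lra).
destruct (fw_below _ _ _ H Hy) as [B1 B2]. fold t in B2.
assert (B3 : f y0 < x0).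
{ apply Rmult_lt_reg_r with t; [exact Ht|]. exact B2. }
destruct (fw_continuous theta f y0 ((x0 - f y0) / 2) H ltac:(lra) ltac:(lra)) as (dl & Hdl & Hf).
set (e := Rmin dl (Rmin ((x0 - f y0) / 2) y0)). assert (He : 0 < e) by (repeat apply Rmin_pos; lra).
assert (L1 : e <= dl) by apply Rmin_l. assert (L2 : e <= Rmin ((x0 - f y0) / 2) y0) by apply Rmin_r.
Rmin_facts.
set (k := e / (4 * (1 + t))).
assert (Hk : 0 < k) by (apply Rdiv_lt_0_compat; lra).
assert (Hk2 : 2 * k * (Rabs (- t) + Rabs 1) < e).
{ rewrite Rabs_R1, Rabs_Ropp, (Rabs_pos_eq t) by lra. unfold k. apply Rle_lt_trans with (e / 2); [|lra]. right; field. lra. }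
rewrite <- (Rmult_1_l (fy P (x0, y0))).
apply (hopf_tangent_disc (Dplus theta f) P W a b d m x0 y0 k (- t) 1 HS); auto.
- split; [apply (closure_Dplus_iff _ _ _ _ H); fold t y0; lra|]. intros E; injection E; lra.
- generalize (pow2_ge_0 (- t)); lra.
- intros xi eta Hne Hd. destruct (tangent_disc_small k (- t) 1 xi eta Hk Hd) as [S1 S2].
  assert (S3 : Rabs xi < e) by lra. assert (S4 : Rabs eta < e) by lra.
  apply (Dplus_iff _ _ _ _ H). fold t.
  assert (S5 := S4). apply Rabs_def2 in S3. apply Rabs_def2 in S4.
  specialize (Hf (y0 + eta) ltac:(lra)). replace (y0 + eta - y0) with eta in Hf by ring.
  specialize (Hf ltac:(lra)). apply Rabs_def2 in Hf.
  split; [lra|]. split; [lra|].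
  assert (Hpos : 0 < xi ^ 2 + eta ^ 2).
  { destruct Hne as [Hn|Hn]; [generalize (pow2_gt_0 _ Hn), (pow2_ge_0 eta)|generalize (pow2_gt_0 _ Hn), (pow2_ge_0 xi)]; lra. }
  assert (0 < - t * xi + 1 * eta) by (apply Rmult_lt_reg_l with (2 * k); lra).
  unfold y0. lra.
Qed.

(** * Jump conditions *)

Definition bernoulli (gamma : R) (U : state) : R :=
  (velx U ^ 2 + vely U ^ 2) / 2 + gamma * pres U / ((gamma - 1) * dens U).

Lemma sonic_speed_sqr gamma U : 1 < gamma -> 0 < pres U -> 0 < dens U ->
  sonic_speed gamma U ^ 2 = gamma * pres U / dens U.
Proof.
intros Hg Hp Hr. apply pow2_sqrt. apply Rlt_le, Rdiv_lt_0_compat; [|exact Hr].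
apply Rmult_lt_0_compat; lra.
Qed.

(** Eliminating the velocities from the jump conditions with the help of the common
    Bernoulli constant leaves a relation between pressures and densities, and the
    normal velocity ahead. *)
Lemma hugoniot gamma b0 df Um Up :
  1 < gamma -> 0 < pres Um -> 0 < dens Um -> 0 < dens Up -> pres Um < pres Up ->
  bernoulli gamma Um = b0 -> bernoulli gamma Up = b0 -> rankine_hugoniot df Um Up ->
  2 * dens Um * (velx Um - df * vely Um) ^ 2
    = (1 + df ^ 2) * ((gamma + 1) * pres Up + (gamma - 1) * pres Um) /\
  dens Up * ((gamma - 1) * pres Up + (gamma + 1) * pres Um)
    = dens Um * ((gamma + 1) * pres Up + (gamma - 1) * pres Um).
Proof.
destruct Um as [p1 u1 v1 r1]. destruct Up as [p2 u2 v2 r2].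
unfold bernoulli, rankine_hugoniot; simpl pres; simpl velx; simpl vely; simpl dens.
intros Hg Hp1 Hr1 Hr2 Hp B1 B2 (E1 & E2 & E3).
set (m := r1 * (u1 - df * v1)).
assert (Hm2 : m = r2 * (u2 - df * v2)) by (unfold m; lra).
assert (F2 : m * (u2 - u1) + (p2 - p1) = 0).
{ replace (m * (u2 - u1)) with (m * u2 - m * u1) by ring. rewrite Hm2 at 1. unfold m. lra. }
assert (F3 : m * (v2 - v1) - df * (p2 - p1) = 0).
{ replace (m * (v2 - v1)) with (m * v2 - m * v1) by ring. rewrite Hm2 at 1. unfold m. lra. }
assert (Hm0 : m <> 0) by (intros Hm; rewrite Hm in F2; lra).
set (X1 := u1 - df * v1) in *. set (X2 := u2 - df * v2) in *. set (S := 1 + df ^ 2).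
assert (HS : 0 < S) by (unfold S; generalize (pow2_ge_0 df); lra).
assert (HT : v2 + df * u2 = v1 + df * u1).
{ apply Rmult_eq_reg_l with m; [|exact Hm0].
  assert (K : m * (v2 - v1) + df * (m * (u2 - u1)) = 0).
  { replace (m * (v2 - v1)) with (df * (p2 - p1)) by lra. replace (m * (u2 - u1)) with (- (p2 - p1)) by lra. ring. }
  lra. }
assert (HX : m * (X2 - X1) = - S * (p2 - p1)).
{ unfold X1, X2, S. replace (m * (u2 - df * v2 - (u1 - df * v1))) with (m * (u2 - u1) - df * (m * (v2 - v1))) by ring.
  replace (m * (u2 - u1)) with (- (p2 - p1)) by lra. replace (m * (v2 - v1)) with (df * (p2 - p1)) by lra. ring. }
set (t1 := / r1). set (t2 := / r2).
assert (Ht1 : 0 < t1) by now apply Rinv_0_lt_compat. assert (Ht2 : 0 < t2) by now apply Rinv_0_lt_compat.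
assert (HX1 : X1 = m * t1) by (unfold m, t1; field; lra).
assert (HX2 : X2 = m * t2) by (rewrite Hm2; unfold t2; field; lra).
assert (HB : (X2 ^ 2 - X1 ^ 2) * (gamma - 1) + 2 * S * gamma * (p2 * t2 - p1 * t1) = 0).
{ assert (K1 : S * (u1 ^ 2 + v1 ^ 2) = X1 ^ 2 + (v1 + df * u1) ^ 2) by (unfold S, X1; ring).
  assert (K2 : S * (u2 ^ 2 + v2 ^ 2) = X2 ^ 2 + (v1 + df * u1) ^ 2) by (rewrite <- HT; unfold S, X2; ring).
  assert (K3 : X2 ^ 2 - X1 ^ 2 = S * ((u2 ^ 2 + v2 ^ 2) - (u1 ^ 2 + v1 ^ 2))) by lra.
  rewrite K3.
  replace (u2 ^ 2 + v2 ^ 2) with (2 * (b0 - gamma * p2 / ((gamma - 1) * r2))) by lra.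
  replace (u1 ^ 2 + v1 ^ 2) with (2 * (b0 - gamma * p1 / ((gamma - 1) * r1))) by lra.
  unfold t1, t2. field. lra. }
assert (HmS : m ^ 2 * (t1 - t2) = S * (p2 - p1)).
{ rewrite HX1, HX2 in HX. lra. }
assert (Hh : (p2 - p1) * (t1 + t2) * (gamma - 1) = 2 * gamma * (p2 * t2 - p1 * t1)).
{ apply Rmult_eq_reg_l with S; [|lra]. rewrite HX1, HX2 in HB.
  replace (S * ((p2 - p1) * (t1 + t2) * (gamma - 1))) with (S * (p2 - p1) * ((t1 + t2) * (gamma - 1))) by ring.
  rewrite <- HmS. lra. }
assert (HH : t2 * ((gamma + 1) * p2 + (gamma - 1) * p1) = t1 * ((gamma - 1) * p2 + (gamma + 1) * p1)) by lra.
split.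
- set (N := (gamma + 1) * p2 + (gamma - 1) * p1) in *.
  assert (HN : N * (t1 - t2) = 2 * t1 * (p2 - p1)).
  { replace (N * (t1 - t2)) with (N * t1 - t2 * N) by ring. rewrite HH. unfold N. ring. }
  apply Rmult_eq_reg_r with (p2 - p1); [|lra].
  replace (S * N * (p2 - p1)) with (N * (S * (p2 - p1))) by ring. rewrite <- HmS.
  replace (N * (m ^ 2 * (t1 - t2))) with (m ^ 2 * (N * (t1 - t2))) by ring. rewrite HN, HX1.
  unfold t1. field. lra.
- replace (r2 * ((gamma - 1) * p2 + (gamma + 1) * p1))
    with (r2 * r1 * (t1 * ((gamma - 1) * p2 + (gamma + 1) * p1))) by (unfold t1; field; lra).
  rewrite <- HH. unfold t2. field. lra.
Qed.

(** By [hugoniot] the square of the normal velocity ahead increases with the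
    pressure behind and is the sonic one when the two pressures agree. *)
Lemma normal_supersonic gamma b0 df Um Up :
  1 < gamma -> 0 < pres Um -> 0 < dens Um -> 0 < dens Up -> pres Um < pres Up ->
  bernoulli gamma Um = b0 -> bernoulli gamma Up = b0 -> rankine_hugoniot df Um Up ->
  (1 + df ^ 2) * (gamma * pres Um / dens Um) < (velx Um - df * vely Um) ^ 2.
Proof.
intros Hg Hp1 Hr1 Hr2 Hp B1 B2 HRH.
destruct (hugoniot gamma b0 df Um Up) as [H _]; auto.
assert (HS : 0 < 1 + df ^ 2) by (generalize (pow2_ge_0 df); lra).
apply Rmult_lt_reg_l with (2 * dens Um); [lra|]. rewrite H.
replace (2 * dens Um * ((1 + df ^ 2) * (gamma * pres Um / dens Um)))
  with ((1 + df ^ 2) * (2 * gamma * pres Um)) by (field; lra).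
apply Rmult_lt_compat_l; [exact HS|]. nra.
Qed.

(** Behind a shock facing the uniform flow the state is a function of the pressure
    and of the slope of the front. *)
Lemma shock_state gamma p0 u0 rho0 df Up :
  1 < gamma -> 0 < p0 -> 0 < u0 -> 0 < rho0 -> 0 < dens Up -> p0 < pres Up ->
  bernoulli gamma Up = bernoulli0 gamma p0 u0 rho0 ->
  rankine_hugoniot df (mkState p0 u0 0 rho0) Up ->
  2 * rho0 * u0 ^ 2 = (1 + df ^ 2) * ((gamma + 1) * pres Up + (gamma - 1) * p0) /\
  velx Up = u0 - (pres Up - p0) / (rho0 * u0) /\
  vely Up = df * ((pres Up - p0) / (rho0 * u0)) /\
  dens Up = rho0 * (((gamma + 1) * pres Up + (gamma - 1) * p0)
                    / ((gamma - 1) * pres Up + (gamma + 1) * p0)).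
Proof.
intros Hg Hp0 Hu0 Hr0 Hr Hp HB HRH.
destruct (hugoniot gamma (bernoulli0 gamma p0 u0 rho0) df (mkState p0 u0 0 rho0) Up) as [H1 H2]; auto.
{ unfold bernoulli, bernoulli0; simpl. field. lra. }
simpl in H1, H2. destruct HRH as (E1 & E2 & E3). simpl in E1, E2, E3.
destruct Up as [p u v r]. simpl pres in *. simpl velx in *. simpl vely in *. simpl dens in *.
assert (Hru : 0 < rho0 * u0) by (apply Rmult_lt_0_compat; assumption).
assert (E1' : r * (u - df * v) = rho0 * u0) by lra.
split; [lra|]. split; [|split].
- apply Rmult_eq_reg_l with (rho0 * u0); [|lra].
  replace (rho0 * u0 * (u0 - (p - p0) / (rho0 * u0))) with (rho0 * u0 * u0 - (p - p0)) by (field; lra).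
  rewrite <- E1' at 1. lra.
- apply Rmult_eq_reg_l with (rho0 * u0); [|lra].
  replace (rho0 * u0 * (df * ((p - p0) / (rho0 * u0)))) with (df * (p - p0)) by (field; lra).
  rewrite <- E1' at 1. lra.
- assert (0 < (gamma - 1) * p + (gamma + 1) * p0) by nra.
  apply Rmult_eq_reg_r with ((gamma - 1) * p + (gamma + 1) * p0); [|lra]. rewrite H2. field. lra.
Qed.

(** * The Euler equations in nonconservative form *)

(** The Euler equations reduced to what is used: the momentum equations freed of the
    mass equation, Bernoulli's law and its gradient.  By continuity they hold up to the
    boundary, where gradients are needed only away from the vertex. *)
Record smooth_flow (gamma b0 : R) (A : R * R -> Prop) (p u v r : diff_field) : Prop := {
  sf_open : open A;
  sf_origin : ~ A (0, 0);
  sf_p : C1_field A p;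
  sf_u : C1_field A u;
  sf_v : C1_field A v;
  sf_r : C1_field A r;
  sf_p_pos : forall z, closure A z -> 0 < fv p z;
  sf_r_pos : forall z, closure A z -> 0 < fv r z;
  sf_mass : forall z, punctured_closure A z ->
    (fx r z * fv u z + fv r z * fx u z) + (fy r z * fv v z + fv r z * fy v z) = 0;
  sf_momx : forall z, punctured_closure A z ->
    fv r z * (fv u z * fx u z + fv v z * fy u z) + fx p z = 0;
  sf_momy : forall z, punctured_closure A z ->
    fv r z * (fv u z * fx v z + fv v z * fy v z) + fy p z = 0;
  sf_bern : forall z, closure A z ->
    (fv u z ^ 2 + fv v z ^ 2) / 2 + gamma * fv p z / ((gamma - 1) * fv r z) = b0;
  sf_bernx : forall z, punctured_closure A z ->
    fv u z * fx u z + fv v z * fx v z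
      + gamma / (gamma - 1) * ((fx p z * fv r z - fv p z * fx r z) / fv r z ^ 2) = 0;
  sf_berny : forall z, punctured_closure A z ->
    fv u z * fy u z + fv v z * fy v z
      + gamma / (gamma - 1) * ((fy p z * fv r z - fv p z * fy r z) / fv r z ^ 2) = 0
}.

Arguments sf_open {_ _ _ _ _ _ _} _.
Arguments sf_origin {_ _ _ _ _ _ _} _.
Arguments sf_p {_ _ _ _ _ _ _} _.
Arguments sf_u {_ _ _ _ _ _ _} _.
Arguments sf_v {_ _ _ _ _ _ _} _.
Arguments sf_r {_ _ _ _ _ _ _} _.
Arguments sf_p_pos {_ _ _ _ _ _ _} _.
Arguments sf_r_pos {_ _ _ _ _ _ _} _.
Arguments sf_mass {_ _ _ _ _ _ _} _.
Arguments sf_momx {_ _ _ _ _ _ _} _.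
Arguments sf_momy {_ _ _ _ _ _ _} _.
Arguments sf_bern {_ _ _ _ _ _ _} _.
Arguments sf_bernx {_ _ _ _ _ _ _} _.
Arguments sf_berny {_ _ _ _ _ _ _} _.

Lemma punctured_extension (A : R * R -> Prop) (q r : R * R -> R) :
  ~ A (0, 0) -> continuous_on (punctured_closure A) q -> continuous_on (punctured_closure A) r ->
  (forall z, A z -> q z = r z) -> forall z, punctured_closure A z -> q z = r z.
Proof.
intros HO Hq Hr H. apply (eq_closure A); auto.
- intros z Hz. now apply subset_punctured.
- intros z Hz. apply Hz.
Qed.

Lemma gradient_of_constant (A : R * R -> Prop) (F : diff_field) (c x y : R) :
  open A -> ~ A (0, 0) -> C1_field A F -> (forall z, A z -> fv F z = c) -> A (x, y) ->
  fx F (x, y) = 0 /\ fy F (x, y) = 0.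
Proof.
intros HA HO HF Hc Hz. destruct (open_square A x y HA Hz) as (d & Hd & Hs).
apply (interior_max_gradient A F x y d); auto.
intros x' y' Hx Hy. rewrite (Hc _ Hz), (Hc _ (Hs _ _ Hx Hy)). lra.
Qed.

Lemma smooth_flow_of_euler gamma b0 A (U : R * R -> state) :
  1 < gamma -> open A -> ~ A (0, 0) -> regular_flow A U ->
  (forall z, closure A z -> 0 < pres (U z) /\ 0 < dens (U z)) ->
  (forall x y, A (x, y) -> euler_at gamma b0 U x y) ->
  exists p u v r, smooth_flow gamma b0 A p u v r /\
    fv p = (fun z => pres (U z)) /\ fv u = (fun z => velx (U z)) /\
    fv v = (fun z => vely (U z)) /\ fv r = (fun z => dens (U z)).
Proof.
intros Hg HA HO (Rp & Ru & Rv & Rr) Hpos HE.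
destruct (C1_up_of_regular _ _ Rp) as (px & py & Cp). destruct (C1_up_of_regular _ _ Ru) as (ux & uy & Cu).
destruct (C1_up_of_regular _ _ Rv) as (vx & vy & Cv). destruct (C1_up_of_regular _ _ Rr) as (rx & ry & Cr).
set (p := fun z => pres (U z)) in *. set (u := fun z => velx (U z)) in *.
set (v := fun z => vely (U z)) in *. set (r := fun z => dens (U z)) in *.
assert (Pp : forall z, closure A z -> 0 < p z) by (intros z Hz; apply (Hpos z Hz)).
assert (Pr : forall z, closure A z -> 0 < r z) by (intros z Hz; apply (Hpos z Hz)).
assert (Hcl : forall z, punctured_closure A z -> closure A z) by (intros z Hz; apply Hz).
exists (mkField p px py), (mkField u ux uy), (mkField v vx vy), (mkField r rx ry).
split; [|repeat split].
assert (c_p := C1_up_cont0 _ _ _ _ Cp). assert (c_u := C1_up_cont0 _ _ _ _ Cu).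
assert (c_v := C1_up_cont0 _ _ _ _ Cv). assert (c_r := C1_up_cont0 _ _ _ _ Cr).
destruct (Cp) as (k_p & c_px & c_py & _). destruct (Cu) as (k_u & c_ux & c_uy & _).
destruct (Cv) as (k_v & c_vx & c_vy & _). destruct (Cr) as (k_r & c_rx & c_ry & _).
assert (Hdx : forall q qx qy x y, C1_up A q qx qy -> A (x, y) ->
  dx q x y = qx (x, y) /\ dy q x y = qy (x, y)).
{ intros q qx qy x y Hq Hz. destruct Hq as (_ & _ & _ & Hq). destruct (Hq x y Hz).
  split; apply is_derive_unique; assumption. }
assert (Hin : forall z, A z ->
  ((rx z * u z + r z * ux z) + (ry z * v z + r z * vy z) = 0 /\
   r z * (u z * ux z + v z * uy z) + px z = 0 /\
   r z * (u z * vx z + v z * vy z) + py z = 0) /\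
  (u z ^ 2 + v z ^ 2) / 2 + gamma * p z / ((gamma - 1) * r z) = b0).
{ intros [x y] Hz. destruct (HE x y Hz) as (E1 & E2 & E3 & E4).
  assert (Cru := C1_up_mult A _ _ _ _ _ _ Cr Cu). assert (Crv := C1_up_mult A _ _ _ _ _ _ Cr Cv).
  assert (Cruu := C1_up_plus A _ _ _ _ _ _ (C1_up_mult A _ _ _ _ _ _ Cru Cu) Cp).
  assert (Cruv := C1_up_mult A _ _ _ _ _ _ Cru Cv).
  assert (Crvv := C1_up_plus A _ _ _ _ _ _ (C1_up_mult A _ _ _ _ _ _ Crv Cv) Cp).
  assert (e2 : dx (fun z => dens (U z) * velx (U z) ^ 2 + pres (U z)) x y
     = dx (fun z => r z * u z * u z + p z) x y).
  { apply Derive_ext. intros t. unfold r, u, p. ring. }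
  assert (e3 : dy (fun z => dens (U z) * vely (U z) ^ 2 + pres (U z)) x y
     = dy (fun z => r z * v z * v z + p z) x y).
  { apply Derive_ext. intros t. unfold r, v, p. ring. }
  rewrite e2 in E2. rewrite e3 in E3.
  change (dx (fun z => r z * u z) x y + dy (fun z => r z * v z) x y = 0) in E1.
  change (dx (fun z => r z * u z * u z + p z) x y + dy (fun z => r z * u z * v z) x y = 0) in E2.
  change (dx (fun z => r z * u z * v z) x y + dy (fun z => r z * v z * v z + p z) x y = 0) in E3.
  rewrite (proj1 (Hdx _ _ _ _ _ Cru Hz)), (proj2 (Hdx _ _ _ _ _ Crv Hz)) in E1.
  rewrite (proj1 (Hdx _ _ _ _ _ Cruu Hz)), (proj2 (Hdx _ _ _ _ _ Cruv Hz)) in E2.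
  rewrite (proj1 (Hdx _ _ _ _ _ Cruv Hz)), (proj2 (Hdx _ _ _ _ _ Crvv Hz)) in E3.
  cbv beta in E1, E2, E3.
  assert (Hc := subset_closure A _ Hz). specialize (Pp _ Hc). specialize (Pr _ Hc).
  rewrite sonic_speed_sqr in E4 by auto.
  change ((u (x, y) ^ 2 + v (x, y) ^ 2) / 2 + gamma * p (x, y) / r (x, y) / (gamma - 1) = b0) in E4.
  repeat split.
  - exact E1.
  - apply Rplus_eq_reg_r with (u (x, y) * (rx (x, y) * u (x, y) + r (x, y) * ux (x, y) + (ry (x, y) * v (x, y) + r (x, y) * vy (x, y)))).
    rewrite E1 at 2. rewrite Rmult_0_r, Rplus_0_r. lra.
  - apply Rplus_eq_reg_r with (v (x, y) * (rx (x, y) * u (x, y) + r (x, y) * ux (x, y) + (ry (x, y) * v (x, y) + r (x, y) * vy (x, y)))).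
    rewrite E1 at 2. rewrite Rmult_0_r, Rplus_0_r. lra.
  - rewrite <- E4. field. lra. }
(* Bernoulli's law is constant on A, so its gradient vanishes there *)
assert (CB : C1_field A (mkField (fun z => (u z ^ 2 + v z ^ 2) / 2 + gamma * p z / ((gamma - 1) * r z))
  (fun z => u z * ux z + v z * vx z + gamma / (gamma - 1) * ((px z * r z - p z * rx z) / r z ^ 2))
  (fun z => u z * uy z + v z * vy z + gamma / (gamma - 1) * ((py z * r z - p z * ry z) / r z ^ 2)))).
{ assert (Cir := C1_up_inv A _ _ _ (fun z Hz => Rgt_not_eq _ _ (Pr z Hz)) Cr).
  refine (C1_up_ext A _ _ _ _ _ _ (C1_up_plus A _ _ _ _ _ _
    (C1_up_scal A (/ 2) _ _ _ (C1_up_plus A _ _ _ _ _ _ (C1_up_mult A _ _ _ _ _ _ Cu Cu) (C1_up_mult A _ _ _ _ _ _ Cv Cv)))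
    (C1_up_scal A (gamma / (gamma - 1)) _ _ _ (C1_up_mult A _ _ _ _ _ _ Cp Cir))) HO _ _ _ HA);
  simpl fv; simpl fx; simpl fy; intros z Hz.
  - specialize (Pr z Hz). field. lra.
  - specialize (Pr z (Hcl z Hz)). field. lra.
  - specialize (Pr z (Hcl z Hz)). field. lra. }
assert (HB : forall z, A z ->
  u z * ux z + v z * vx z + gamma / (gamma - 1) * ((px z * r z - p z * rx z) / r z ^ 2) = 0 /\
  u z * uy z + v z * vy z + gamma / (gamma - 1) * ((py z * r z - p z * ry z) / r z ^ 2) = 0).
{ intros [x y] Hz. apply (gradient_of_constant A _ b0 x y HA HO CB); [|exact Hz].
  intros z Hz'. apply (Hin z Hz'). }
assert (cr2 : continuous_on (punctured_closure A) (fun z => / r z ^ 2)).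
{ apply continuous_on_inv.
  - intros z Hz. specialize (Pr z (Hcl z Hz)). apply pow_nonzero. lra.
  - apply (continuous_on_ext _ (fun z => r z * r z)); [|cont_on].
    intros z _. change (r z * r z = r z ^ 2). ring. }
constructor; simpl fv; simpl fx; simpl fy; auto.
- apply (punctured_extension A); auto; [cont_on|cont_on|]. intros z Hz. apply (Hin z Hz).
- apply (punctured_extension A); auto; [cont_on|cont_on|]. intros z Hz. apply (Hin z Hz).
- apply (punctured_extension A); auto; [cont_on|cont_on|]. intros z Hz. apply (Hin z Hz).
- assert (kir : continuous_on (closure A) (fun z => / ((gamma - 1) * r z))).
  { apply continuous_on_inv; [|cont_on]. intros z Hz. specialize (Pr z Hz).
    apply Rmult_integral_contrapositive; lra. }
  apply (eq_closure A (closure A)); auto.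
  + apply subset_closure.
  + apply (continuous_on_ext _ (fun z => / 2 * (u z * u z + v z * v z) + gamma * p z * / ((gamma - 1) * r z))); [|cont_on].
    intros z Hz. change (/ 2 * (u z * u z + v z * v z) + gamma * p z * / ((gamma - 1) * r z)
      = (u z ^ 2 + v z ^ 2) / 2 + gamma * p z / ((gamma - 1) * r z)).
    specialize (Pr z Hz). field. lra.
  + apply continuous_on_const.
  + intros z Hz. apply (Hin z Hz).
- apply (punctured_extension A); auto; [|cont_on|intros z Hz; apply (HB z Hz)].
  unfold Rdiv at 2. cont_on.
- apply (punctured_extension A); auto; [|cont_on|intros z Hz; apply (HB z Hz)].
  unfold Rdiv at 2. cont_on.
Qed.

(** Along a streamline the momentum equations account for the kinetic part of
    Bernoulli's law; what is left is the isentropic relation between pressure and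
    density. *)
Lemma smooth_flow_entropy gamma b0 A p u v r z :
  1 < gamma -> smooth_flow gamma b0 A p u v r -> punctured_closure A z ->
  fv u z * fx p z + fv v z * fy p z = gamma * fv p z / fv r z * (fv u z * fx r z + fv v z * fy r z).
Proof.
intros Hg HF Hz. assert (Hr := sf_r_pos HF z (proj1 Hz)).
assert (E2 := sf_momx HF z Hz). assert (E3 := sf_momy HF z Hz).
assert (B1 := sf_bernx HF z Hz). assert (B2 := sf_berny HF z Hz).
set (P := fv p z) in *. set (Px := fx p z) in *. set (Py := fy p z) in *.
set (u0 := fv u z) in *. set (Ux := fx u z) in *. set (Uy := fy u z) in *.
set (v0 := fv v z) in *. set (Vx := fx v z) in *. set (Vy := fy v z) in *.
set (r0 := fv r z) in *. set (Rx := fx r z) in *. set (Ry := fy r z) in *.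
assert (K : u0 * (r0 * (u0 * Ux + v0 * Uy) + Px) + v0 * (r0 * (u0 * Vx + v0 * Vy) + Py) = 0) by (rewrite E2, E3; ring).
assert (L : u0 * (u0 * Ux + v0 * Vx + gamma / (gamma - 1) * ((Px * r0 - P * Rx) / r0 ^ 2))
  + v0 * (u0 * Uy + v0 * Vy + gamma / (gamma - 1) * ((Py * r0 - P * Ry) / r0 ^ 2)) = 0) by (rewrite B1, B2; ring).
assert (M : gamma / (gamma - 1) * ((u0 * Px + v0 * Py) * r0 - P * (u0 * Rx + v0 * Ry)) = (u0 * Px + v0 * Py) * r0).
{ replace (gamma / (gamma - 1) * ((u0 * Px + v0 * Py) * r0 - P * (u0 * Rx + v0 * Ry)))
    with (r0 ^ 2 * (u0 * (u0 * Ux + v0 * Vx + gamma / (gamma - 1) * ((Px * r0 - P * Rx) / r0 ^ 2))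
      + v0 * (u0 * Uy + v0 * Vy + gamma / (gamma - 1) * ((Py * r0 - P * Ry) / r0 ^ 2)))
      - r0 * (u0 * (r0 * (u0 * Ux + v0 * Uy) + Px) + v0 * (r0 * (u0 * Vx + v0 * Vy) + Py)) + (u0 * Px + v0 * Py) * r0)
    by (field; lra).
  rewrite K, L. ring. }
apply Rmult_eq_reg_r with (r0 / (gamma - 1)).
2:{ apply Rgt_not_eq, Rdiv_lt_0_compat; lra. }
replace (gamma * P / r0 * (u0 * Rx + v0 * Ry) * (r0 / (gamma - 1)))
  with (gamma / (gamma - 1) * ((u0 * Px + v0 * Py) * r0) -
        gamma / (gamma - 1) * ((u0 * Px + v0 * Py) * r0 - P * (u0 * Rx + v0 * Ry))) by (field; lra).
rewrite M. field. lra.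
Qed.

(** * Transport along characteristics ahead of the front *)

(** The part of the region ahead of the front cut off by [x = X] and by a line of
    slope [- k]; it is a domain of dependence if no characteristic has a slope below
    [- k]. *)
Definition backward_region (theta : R) (f : R -> R) (Y k X : R) (z : R * R) : Prop :=
  closure (Dminus theta f) z /\ fst z <= X /\ snd z + k * fst z <= Y.

Lemma backward_region_closed theta f Y k X : closed_planar (backward_region theta f Y k X).
Proof.
apply (closed_set_ext (fun z => (closure (Dminus theta f) z /\ fst z <= (fun _ : R * R => X) z) /\
   snd z + k * fst z <= (fun _ : R * R => Y) z)).
{ intros z. unfold backward_region. tauto. }
apply closed_set_le; [apply closed_set_le; [apply closed_set_closure| |]| |]; cont_on.
Qed.

Lemma backward_region_bounded theta f Y k X x y :
  front_in_wedge theta f -> 0 <= k -> backward_region theta f Y k X (x, y) ->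
  Rabs x < Rabs X + Rabs Y + 1 /\ Rabs y < Rabs X + Rabs Y + 1.
Proof.
intros H Hk (H1 & H2 & H3). simpl in H2, H3.
apply (closure_Dminus_iff _ _ _ _ H) in H1 as (H4 & H5 & _).
assert (0 <= k * x) by (apply Rmult_le_pos; assumption).
generalize (Rle_abs X), (Rle_abs Y), (Rabs_pos X), (Rabs_pos Y).
rewrite (Rabs_pos_eq x), (Rabs_pos_eq y) by assumption. lra.
Qed.

(** Constancy to first order along the backward characteristic of slope [lam], as
    seen from each point whose backward ray enters the region. *)
Definition transported (theta : R) (f : R -> R) (Y k X : R) (lam q : R * R -> R) : Prop :=
  forall x y s0, backward_region theta f Y k X (x, y) -> 0 < x -> 0 < s0 ->
  (forall s, 0 < s < s0 -> Dminus theta f (x + s * -1, y + s * - lam (x, y)) /\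
     backward_region theta f Y k X (x + s * -1, y + s * - lam (x, y))) ->
  exists H, is_derive H 0 0 /\ forall s, 0 <= s -> H s = q (x + s * -1, y + s * - lam (x, y)).

(** The backward characteristic from a point with [x > 0] enters the region: through
    the front by the condition on the product with its derivative, and across the upper
    line by the bound on the slope.  Along it [q] is stationary and [- e * x] increases,
    so [q - e * x] has its maximum on the entry line. *)
Lemma transport_le theta f Y k X lam q c :
  front_in_wedge theta f -> 0 <= k ->
  continuous_on (backward_region theta f Y k X) q ->
  (forall x y, backward_region theta f Y k X (x, y) -> 0 < x ->
     - k <= lam (x, y) /\ (x = f y -> lam (x, y) * Derive f y < 1)) ->
  transported theta f Y k X lam q ->
  (forall y, 0 <= y -> q (0, y) <= c) ->
  forall z, backward_region theta f Y k X z -> q z <= c.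
Proof.
intros H Hk Hq Hlam Htr H0 [x1 y1] Hz1. apply Rnot_lt_le; intros Hlt.
assert (Hz1' := Hz1). destruct Hz1' as (C1 & C2 & C3). simpl in C2, C3.
apply (closure_Dminus_iff _ _ _ _ H) in C1 as (G1 & G2 & _).
assert (Hx1 : 0 < x1).
{ destruct (Rle_lt_or_eq_dec _ _ G2) as [Hx|<-]; [exact Hx|]. specialize (H0 y1 G1). lra. }
(* so small that [q - e * x] still exceeds [c] at the point [(x1, y1)] *)
set (e := (q (x1, y1) - c) / (2 * x1)).
assert (He : 0 < e) by (apply Rdiv_lt_0_compat; lra).
assert (Hex : e * x1 = (q (x1, y1) - c) / 2) by (unfold e; field; lra).
destruct (compact_max (backward_region theta f Y k X) (fun z => q z - e * fst z)
  (Rabs X + Rabs Y + 1) (x1, y1)) as (x & y & Hz & Hmax); auto.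
{ apply backward_region_closed. }
{ intros x y. now apply backward_region_bounded. }
{ cont_on. }
assert (Hval := Hmax _ Hz1). simpl fst in Hval.
assert (Hz' := Hz). destruct Hz' as (C4 & C5 & C6). simpl in C5, C6.
apply (closure_Dminus_iff _ _ _ _ H) in C4 as (G3 & G4 & G5).
assert (Hx : 0 < x).
{ destruct (Rle_lt_or_eq_dec _ _ G4) as [Hx|<-]; [exact Hx|]. specialize (H0 y G3). lra. }
assert (Hy : 0 < y).
{ destruct (Rle_lt_or_eq_dec _ _ G3) as [Hy|<-]; [exact Hy|]. rewrite (fw_origin H) in G5. lra. }
destruct (Hlam x y Hz Hx) as [L1 L2]. set (l := lam (x, y)) in *.
assert (Hray : exists s0, 0 < s0 /\ forall s, 0 < s < s0 -> Dminus theta f (x + s * -1, y + s * - l)).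
{ destruct (Rle_lt_or_eq_dec _ _ G5) as [Hf|Hf].
  - destruct (open_square (Dminus theta f) x y (open_Dminus _ _ H)) as (d & Hd & Hsq).
    { apply (Dminus_iff _ _ _ _ H). lra. }
    assert (Pl := Rabs_pos l).
    exists (d / (1 + Rabs l)). split; [apply Rdiv_lt_0_compat; lra|].
    intros s Hs. assert (Hsd : s * (1 + Rabs l) < d).
    { apply Rlt_le_trans with (d / (1 + Rabs l) * (1 + Rabs l)); [apply Rmult_lt_compat_r; lra|right; field; lra]. }
    apply Hsq.
    + replace (x + s * -1 - x) with (- s) by ring. rewrite Rabs_Ropp, Rabs_pos_eq by lra. nra.
    + replace (y + s * - l - y) with (- (s * l)) by ring.
      rewrite Rabs_Ropp, Rabs_mult, (Rabs_pos_eq s) by lra. nra.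
  - specialize (L2 Hf). set (p := Derive f y) in *.
    assert (HD : is_derive (fun s => f (y + s * - l) + s) 0 (1 - l * p)).
    { replace (1 - l * p) with (- l * p + 1) by ring.
      apply (is_derive_plus (fun s => f (y + s * - l)) (fun s => s)); [|apply (is_derive_id (K := R_AbsRing))].
      apply (is_derive_comp f (fun s => y + s * - l) 0 p (- l)).
      - replace (y + 0 * - l) with y by ring. now apply (fw_derive theta).
      - auto_derive; [exact I|ring]. }
    apply is_derive_Reals in HD. destruct (HD ((1 - l * p) / 2) ltac:(lra)) as [d Hd].
    assert (Pd := cond_pos d). assert (Pl := Rabs_pos l).
    exists (Rmin d (Rmin x (y / (1 + Rabs l)))). split; [repeat apply Rmin_pos; auto; apply Rdiv_lt_0_compat; lra|].
    intros s Hs. Rmin_facts.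
    specialize (Hd s ltac:(lra) ltac:(rewrite Rabs_pos_eq; lra)).
    rewrite Rplus_0_l, Rmult_0_l, !Rplus_0_r in Hd. apply Rabs_def2 in Hd.
    apply (Dminus_iff _ _ _ _ H).
    assert (Hsy : s * (1 + Rabs l) < y).
    { apply Rlt_le_trans with (y / (1 + Rabs l) * (1 + Rabs l)); [apply Rmult_lt_compat_r; lra|right; field; lra]. }
    assert (s * l <= s * Rabs l) by (apply Rmult_le_compat_l; [lra|apply Rle_abs]).
    assert (0 < (f (y + s * - l) + s - f y) / s) by lra.
    assert (Hpos : 0 < (f (y + s * - l) + s - f y) / s * s) by (apply Rmult_lt_0_compat; lra).
    replace ((f (y + s * - l) + s - f y) / s * s) with (f (y + s * - l) + s - f y) in Hpos by (field; lra).
    split; [lra|]. lra. }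
destruct Hray as (s0 & Hs0 & Hray).
assert (Hreg : forall s, 0 < s < s0 -> backward_region theta f Y k X (x + s * -1, y + s * - l)).
{ intros s Hs. split; [apply subset_closure, Hray, Hs|]. simpl. split; [lra|].
  assert (0 <= s * (l + k)) by (apply Rmult_le_pos; lra). lra. }
destruct (Htr x y s0 Hz Hx Hs0) as (h & Hh & Eh).
{ intros s Hs. split; [now apply Hray|now apply Hreg]. }
assert (0 <= - e); [|lra].
apply (right_derivative_le h 0 (- e) s0 Hh Hs0). intros s Hs.
assert (Hms := Hmax _ (Hreg s Hs)). simpl fst in Hms. fold l in Eh. rewrite <- (Eh s) in Hms by lra.
assert (E0 : h 0 = q (x, y)) by (rewrite Eh by lra; now rewrite !Rmult_0_l, !Rplus_0_r).
rewrite <- E0 in Hms. lra.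
Qed.

Lemma transport_eq theta f Y k X lam q c :
  front_in_wedge theta f -> 0 <= k ->
  continuous_on (backward_region theta f Y k X) q ->
  (forall x y, backward_region theta f Y k X (x, y) -> 0 < x ->
     - k <= lam (x, y) /\ (x = f y -> lam (x, y) * Derive f y < 1)) ->
  transported theta f Y k X lam q ->
  (forall y, 0 <= y -> q (0, y) = c) ->
  forall z, backward_region theta f Y k X z -> q z = c.
Proof.
intros H Hk Hq Hlam Htr H0 z Hz. apply Rle_antisym.
- apply (transport_le theta f Y k X lam q c); auto. intros y Hy. rewrite H0; lra.
- apply Ropp_le_cancel.
  apply (transport_le theta f Y k X lam (fun z => - q z) (- c)); auto.
  + now apply continuous_on_opp.
  + intros x y s0 Hz' Hx Hs Hr. destruct (Htr x y s0 Hz' Hx Hs Hr) as (h & Hh & Eh).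
    exists (fun s => - h s). split.
    * replace 0 with (- 0) at 2 by ring. now apply (is_derive_opp h).
    * intros s Hs'. now rewrite Eh.
  + intros y Hy. rewrite H0; lra.
Qed.

(** * The Prandtl-Meyer function and Riemann invariants *)

(** The Prandtl-Meyer angle as a function of the squared Mach number. *)
Definition prandtl_meyer (gamma Q : R) : R :=
  let k := sqrt ((gamma + 1) / (gamma - 1)) in
  k * atan (sqrt (Q - 1) / k) - atan (sqrt (Q - 1)).

Lemma prandtl_meyer_derive gamma Q : 1 < gamma -> 1 < Q ->
  is_derive (prandtl_meyer gamma) Q (sqrt (Q - 1) / (Q * ((gamma - 1) * Q + 2))).
Proof.
intros Hg HQ. unfold prandtl_meyer.
assert (Hk0 : 0 < (gamma + 1) / (gamma - 1)) by (apply Rdiv_lt_0_compat; lra).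
assert (Hk2 : sqrt ((gamma + 1) / (gamma - 1)) ^ 2 * (gamma - 1) = gamma + 1).
{ rewrite pow2_sqrt by lra. field. lra. }
assert (Hk := sqrt_lt_R0 _ Hk0). set (k := sqrt ((gamma + 1) / (gamma - 1))) in *.
assert (Hm2 : sqrt (Q - 1) ^ 2 = Q - 1) by (apply pow2_sqrt; lra).
assert (Hm := sqrt_lt_R0 (Q - 1) ltac:(lra)).
auto_derive; [repeat split; lra|].
replace (Q + - (1)) with (Q - 1) by ring.
set (m := sqrt (Q - 1)) in *. replace Q with (m ^ 2 + 1) by lra.
assert (0 < k * k) by (apply Rmult_lt_0_compat; assumption).
assert (0 < m * m) by (apply Rmult_lt_0_compat; assumption).
assert (D1 : 0 < (gamma - 1) * (m ^ 2 + 1) + 2).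
{ assert (0 < (gamma - 1) * (m ^ 2 + 1)) by (apply Rmult_lt_0_compat; lra). lra. }
assert (D2 : (gamma - 1) * (m ^ 2 + 1) + 2 = (gamma - 1) * (m ^ 2 + k ^ 2)) by lra.
assert (Hk3 : k ^ 2 = 1 + 2 / (gamma - 1)).
{ apply Rmult_eq_reg_r with (gamma - 1); [|lra]. rewrite Hk2. field. lra. }
rewrite D2.
replace (k * (1 * / (2 * m) * / k * / (1 + m * / k * (m * / k * 1))) + - (1 * / (2 * m) * / (1 + m * (m * 1))))
  with (m * (k ^ 2 - 1) / (2 * ((m ^ 2 + k ^ 2) * (m ^ 2 + 1)))).
2:{ field. repeat split; nra. }
rewrite Hk3. field. repeat split; try lra.
Qed.

Lemma prandtl_meyer_inj gamma Q0 Q1 : 1 < gamma -> 1 < Q0 -> 1 < Q1 ->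
  prandtl_meyer gamma Q0 = prandtl_meyer gamma Q1 -> Q0 = Q1.
Proof.
assert (aux : forall Q0 Q1, 1 < gamma -> 1 < Q0 -> Q0 < Q1 -> prandtl_meyer gamma Q0 < prandtl_meyer gamma Q1).
{ clear. intros Q0 Q1 Hg H0 H1.
  destruct (MVT_cor2 (prandtl_meyer gamma) (fun Q => sqrt (Q - 1) / (Q * ((gamma - 1) * Q + 2))) Q0 Q1 H1) as (c & E & Hc).
  { intros c Hc. apply is_derive_Reals, prandtl_meyer_derive; lra. }
  assert (0 < sqrt (c - 1) / (c * ((gamma - 1) * c + 2))).
  { apply Rdiv_lt_0_compat; [apply sqrt_lt_R0; lra|]. apply Rmult_lt_0_compat; [lra|].
    assert (0 < (gamma - 1) * c) by (apply Rmult_lt_0_compat; lra). lra. }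
  assert (0 < sqrt (c - 1) / (c * ((gamma - 1) * c + 2)) * (Q1 - Q0)) by (apply Rmult_lt_0_compat; lra).
  lra. }
intros Hg H0 H1 E. destruct (Rtotal_order Q0 Q1) as [H|[H|H]]; [|exact H|].
- specialize (aux Q0 Q1 Hg H0 H). lra.
- specialize (aux Q1 Q0 Hg H1 H). lra.
Qed.

(** Along a streamline the mass equation controls the divergence and across it the
    momentum equation controls the rotation of the velocity; this is [m] times the latter
    plus the former.  The two signs of [m] give the two families of Mach lines. *)
Lemma characteristic_equation gamma b0 A p u v r z m :
  1 < gamma -> smooth_flow gamma b0 A p u v r -> punctured_closure A z ->
  m ^ 2 = (fv u z ^ 2 + fv v z ^ 2) * fv r z / (gamma * fv p z) - 1 ->
  fv r z * (fv u z * ((m * fv u z - fv v z) * fx v z + (m * fv v z + fv u z) * fy v z)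
     - fv v z * ((m * fv u z - fv v z) * fx u z + (m * fv v z + fv u z) * fy u z))
  = - m * ((m * fv u z - fv v z) * fx p z + (m * fv v z + fv u z) * fy p z).
Proof.
intros Hg HF Hz Hm.
assert (Hr := sf_r_pos HF z (proj1 Hz)). assert (Hp := sf_p_pos HF z (proj1 Hz)).
assert (E1 := sf_mass HF z Hz).
assert (E2 := sf_momx HF z Hz). assert (E3 := sf_momy HF z Hz).
assert (E4 := smooth_flow_entropy _ _ _ _ _ _ _ z Hg HF Hz).
set (P := fv p z) in *. set (Px := fx p z) in *. set (Py := fy p z) in *.
set (u0 := fv u z) in *. set (Ux := fx u z) in *. set (Uy := fy u z) in *.
set (v0 := fv v z) in *. set (Vx := fx v z) in *. set (Vy := fy v z) in *.
set (r0 := fv r z) in *. set (Rx := fx r z) in *. set (Ry := fy r z) in *.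
set (Dp := u0 * Px + v0 * Py) in *. set (Dr := u0 * Rx + v0 * Ry) in *.
assert (HDr : Dr = r0 / (gamma * P) * Dp) by (rewrite E4; field; lra).
assert (Hdiv : r0 * (Ux + Vy) = - Dr) by (unfold Dr; lra).
assert (HN : r0 * (u0 * (- v0 * Vx + u0 * Vy) - v0 * (- v0 * Ux + u0 * Uy)) = - m ^ 2 * Dp).
{ replace (r0 * (u0 * (- v0 * Vx + u0 * Vy) - v0 * (- v0 * Ux + u0 * Uy)))
    with ((u0 ^ 2 + v0 ^ 2) * (r0 * (Ux + Vy))
      - (u0 * (r0 * (u0 * Ux + v0 * Uy)) + v0 * (r0 * (u0 * Vx + v0 * Vy)))) by ring.
  replace (r0 * (u0 * Ux + v0 * Uy)) with (- Px) by lra.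
  replace (r0 * (u0 * Vx + v0 * Vy)) with (- Py) by lra.
  rewrite Hdiv, HDr, Hm. unfold Dp. field. lra. }
replace (r0 * (u0 * ((m * u0 - v0) * Vx + (m * v0 + u0) * Vy) - v0 * ((m * u0 - v0) * Ux + (m * v0 + u0) * Uy)))
  with (m * (u0 * (r0 * (u0 * Vx + v0 * Vy)) - v0 * (r0 * (u0 * Ux + v0 * Uy)))
    + r0 * (u0 * (- v0 * Vx + u0 * Vy) - v0 * (- v0 * Ux + u0 * Uy))) by ring.
rewrite HN.
replace (r0 * (u0 * Ux + v0 * Uy)) with (- Px) by lra.
replace (r0 * (u0 * Vx + v0 * Vy)) with (- Py) by lra.
unfold Dp. ring.
Qed.

(** [Hp], [Hu], [Hv] and [Hr] stand for the flow along a Mach line of the family of sign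
    [sg].  Bernoulli's law and constant entropy turn the pressure derivative in the
    characteristic equation into the derivative of the Prandtl-Meyer angle. *)
Lemma riemann_invariant_derive gamma sg (Hp Hu Hv Hr : R -> R) dp du dv dr :
  1 < gamma -> sg ^ 2 = 1 -> 0 < Hp 0 -> 0 < Hu 0 -> 0 < Hr 0 ->
  1 < (Hu 0 ^ 2 + Hv 0 ^ 2) * Hr 0 / (gamma * Hp 0) ->
  is_derive Hp 0 dp -> is_derive Hu 0 du -> is_derive Hv 0 dv -> is_derive Hr 0 dr ->
  Hr 0 * (Hu 0 * dv - Hv 0 * du)
    = - (sg * sqrt ((Hu 0 ^ 2 + Hv 0 ^ 2) * Hr 0 / (gamma * Hp 0) - 1)) * dp ->
  Hu 0 * du + Hv 0 * dv = - dp / Hr 0 ->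
  dr = Hr 0 / (gamma * Hp 0) * dp ->
  is_derive (fun s => atan (Hv s / Hu s)
    - sg * prandtl_meyer gamma ((Hu s ^ 2 + Hv s ^ 2) * Hr s / (gamma * Hp s))) 0 0.
Proof.
intros Hg Hsg Pp Pu Pr HQ Dp Du Dv Dr Ech EB Er.
set (Q := fun s => (Hu s ^ 2 + Hv s ^ 2) * Hr s / (gamma * Hp s)) in *.
set (dQ := (2 * (Hu 0 * du + Hv 0 * dv) * Hr 0 + (Hu 0 ^ 2 + Hv 0 ^ 2) * dr) / (gamma * Hp 0)
   - (Hu 0 ^ 2 + Hv 0 ^ 2) * Hr 0 * dp / (gamma * Hp 0 ^ 2)).
assert (EX : ex_derive Hp 0 /\ ex_derive Hu 0 /\ ex_derive Hv 0 /\ ex_derive Hr 0).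
{ repeat split; eexists; eassumption. }
destruct EX as (X1 & X2 & X3 & X4).
assert (Z1 : Derive (fun x : R => Hp x) 0 = dp) by now apply is_derive_unique.
assert (Z2 : Derive (fun x : R => Hu x) 0 = du) by now apply is_derive_unique.
assert (Z3 : Derive (fun x : R => Hv x) 0 = dv) by now apply is_derive_unique.
assert (Z4 : Derive (fun x : R => Hr x) 0 = dr) by now apply is_derive_unique.
assert (HdQ : is_derive Q 0 dQ).
{ unfold Q. auto_derive; [repeat split; auto; apply Rmult_integral_contrapositive; lra|].
  rewrite Z1, Z2, Z3, Z4.
  unfold dQ. field. lra. }
assert (Hda : is_derive (fun s => atan (Hv s / Hu s)) 0 ((Hu 0 * dv - Hv 0 * du) / (Hu 0 ^ 2 + Hv 0 ^ 2))).
{ auto_derive; [repeat split; auto; lra|].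
  rewrite Z2, Z3.
  generalize (pow2_ge_0 (Hv 0)); intros; field.
  assert (0 < Hu 0 ^ 2) by (apply pow_lt; exact Pu). lra. }
set (m := sqrt (Q 0 - 1)).
change (Hr 0 * (Hu 0 * dv - Hv 0 * du) = - (sg * m) * dp) in Ech. change (1 < Q 0) in HQ.
replace 0 with ((Hu 0 * dv - Hv 0 * du) / (Hu 0 ^ 2 + Hv 0 ^ 2)
   - sg * (dQ * (m / (Q 0 * ((gamma - 1) * Q 0 + 2))))) at 2.
2:{ assert (E1 : Hu 0 * dv - Hv 0 * du = - (sg * m) * dp / Hr 0).
  { rewrite <- Ech. field. lra. }
  assert (E2 : dQ = - dp / (gamma * Hp 0) * ((gamma - 1) * Q 0 + 2)).
  { unfold dQ. rewrite EB, Er. unfold Q. field. lra. }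
  assert (E3 : Hu 0 ^ 2 + Hv 0 ^ 2 = gamma * Hp 0 * Q 0 / Hr 0) by (unfold Q; field; lra).
  assert (0 < (gamma - 1) * Q 0) by (apply Rmult_lt_0_compat; lra).
  rewrite E1, E2, E3. field. repeat split; lra. }
apply (is_derive_minus (fun s => atan (Hv s / Hu s))); [exact Hda|].
apply (is_derive_scal (fun s => prandtl_meyer gamma (Q s)) 0 sg).
apply (is_derive_comp (prandtl_meyer gamma) Q); [|exact HdQ].
now apply prandtl_meyer_derive.
Qed.

Lemma right_constant_derive (h : R -> R) l s0 : is_derive h 0 l -> 0 < s0 ->
  (forall s, 0 < s < s0 -> h s = h 0) -> l = 0.
Proof.
intros Hh Hs0 Hc. apply Rle_antisym.
- apply (right_derivative_le h l 0 s0); auto. intros s Hs. rewrite (Hc s Hs). lra.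
- assert (- l <= 0); [|lra]. apply (right_derivative_le (fun s => - h s) (- l) 0 s0); auto.
  + now apply (is_derive_opp h).
  + intros s Hs. rewrite (Hc s Hs). lra.
Qed.

(** * The flow ahead of the front is uniform *)

Definition mach_sqr (gamma p u v r : R) : R := (u ^ 2 + v ^ 2) * r / (gamma * p).

(** The smallest of the quantities whose positivity makes the front outgoing and
    all characteristics graphs over [x] with slopes at least [- k]. *)
Definition margin (gamma k p u v r : R) : R :=
  let m := sqrt (mach_sqr gamma p u v r - 1) in
  Rmin u (Rmin (gamma * p / r - v ^ 2) (Rmin (m * u - v) (Rmin (m * u + v) (Rmin (v + k * u)
    (Rmin (m * v + u + k * (m * u - v)) (m * v - u + k * (m * u + v))))))).

Lemma Rmin_pos_inv a b : 0 < Rmin a b -> 0 < a /\ 0 < b.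
Proof. intros H. generalize (Rmin_l a b), (Rmin_r a b). lra. Qed.

Lemma margin_pos gamma k p u v r : 0 < margin gamma k p u v r ->
  let m := sqrt (mach_sqr gamma p u v r - 1) in
  0 < u /\ 0 < gamma * p / r - v ^ 2 /\ 0 < m * u - v /\ 0 < m * u + v /\ 0 < v + k * u /\
  0 < m * v + u + k * (m * u - v) /\ 0 < m * v - u + k * (m * u + v).
Proof.
unfold margin. intros H. simpl.
apply Rmin_pos_inv in H as [H1 H]. apply Rmin_pos_inv in H as [H2 H]. apply Rmin_pos_inv in H as [H3 H].
apply Rmin_pos_inv in H as [H4 H]. apply Rmin_pos_inv in H as [H5 H]. apply Rmin_pos_inv in H as [H6 H7].
repeat split; assumption.
Qed.

Lemma continuous_on_Rmin (D : R * R -> Prop) (q r : R * R -> R) :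
  continuous_on D q -> continuous_on D r -> continuous_on D (fun z => Rmin (q z) (r z)).
Proof.
intros Hq Hr. apply (continuous_on_ext D (fun z => (q z + r z - Rabs (q z - r z)) * / 2)).
- intros z _. change ((q z + r z - Rabs (q z - r z)) * / 2 = Rmin (q z) (r z)).
  unfold Rmin. destruct (Rle_dec (q z) (r z)).
  + rewrite Rabs_left1; lra.
  + rewrite Rabs_pos_eq; lra.
- apply continuous_on_mult; [|apply continuous_on_const].
  apply continuous_on_minus; [cont_on|].
  apply (continuous_on_comp D Rabs (fun z => q z - r z)); [|cont_on].
  intros z _. apply continuous_Rabs.
Qed.

Lemma continuous_on_sqrt (D : R * R -> Prop) (q : R * R -> R) :
  continuous_on D q -> continuous_on D (fun z => sqrt (q z)).
Proof.
intros Hq. apply (continuous_on_comp D sqrt q); [|exact Hq]. intros z _. apply continuous_sqrt.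
Qed.

Lemma continuous_on_mach (D : R * R -> Prop) gamma (p u v r : R * R -> R) :
  0 < gamma -> (forall z, D z -> 0 < p z) ->
  continuous_on D p -> continuous_on D u -> continuous_on D v -> continuous_on D r ->
  continuous_on D (fun z => mach_sqr gamma (p z) (u z) (v z) (r z)).
Proof.
intros Hg Hp cp cu cv cr.
apply (continuous_on_ext D (fun z => (u z * u z + v z * v z) * r z / (gamma * p z))).
- intros z _. unfold mach_sqr.
  change ((u z * u z + v z * v z) * r z / (gamma * p z) = (u z ^ 2 + v z ^ 2) * r z / (gamma * p z)).
  f_equal. ring.
- apply continuous_on_div; [|cont_on|cont_on].
  intros z Hz. specialize (Hp z Hz). apply Rmult_integral_contrapositive; lra.
Qed.

Lemma continuous_on_margin (D : R * R -> Prop) gamma k (p u v r : R * R -> R) :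
  0 < gamma -> (forall z, D z -> 0 < p z) -> (forall z, D z -> 0 < r z) ->
  continuous_on D p -> continuous_on D u -> continuous_on D v -> continuous_on D r ->
  continuous_on D (fun z => margin gamma k (p z) (u z) (v z) (r z)).
Proof.
intros Hg Hp Hr cp cu cv cr.
assert (cv2 : continuous_on D (fun z => v z ^ 2)).
{ apply (continuous_on_ext D (fun z => v z * v z)); [|cont_on].
  intros z _. change (v z * v z = v z ^ 2). ring. }
assert (cq := continuous_on_mach D gamma p u v r Hg Hp cp cu cv cr).
assert (cm : continuous_on D (fun z => sqrt (mach_sqr gamma (p z) (u z) (v z) (r z) - 1))).
{ apply (continuous_on_sqrt D (fun z => mach_sqr gamma (p z) (u z) (v z) (r z) - 1)). cont_on. }
unfold margin. repeat apply continuous_on_Rmin; try solve [cont_on].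
apply continuous_on_minus; [|exact cv2]. apply continuous_on_div; [|cont_on|exact cr].
intros z Hz. specialize (Hr z Hz). lra.
Qed.

Lemma flow_ray gamma b0 A p u v r x y l s0 :
  smooth_flow gamma b0 A p u v r -> punctured_closure A (x, y) -> 0 < s0 ->
  (forall s, 0 < s < s0 -> A (x + s * -1, y + s * - l)) ->
  exists Hp Hu Hv Hr : R -> R,
    (is_derive Hp 0 (-1 * fx p (x, y) + - l * fy p (x, y)) /\
     is_derive Hu 0 (-1 * fx u (x, y) + - l * fy u (x, y)) /\
     is_derive Hv 0 (-1 * fx v (x, y) + - l * fy v (x, y)) /\
     is_derive Hr 0 (-1 * fx r (x, y) + - l * fy r (x, y))) /\
    forall s, 0 <= s ->
      Hp s = fv p (x + s * -1, y + s * - l) /\ Hu s = fv u (x + s * -1, y + s * - l) /\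
      Hv s = fv v (x + s * -1, y + s * - l) /\ Hr s = fv r (x + s * -1, y + s * - l).
Proof.
intros HF Hz Hs0 Hin.
assert (HA := sf_open HF). assert (HO := sf_origin HF).
destruct (ray_derivative A _ _ _ x y (-1) (- l) s0 HA HO (sf_p HF) Hz Hs0 Hin) as (h1 & D1 & E1).
destruct (ray_derivative A _ _ _ x y (-1) (- l) s0 HA HO (sf_u HF) Hz Hs0 Hin) as (h2 & D2 & E2).
destruct (ray_derivative A _ _ _ x y (-1) (- l) s0 HA HO (sf_v HF) Hz Hs0 Hin) as (h3 & D3 & E3).
destruct (ray_derivative A _ _ _ x y (-1) (- l) s0 HA HO (sf_r HF) Hz Hs0 Hin) as (h4 & D4 & E4).
exists h1, h2, h3, h4. split; [exact (conj D1 (conj D2 (conj D3 D4)))|].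
intros s Hs. repeat split; auto.
Qed.

(** What the argument uses about the flow ahead of the front. *)
Record ahead_flow (gamma b0 theta : R) (f : R -> R) (p0 u0 r0 : R) (p u v r : diff_field) : Prop := {
  af_gamma : 1 < gamma;
  af_wedge : front_in_wedge theta f;
  af_flow : smooth_flow gamma b0 (Dminus theta f) p u v r;
  af_supersonic : forall z, closure (Dminus theta f) z ->
    1 < mach_sqr gamma (fv p z) (fv u z) (fv v z) (fv r z);
  af_spacelike : forall y, 0 < y ->
    (1 + Derive f y ^ 2) * (gamma * fv p (f y, y) / fv r (f y, y))
      < (fv u (f y, y) - Derive f y * fv v (f y, y)) ^ 2;
  af_data : forall y, 0 <= y ->
    fv p (0, y) = p0 /\ fv u (0, y) = u0 /\ fv v (0, y) = 0 /\ fv r (0, y) = r0;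
  af_u0 : 0 < u0
}.

Arguments af_gamma {_ _ _ _ _ _ _ _ _ _ _} _.
Arguments af_wedge {_ _ _ _ _ _ _ _ _ _ _} _.
Arguments af_flow {_ _ _ _ _ _ _ _ _ _ _} _.
Arguments af_supersonic {_ _ _ _ _ _ _ _ _ _ _} _.
Arguments af_spacelike {_ _ _ _ _ _ _ _ _ _ _} _.
Arguments af_data {_ _ _ _ _ _ _ _ _ _ _} _.
Arguments af_u0 {_ _ _ _ _ _ _ _ _ _ _} _.

Lemma ahead_data_state gamma b0 theta f p0 u0 r0 p u v r :
  ahead_flow gamma b0 theta f p0 u0 r0 p u v r ->
  0 < p0 /\ 0 < r0 /\ 1 < mach_sqr gamma p0 u0 0 r0 /\
  u0 ^ 2 / 2 + gamma * p0 / ((gamma - 1) * r0) = b0.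
Proof.
intros H. assert (HF := af_flow H).
assert (Hc : closure (Dminus theta f) (0, 1)).
{ apply (closure_Dminus_iff _ _ _ _ (af_wedge H)).
  destruct (fw_below _ _ 1 (af_wedge H) Rlt_0_1). lra. }
destruct (af_data H 1 ltac:(lra)) as (E1 & E2 & E3 & E4).
assert (K1 := sf_p_pos HF _ Hc). assert (K2 := sf_r_pos HF _ Hc).
assert (K3 := af_supersonic H _ Hc). assert (K4 := sf_bern HF _ Hc).
rewrite E1, E2, E3, E4 in *. repeat split; auto. rewrite <- K4. field.
assert (Hg := af_gamma H). lra.
Qed.

(** A velocity pointing back across the front would need [|v|] above the sound speed
    to have a supersonic normal component.  For the Mach lines, the square of
    [m * (u - p * v)] exceeds that of the tangential component exactly because the normal
    component is supersonic. *)
Lemma outgoing_front u v c2 p : 0 < u -> 0 < c2 - v ^ 2 -> (1 + p ^ 2) * c2 < (u - p * v) ^ 2 ->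
  0 < u - p * v /\
  forall m, m ^ 2 = (u ^ 2 + v ^ 2) / c2 - 1 -> 0 <= m ->
    0 < m * (u - p * v) - (v + p * u) /\ 0 < m * (u - p * v) + (v + p * u).
Proof.
intros Hu Hv HX.
assert (Hc2 : 0 < c2) by (generalize (pow2_ge_0 v); lra).
assert (Hpos : 0 < u - p * v).
{ apply Rnot_le_lt; intros Hle.
  assert ((u - p * v) ^ 2 <= (p * v) ^ 2) by nra.
  assert ((p * v) ^ 2 <= p ^ 2 * c2).
  { rewrite Rpow_mult_distr. apply Rmult_le_compat_l; [apply pow2_ge_0|lra]. }
  lra. }
split; [exact Hpos|]. intros m Hm Hm0.
assert (Hsq : Rsqr (v + p * u) < Rsqr (m * (u - p * v))).
{ rewrite !Rsqr_pow2. replace ((m * (u - p * v)) ^ 2) with (m ^ 2 * (u - p * v) ^ 2) by ring. rewrite Hm.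
  set (X2 := (u - p * v) ^ 2) in *.
  replace ((v + p * u) ^ 2) with ((1 + p ^ 2) * (u ^ 2 + v ^ 2) - X2) by (unfold X2; ring).
  assert (Hq : 0 < (u ^ 2 + v ^ 2) / c2).
  { apply Rdiv_lt_0_compat; [|exact Hc2]. generalize (pow2_ge_0 v), (pow_lt u 2 Hu). lra. }
  assert ((u ^ 2 + v ^ 2) / c2 * ((1 + p ^ 2) * c2) < (u ^ 2 + v ^ 2) / c2 * X2) by (apply Rmult_lt_compat_l; assumption).
  replace ((u ^ 2 + v ^ 2) / c2 * ((1 + p ^ 2) * c2)) with ((1 + p ^ 2) * (u ^ 2 + v ^ 2)) in H by (field; lra).
  lra. }
apply Rsqr_lt_abs_0 in Hsq. rewrite (Rabs_pos_eq (m * (u - p * v))) in Hsq by (apply Rmult_le_pos; lra).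
apply Rabs_def2 in Hsq. lra.
Qed.

(** The entropy and both Riemann invariants are transported from the entry line;
    together with Bernoulli's law they determine the state. *)
Lemma ahead_uniform_of_margin gamma b0 theta f p0 u0 r0 p u v r Y k X :
  ahead_flow gamma b0 theta f p0 u0 r0 p u v r -> 0 <= k ->
  (forall z, backward_region theta f Y k X z -> 0 < margin gamma k (fv p z) (fv u z) (fv v z) (fv r z)) ->
  forall z, backward_region theta f Y k X z ->
    fv p z = p0 /\ fv u z = u0 /\ fv v z = 0 /\ fv r z = r0.
Proof.
intros H Hk Hmar.
destruct (ahead_data_state _ _ _ _ _ _ _ _ _ _ _ H) as (Hp0 & Hr0 & HQ0 & HB0).
assert (Hg := af_gamma H). assert (Hw := af_wedge H).
assert (HF := af_flow H). assert (Hu0 := af_u0 H).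
assert (Hdata := af_data H).
assert (Pp := sf_p_pos HF). assert (Pr := sf_r_pos HF).
set (Rg := backward_region theta f Y k X) in *.
assert (Hsub : forall z, Rg z -> closure (Dminus theta f) z) by (intros z Hz; apply Hz).
assert (kp := continuous_on_subset _ _ _ Hsub (proj1 (sf_p HF))).
assert (ku := continuous_on_subset _ _ _ Hsub (proj1 (sf_u HF))).
assert (kv := continuous_on_subset _ _ _ Hsub (proj1 (sf_v HF))).
assert (kr := continuous_on_subset _ _ _ Hsub (proj1 (sf_r HF))).
assert (Hreg_pt : forall x y, Rg (x, y) -> 0 < x ->
  0 < y /\ punctured_closure (Dminus theta f) (x, y)).
{ intros x y (C & _ & _) Hx. split.
  - apply (closure_Dminus_iff _ _ _ _ Hw) in C as (C1 & C2 & C3).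
    destruct (Rle_lt_or_eq_dec _ _ C1) as [Hy|<-]; [exact Hy|]. rewrite (fw_origin Hw) in C3. lra.
  - split; [exact C|]. intros E; injection E; lra. }
assert (Hsig : forall z, Rg z ->
  ln (fv p z) - gamma * ln (fv r z) = ln p0 - gamma * ln r0).
{ apply (transport_eq theta f Y k X (fun z => fv v z / fv u z) (fun z => ln (fv p z) - gamma * ln (fv r z))
    (ln p0 - gamma * ln r0) Hw Hk).
  - assert (Hln : forall q : diff_field, (forall z, closure (Dminus theta f) z -> 0 < fv q z) ->
      continuous_on Rg (fv q) -> continuous_on Rg (fun z => ln (fv q z))).
    { intros q Hq kq. apply (continuous_on_comp _ ln (fv q)); [|exact kq]. intros z Hz.
      apply (ex_derive_continuous ln). specialize (Hq z (Hsub z Hz)). auto_derive. exact Hq. }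
    assert (k1 := Hln p Pp kp). assert (k2 := Hln r Pr kr). cont_on.
  - intros x y Hz Hx. destruct (Hreg_pt x y Hz Hx) as [Hy _].
    destruct (margin_pos _ _ _ _ _ _ (Hmar _ Hz)) as (M1 & M2 & _ & _ & M5 & _). split.
    + apply Rmult_le_reg_r with (fv u (x, y)); [exact M1|].
      replace (fv v (x, y) / fv u (x, y) * fv u (x, y)) with (fv v (x, y)) by (field; lra). lra.
    + intros ->. assert (S := af_spacelike H y Hy).
      destruct (outgoing_front _ _ _ _ M1 M2 S) as [O1 _].
      apply Rmult_lt_reg_r with (fv u (f y, y)); [exact M1|].
      replace (fv v (f y, y) / fv u (f y, y) * Derive f y * fv u (f y, y)) with (Derive f y * fv v (f y, y)) by (field; lra).
      lra.
  - intros x y s0 Hz Hx Hs0 Hray. destruct (Hreg_pt x y Hz Hx) as [Hy Hpt].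
    destruct (margin_pos _ _ _ _ _ _ (Hmar _ Hz)) as (M1 & _).
    set (l := fv v (x, y) / fv u (x, y)) in *.
    destruct (flow_ray _ _ _ _ _ _ _ x y l s0 HF Hpt Hs0) as (hp & hu & hv & hr & (D1 & D2 & D3 & D4) & E).
    { intros s Hs. apply (Hray s Hs). }
    destruct (E 0 ltac:(lra)) as (E1 & E2 & E3 & E4). rewrite !Rmult_0_l, !Rplus_0_r in E1, E2, E3, E4.
    assert (P1 := Pp _ (proj1 Hpt)). assert (P2 := Pr _ (proj1 Hpt)).
    exists (fun s => ln (hp s) - gamma * ln (hr s)). split.
    + assert (ent := smooth_flow_entropy _ _ _ _ _ _ _ _ Hg HF Hpt).
      replace 0 with ((-1 * fx p (x, y) + - l * fy p (x, y)) * / hp 0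
         - gamma * ((-1 * fx r (x, y) + - l * fy r (x, y)) * / hr 0)) at 2.
      * apply (is_derive_minus (fun s => ln (hp s))).
        -- apply (is_derive_comp ln hp); [apply is_derive_Reals, derivable_pt_lim_ln; lra|exact D1].
        -- apply (is_derive_scal (fun s => ln (hr s))).
           apply (is_derive_comp ln hr); [apply is_derive_Reals, derivable_pt_lim_ln; lra|exact D4].
      * rewrite E1, E4. unfold l.
        replace ((-1 * fx p (x, y) + - (fv v (x, y) / fv u (x, y)) * fy p (x, y)) * / fv p (x, y))
          with (- (fv u (x, y) * fx p (x, y) + fv v (x, y) * fy p (x, y)) / (fv u (x, y) * fv p (x, y))) by (field; lra).
        rewrite ent. field. lra.
    + intros s Hs. destruct (E s Hs) as (F1 & _ & _ & F4). rewrite F1, F4. reflexivity.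
  - intros y Hy. destruct (Hdata y Hy) as (E1 & _ & _ & E4). now rewrite E1, E4. }
set (Q := fun z => mach_sqr gamma (fv p z) (fv u z) (fv v z) (fv r z)).
assert (HQ1 : forall z, closure (Dminus theta f) z -> 1 < Q z) by apply (af_supersonic H).
set (Q0 := mach_sqr gamma p0 u0 0 r0) in *.
assert (Hrie : forall sg, sg = 1 \/ sg = -1 -> forall z, Rg z ->
  atan (fv v z / fv u z) - sg * prandtl_meyer gamma (Q z) = - sg * prandtl_meyer gamma Q0).
{ intros sg Hsg.
  assert (Hsg2 : sg ^ 2 = 1) by (destruct Hsg as [-> | ->]; ring).
  set (M := fun z => sg * sqrt (Q z - 1)).
  set (lam := fun z => (M z * fv v z + fv u z) / (M z * fv u z - fv v z)).
  assert (Hcond : forall x y, Rg (x, y) -> 0 < x ->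
     0 < sg * (M (x, y) * fv u (x, y) - fv v (x, y)) /\
     - k <= lam (x, y) /\ (x = f y -> lam (x, y) * Derive f y < 1)).
  { intros x y Hz Hx. destruct (Hreg_pt x y Hz Hx) as [Hy Hpt].
    destruct (margin_pos _ _ _ _ _ _ (Hmar _ Hz)) as (M1 & M2 & M3 & M4 & M5 & M6 & M7).
    fold (Q (x, y)) in M3, M4, M6, M7. set (m := sqrt (Q (x, y) - 1)) in *.
    assert (HMm : M (x, y) = sg * m) by reflexivity.
    assert (Hden : 0 < sg * (M (x, y) * fv u (x, y) - fv v (x, y))).
    { rewrite HMm. destruct Hsg as [-> | ->]; lra. }
    split; [exact Hden|].
    set (den := M (x, y) * fv u (x, y) - fv v (x, y)) in *.
    assert (Hlam : lam (x, y) = sg * (M (x, y) * fv v (x, y) + fv u (x, y)) / (sg * den)).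
    { unfold lam. fold den. field. destruct Hsg as [-> | ->]; lra. }
    split.
    - rewrite Hlam. apply Rmult_le_reg_r with (sg * den); [exact Hden|].
      replace (sg * (M (x, y) * fv v (x, y) + fv u (x, y)) / (sg * den) * (sg * den))
        with (sg * (M (x, y) * fv v (x, y) + fv u (x, y))) by (field; destruct Hsg as [-> | ->]; lra).
      unfold den. rewrite HMm. destruct Hsg as [-> | ->]; lra.
    - intros Hxf. rewrite Hlam. apply Rmult_lt_reg_r with (sg * den); [exact Hden|].
      replace (sg * (M (x, y) * fv v (x, y) + fv u (x, y)) / (sg * den) * Derive f y * (sg * den))
        with (sg * (M (x, y) * fv v (x, y) + fv u (x, y)) * Derive f y) by (field; destruct Hsg as [-> | ->]; lra).
      assert (S := af_spacelike H y Hy). rewrite <- Hxf in S.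
      destruct (outgoing_front _ _ _ _ M1 M2 S) as [_ O2].
      destruct (O2 m) as [O3 O4].
      { unfold m. rewrite pow2_sqrt by (specialize (HQ1 _ (proj1 Hpt)); lra).
        unfold Q, mach_sqr. assert (P1 := Pp _ (proj1 Hpt)). assert (P2 := Pr _ (proj1 Hpt)). field. lra. }
      { apply sqrt_pos. }
      unfold den. rewrite HMm. destruct Hsg as [-> | ->]; lra. }
  apply (transport_eq theta f Y k X lam (fun z => atan (fv v z / fv u z) - sg * prandtl_meyer gamma (Q z))
    (- sg * prandtl_meyer gamma Q0) Hw Hk).
  - assert (Hun : forall z, Rg z -> fv u z <> 0).
    { intros z Hz. destruct (margin_pos _ _ _ _ _ _ (Hmar _ Hz)) as (M1 & _). lra. }
    assert (kw : continuous_on Rg (fun z => fv v z / fv u z)) by (apply continuous_on_div; assumption).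
    assert (kQ : continuous_on Rg Q) by (apply (continuous_on_mach Rg gamma (fv p) (fv u) (fv v) (fv r)); auto; lra).
    apply continuous_on_minus.
    + apply (continuous_on_comp Rg atan (fun z => fv v z / fv u z)); [|exact kw].
      intros z _. apply continuity_pt_filterlim, derivable_continuous_pt, derivable_pt_atan.
    + apply continuous_on_mult; [apply continuous_on_const|].
      apply (continuous_on_comp Rg (prandtl_meyer gamma) Q); [|exact kQ].
      intros z Hz. apply (ex_derive_continuous (prandtl_meyer gamma)). eexists.
      apply prandtl_meyer_derive; [exact Hg|apply HQ1, Hsub, Hz].
  - intros x y Hz Hx. apply (Hcond x y Hz Hx).
  - intros x y s0 Hz Hx Hs0 Hray. destruct (Hreg_pt x y Hz Hx) as [Hy Hpt].
    destruct (margin_pos _ _ _ _ _ _ (Hmar _ Hz)) as (M1 & _).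
    destruct (Hcond x y Hz Hx) as (Hden & _). set (l := lam (x, y)) in *.
    destruct (flow_ray _ _ _ _ _ _ _ x y l s0 HF Hpt Hs0) as (hp & hu & hv & hr & (D1 & D2 & D3 & D4) & E).
    { intros s Hs. apply (Hray s Hs). }
    destruct (E 0 ltac:(lra)) as (E1 & E2 & E3 & E4). rewrite !Rmult_0_l, !Rplus_0_r in E1, E2, E3, E4.
    assert (P1 := Pp _ (proj1 Hpt)). assert (P2 := Pr _ (proj1 Hpt)).
    exists (fun s => atan (hv s / hu s) - sg * prandtl_meyer gamma ((hu s ^ 2 + hv s ^ 2) * hr s / (gamma * hp s))).
    split.
    + assert (HM2 : M (x, y) ^ 2 = (fv u (x, y) ^ 2 + fv v (x, y) ^ 2) * fv r (x, y) / (gamma * fv p (x, y)) - 1).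
      { unfold M. rewrite Rpow_mult_distr, Hsg2, pow2_sqrt by (specialize (HQ1 _ (proj1 Hpt)); lra).
        unfold Q, mach_sqr. ring. }
      assert (Hch := characteristic_equation _ _ _ _ _ _ _ (x, y) (M (x, y)) Hg HF Hpt HM2).
      assert (B1 := sf_bernx HF _ Hpt). assert (B2 := sf_berny HF _ Hpt).
      assert (Hden0 : M (x, y) * fv u (x, y) - fv v (x, y) <> 0).
      { intros E0. rewrite E0 in Hden. lra. }
      (* isentropy along the ray, from the constancy of entropy in the region *)
      assert (Hent : (-1 * fx p (x, y) + - l * fy p (x, y)) * / hp 0
         - gamma * ((-1 * fx r (x, y) + - l * fy r (x, y)) * / hr 0) = 0).
      { apply (right_constant_derive (fun s => ln (hp s) - gamma * ln (hr s)) _ s0).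
        - apply (is_derive_minus (fun s => ln (hp s))).
          + apply (is_derive_comp ln hp); [apply is_derive_Reals, derivable_pt_lim_ln; lra|exact D1].
          + apply (is_derive_scal (fun s => ln (hr s))).
            apply (is_derive_comp ln hr); [apply is_derive_Reals, derivable_pt_lim_ln; lra|exact D4].
        - exact Hs0.
        - intros s Hs. destruct (E s ltac:(lra)) as (F1 & _ & _ & F4). rewrite F1, F4, E1, E4.
          rewrite (Hsig _ Hz). apply Hsig, (Hray s Hs). }
      set (dp := -1 * fx p (x, y) + - l * fy p (x, y)) in *. set (dr := -1 * fx r (x, y) + - l * fy r (x, y)) in *.
      rewrite E1, E4 in Hent.
      assert (Hdr : dr = fv r (x, y) / (gamma * fv p (x, y)) * dp).
      { apply Rmult_eq_reg_l with (gamma * / fv r (x, y)).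
        2:{ apply Rmult_integral_contrapositive; split; [lra|]. apply Rinv_neq_0_compat; lra. }
        replace (gamma * / fv r (x, y) * (fv r (x, y) / (gamma * fv p (x, y)) * dp)) with (dp * / fv p (x, y)) by (field; lra).
        lra. }
      apply (riemann_invariant_derive gamma sg hp hu hv hr dp
        (-1 * fx u (x, y) + - l * fy u (x, y)) (-1 * fx v (x, y) + - l * fy v (x, y)) dr); auto;
        try (rewrite ?E1, ?E2, ?E3, ?E4; lra).
      * rewrite E1, E2, E3, E4. apply (HQ1 _ (proj1 Hpt)).
      * rewrite E1, E2, E3, E4. change (sqrt ((fv u (x, y) ^ 2 + fv v (x, y) ^ 2) * fv r (x, y) / (gamma * fv p (x, y)) - 1))
          with (sqrt (Q (x, y) - 1)). fold (M (x, y)).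
        apply Rmult_eq_reg_l with (- (M (x, y) * fv u (x, y) - fv v (x, y))); [|lra].
        unfold dp, l, lam.
        match goal with |- ?a = ?b =>
          replace a with (fv r (x, y) * (fv u (x, y) * ((M (x, y) * fv u (x, y) - fv v (x, y)) * fx v (x, y) + (M (x, y) * fv v (x, y) + fv u (x, y)) * fy v (x, y))
     - fv v (x, y) * ((M (x, y) * fv u (x, y) - fv v (x, y)) * fx u (x, y) + (M (x, y) * fv v (x, y) + fv u (x, y)) * fy u (x, y)))) by (field; exact Hden0);
          replace b with (- M (x, y) * ((M (x, y) * fv u (x, y) - fv v (x, y)) * fx p (x, y) + (M (x, y) * fv v (x, y) + fv u (x, y)) * fy p (x, y))) by (field; exact Hden0)
        end. exact Hch.
      * rewrite E2, E3, E4.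
        assert (K : -1 * (fv u (x, y) * fx u (x, y) + fv v (x, y) * fx v (x, y)
            + gamma / (gamma - 1) * ((fx p (x, y) * fv r (x, y) - fv p (x, y) * fx r (x, y)) / fv r (x, y) ^ 2))
          + - l * (fv u (x, y) * fy u (x, y) + fv v (x, y) * fy v (x, y)
            + gamma / (gamma - 1) * ((fy p (x, y) * fv r (x, y) - fv p (x, y) * fy r (x, y)) / fv r (x, y) ^ 2)) = 0).
        { rewrite B1, B2. ring. }
        assert (K2 : gamma / (gamma - 1) * ((dp * fv r (x, y) - fv p (x, y) * dr) / fv r (x, y) ^ 2) = dp / fv r (x, y)).
        { rewrite Hdr. field. lra. }
        assert (K3 : gamma / (gamma - 1) * ((dp * fv r (x, y) - fv p (x, y) * dr) / fv r (x, y) ^ 2)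
          = -1 * (gamma / (gamma - 1) * ((fx p (x, y) * fv r (x, y) - fv p (x, y) * fx r (x, y)) / fv r (x, y) ^ 2))
          + - l * (gamma / (gamma - 1) * ((fy p (x, y) * fv r (x, y) - fv p (x, y) * fy r (x, y)) / fv r (x, y) ^ 2))).
        { unfold dp, dr. field. lra. }
        unfold Rdiv at 1. rewrite Ropp_mult_distr_l_reverse. fold (dp / fv r (x, y)). lra.
    + intros s Hs. destruct (E s Hs) as (F1 & F2 & F3 & F4). rewrite F1, F2, F3, F4. reflexivity.
  - intros y Hy. destruct (Hdata y Hy) as (E1 & E2 & E3 & E4). unfold Q. rewrite E1, E2, E3, E4. fold Q0.
    unfold Rdiv. rewrite Rmult_0_l, atan_0.
    change (0 - sg * prandtl_meyer gamma Q0 = - sg * prandtl_meyer gamma Q0). ring. }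
intros z Hz.
assert (R1 := Hrie 1 (or_introl eq_refl) z Hz). assert (R2 := Hrie (-1) (or_intror eq_refl) z Hz).
assert (Hcl := Hsub z Hz).
destruct (margin_pos _ _ _ _ _ _ (Hmar _ Hz)) as (M1 & _).
assert (P1 := Pp z Hcl). assert (P2 := Pr z Hcl).
assert (Hv : fv v z = 0).
{ assert (Ha : atan (fv v z / fv u z) = 0) by lra.
  assert (Hw0 : fv v z / fv u z = 0) by (rewrite <- (tan_atan (fv v z / fv u z)), Ha; apply tan_0).
  replace (fv v z) with (fv v z / fv u z * fv u z) by (field; lra). rewrite Hw0. ring. }
assert (HQz : Q z = Q0) by (apply (prandtl_meyer_inj gamma); [exact Hg|apply HQ1, Hcl|exact HQ0|lra]).
assert (HBz := sf_bern HF z Hcl).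
unfold Q, Q0, mach_sqr in HQz. rewrite Hv in HQz, HBz.
set (P := fv p z) in *. set (U := fv u z) in *. set (D := fv r z) in *.
(* Mach number and Bernoulli's law give the temperature, then entropy gives the density *)
assert (HU : U ^ 2 = u0 ^ 2 * r0 / p0 * (P / D)).
{ replace (U ^ 2) with ((U ^ 2 + 0 ^ 2) * D / (gamma * P) * (gamma * (P / D))) by (field; lra).
  rewrite HQz. field. lra. }
assert (Ha : P / D = p0 / r0).
{ apply Rmult_eq_reg_l with (u0 ^ 2 * r0 / p0 / 2 + gamma / (gamma - 1)).
  - transitivity b0.
    + rewrite <- HBz, HU. field. lra.
    + rewrite <- HB0. field. lra.
  - apply Rgt_not_eq. assert (0 < u0 ^ 2 * r0 / p0).
    { apply Rdiv_lt_0_compat; [apply Rmult_lt_0_compat; [apply pow_lt|]|]; assumption. }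
    assert (0 < gamma / (gamma - 1)) by (apply Rdiv_lt_0_compat; lra). lra. }
assert (HUu : U = u0).
{ apply Rsqr_inj; [lra|lra|]. rewrite !Rsqr_pow2, HU, Ha. field. lra. }
assert (HD : D = r0).
{ apply ln_inv; [exact P2|exact Hr0|].
  assert (HS := Hsig z Hz). fold P D in HS.
  replace P with (P / D * D) in HS by (field; lra). replace p0 with (p0 / r0 * r0) in HS by (field; lra).
  rewrite Ha in HS.
  rewrite !ln_mult in HS by (try assumption; apply Rdiv_lt_0_compat; assumption).
  apply Rmult_eq_reg_l with (gamma - 1); [|lra].
  replace (p0 / r0 * r0) with p0 in HS by (field; lra). lra. }
repeat split; auto.
replace P with (P / D * D) by (field; lra). rewrite Ha, HD. field. lra.
Qed.

(** The margin is positive on the entry line.  At a leftmost point where it is not,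
    everything to the left is uniform by the preceding lemma, so by continuity the
    margin has its initial value there after all. *)
Lemma ahead_uniform gamma b0 theta f p0 u0 r0 p u v r :
  ahead_flow gamma b0 theta f p0 u0 r0 p u v r ->
  forall z, closure (Dminus theta f) z ->
    fv p z = p0 /\ fv u z = u0 /\ fv v z = 0 /\ fv r z = r0.
Proof.
intros H [x y] Hz.
destruct (ahead_data_state _ _ _ _ _ _ _ _ _ _ _ H) as (Hp0 & Hr0 & HQ0 & HB0).
assert (Hg := af_gamma H). assert (Hw := af_wedge H).
assert (HF := af_flow H). assert (Hu0 := af_u0 H).
set (mu := sqrt (mach_sqr gamma p0 u0 0 r0 - 1)).
assert (Hmu : 0 < mu) by (apply sqrt_lt_R0; lra).
(* twice the slope of the Mach lines of the oncoming flow *)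
set (k := 2 / mu). assert (Hk : 0 < k) by (apply Rdiv_lt_0_compat; lra).
assert (Hkm : k * mu = 2) by (unfold k; field; lra).
assert (Hmar0 : 0 < margin gamma k p0 u0 0 r0).
{ assert (0 < mu * u0) by (apply Rmult_lt_0_compat; assumption).
  assert (0 < k * u0) by (apply Rmult_lt_0_compat; assumption).
  assert (k * (mu * u0) = 2 * u0) by (rewrite <- Hkm; ring).
  assert (0 < gamma * p0 / r0) by (apply Rdiv_lt_0_compat; [apply Rmult_lt_0_compat|]; lra).
  unfold margin. fold mu. repeat apply Rmin_glb_lt; lra. }
assert (Hz' := Hz). apply (closure_Dminus_iff _ _ _ _ Hw) in Hz' as (Hy & Hx & _).
set (Y := y + k * x).
set (mz := fun z => margin gamma k (fv p z) (fv u z) (fv v z) (fv r z)).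
assert (Hreg : backward_region theta f Y k x (x, y)).
{ split; [exact Hz|]. simpl. unfold Y. lra. }
assert (kmz : continuous_on (closure (Dminus theta f)) mz).
{ apply (continuous_on_margin _ gamma k (fv p) (fv u) (fv v) (fv r)); [lra|apply HF|apply HF| | | |].
  - apply (sf_p HF).
  - apply (sf_u HF).
  - apply (sf_v HF).
  - apply (sf_r HF). }
set (Rg := backward_region theta f Y k x).
assert (Hsub : forall z, Rg z -> closure (Dminus theta f) z) by (intros z' Hz'; apply Hz').
assert (kRg := continuous_on_subset _ _ _ Hsub kmz).
assert (Hall : forall z, Rg z -> 0 < mz z).
{ intros zb Hzb. apply Rnot_le_lt; intros Hbad.
  destruct (compact_max (fun z => Rg z /\ mz z <= (fun _ => 0) z) (fun z => - fst z)
    (Rabs x + Rabs Y + 1) zb) as (xm & ym & [Hm1 Hm2] & Hmin).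
  - split; assumption.
  - apply closed_set_le; [apply backward_region_closed|exact kRg|apply continuous_on_const].
  - intros x' y' [H1 _]. apply (backward_region_bounded theta f Y k x x' y' Hw); [lra|exact H1].
  - cont_on.
  - assert (Hm3 := Hm1). destruct Hm3 as (C1 & C2 & C3). simpl in C2, C3.
    assert (C4 := C1). apply (closure_Dminus_iff _ _ _ _ Hw) in C4 as (G1 & G2 & G3).
    assert (Hm0 : forall z, (fv p z = p0 /\ fv u z = u0 /\ fv v z = 0 /\ fv r z = r0) -> mz z = margin gamma k p0 u0 0 r0).
    { intros z (E1 & E2 & E3 & E4). unfold mz. now rewrite E1, E2, E3, E4. }
    assert (Hxm : 0 < xm).
    { destruct (Rle_lt_or_eq_dec _ _ G2) as [Hxm|<-]; [exact Hxm|].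
      rewrite (Hm0 _ (af_data H ym G1)) in Hm2. lra. }
    destruct (continuous_on_eps _ _ xm ym (margin gamma k p0 u0 0 r0) kRg Hm1 Hmar0) as (d & Hd & Hnear).
    set (s := Rmin (d / 2) (xm / 2)). assert (Hs : 0 < s) by (apply Rmin_pos; lra).
    assert (N1 : s <= d / 2) by apply Rmin_l. assert (N2 : s <= xm / 2) by apply Rmin_r.
    assert (Hreg2 : forall X, X <= x -> forall z, backward_region theta f Y k X z -> Rg z).
    { intros X HX z (K1 & K2 & K3). split; [exact K1|]. split; [lra|exact K3]. }
    assert (Hin : backward_region theta f Y k (xm - s) (xm - s, ym)).
    { split; [apply (closure_Dminus_iff _ _ _ _ Hw); lra|]. simpl. split; [lra|].
      assert (0 < k * s) by (apply Rmult_lt_0_compat; assumption). lra. }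
    assert (Hst := ahead_uniform_of_margin gamma b0 theta f p0 u0 r0 p u v r Y k (xm - s) H ltac:(lra)).
    specialize (Hst ltac:(idtac; intros z' Hz'; apply Rnot_le_lt; intros Hle;
      assert (HR := Hreg2 (xm - s) ltac:(lra) z' Hz');
      assert (Hmz := Hmin z' (conj HR Hle)); simpl in Hmz; destruct Hz' as (_ & Hz2 & _); lra) _ Hin).
    specialize (Hnear (xm - s) ym (Hreg2 (xm - s) ltac:(lra) _ Hin)).
    rewrite (Hm0 _ Hst) in Hnear.
    replace (xm - s - xm) with (- s) in Hnear by ring. rewrite Rabs_Ropp, (Rabs_pos_eq s) in Hnear by lra.
    rewrite Rminus_diag, Rabs_R0 in Hnear. specialize (Hnear ltac:(lra) Hd).
    apply Rabs_def2 in Hnear. lra. }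
apply (ahead_uniform_of_margin gamma b0 theta f p0 u0 r0 p u v r Y k x H); [lra|exact Hall|exact Hreg].
Qed.

(** * The elliptic system behind the front *)

(** The matrix of the system is [I / (rho u^2) - (1, w) (1, w)^T / (gamma p)], whose
    determinant has the sign of [1 - M^2]. *)
Lemma subsonic_elliptic gamma b0 A p u v r :
  1 < gamma -> smooth_flow gamma b0 A p u v r ->
  (forall z, closure A z -> 0 < fv u z) ->
  (forall z, closure A z -> mach_sqr gamma (fv p z) (fv u z) (fv v z) (fv r z) < 1) ->
  exists W a b d, elliptic_system A p W a b d /\
    forall z, fv W z = fv v z / fv u z /\
      fv a z = / (fv r z * fv u z ^ 2) - / (gamma * fv p z) /\
      fv b z = - (fv v z / fv u z) / (gamma * fv p z) /\
      fv d z = / (fv r z * fv u z ^ 2) - (fv v z / fv u z) ^ 2 / (gamma * fv p z).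
Proof.
intros Hg HF Hu HQ.
assert (HA := sf_open HF). assert (HO := sf_origin HF).
assert (Cp := sf_p HF). assert (Cu := sf_u HF).
assert (Cv := sf_v HF). assert (Cr := sf_r HF).
assert (Pp := sf_p_pos HF). assert (Pr := sf_r_pos HF).
assert (Hcl : forall z, punctured_closure A z -> closure A z) by (intros z Hz; apply Hz).
assert (Nu : forall z, closure A z -> fv u z <> 0) by (intros z Hz; specialize (Hu z Hz); lra).
assert (Np : forall z, closure A z -> gamma * fv p z <> 0).
{ intros z Hz. specialize (Pp z Hz). apply Rmult_integral_contrapositive; lra. }
assert (Nr : forall z, closure A z -> fv r z * (fv u z * fv u z) <> 0).
{ intros z Hz. specialize (Pr z Hz). specialize (Hu z Hz).
  apply Rmult_integral_contrapositive; split; [lra|]. apply Rmult_integral_contrapositive; lra. }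
assert (Ciu := C1_up_inv A _ _ _ Nu Cu).
assert (Cw := C1_up_mult A _ _ _ _ _ _ Cv Ciu).
assert (Cs := C1_up_inv A _ _ _ Np (C1_up_scal A gamma _ _ _ Cp)).
assert (Ck := C1_up_inv A _ _ _ Nr (C1_up_mult A _ _ _ _ _ _ Cr (C1_up_mult A _ _ _ _ _ _ Cu Cu))).
assert (Ca := C1_up_plus A _ _ _ _ _ _ Ck (C1_up_scal A (-1) _ _ _ Cs)).
assert (Cb := C1_up_scal A (-1) _ _ _ (C1_up_mult A _ _ _ _ _ _ Cw Cs)).
assert (Cd := C1_up_plus A _ _ _ _ _ _ Ck (C1_up_scal A (-1) _ _ _ (C1_up_mult A _ _ _ _ _ _ (C1_up_mult A _ _ _ _ _ _ Cw Cw) Cs))).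
match type of Cw with C1_up _ ?q ?qx ?qy => set (W := mkField q qx qy) end.
match type of Ca with C1_up _ ?q ?qx ?qy => set (a := mkField q qx qy) end.
match type of Cb with C1_up _ ?q ?qx ?qy => set (b := mkField q qx qy) end.
match type of Cd with C1_up _ ?q ?qx ?qy => set (d := mkField q qx qy) end.
assert (Hval : forall z, fv W z = fv v z / fv u z /\
      fv a z = / (fv r z * fv u z ^ 2) - / (gamma * fv p z) /\
      fv b z = - (fv v z / fv u z) / (gamma * fv p z) /\
      fv d z = / (fv r z * fv u z ^ 2) - (fv v z / fv u z) ^ 2 / (gamma * fv p z)).
{ intros z. simpl. unfold Rdiv. rewrite !Rmult_1_r. repeat split; try ring. }
exists W, a, b, d. split; [|exact Hval].
assert (Hgrad : forall z, punctured_closure A z ->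
   fv r z * (fx u z + fy v z) = - (fv r z / (gamma * fv p z)) * (fv u z * fx p z + fv v z * fy p z)).
{ intros z Hz. assert (E1 := sf_mass HF z Hz).
  assert (E4 := smooth_flow_entropy _ _ _ _ _ _ _ z Hg HF Hz).
  specialize (Pp z (Hcl z Hz)). specialize (Pr z (Hcl z Hz)). rewrite E4.
  replace (- (fv r z / (gamma * fv p z)) * (gamma * fv p z / fv r z * (fv u z * fx r z + fv v z * fy r z)))
    with (- (fv u z * fx r z + fv v z * fy r z)) by (field; lra). lra. }
constructor; auto.
- intros z Hz. destruct (Hval z) as (_ & Va & Vb & _). rewrite Va, Vb.
  assert (E0 := Hgrad z Hz). assert (E2 := sf_momx HF z Hz).
  specialize (Pp z (Hcl z Hz)). specialize (Pr z (Hcl z Hz)). specialize (Hu z (Hcl z Hz)).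
  assert (E : fv r z * (fv u z * fy v z - fv v z * fy u z)
    = fx p z - fv u z * (fv r z / (gamma * fv p z)) * (fv u z * fx p z + fv v z * fy p z)).
  { replace (fv r z * (fv u z * fy v z - fv v z * fy u z))
      with (fv u z * (fv r z * (fx u z + fy v z)) - fv r z * (fv u z * fx u z + fv v z * fy u z)) by ring.
    rewrite E0. lra. }
  simpl.
  replace (fy v z * / fv u z + fv v z * (- / (fv u z * (fv u z * 1)) * fy u z))
    with (fv r z * (fv u z * fy v z - fv v z * fy u z) / (fv r z * fv u z ^ 2)) by (field; lra).
  rewrite E. field. lra.
- intros z Hz. destruct (Hval z) as (_ & _ & Vb & Vd). rewrite Vb, Vd.
  assert (E0 := Hgrad z Hz). assert (E3 := sf_momy HF z Hz).
  specialize (Pp z (Hcl z Hz)). specialize (Pr z (Hcl z Hz)). specialize (Hu z (Hcl z Hz)).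
  assert (E : fv r z * (fv u z * fx v z - fv v z * fx u z)
    = - fy p z + fv v z * (fv r z / (gamma * fv p z)) * (fv u z * fx p z + fv v z * fy p z)).
  { replace (fv r z * (fv u z * fx v z - fv v z * fx u z))
      with (fv r z * (fv u z * fx v z + fv v z * fy v z) - fv v z * (fv r z * (fx u z + fy v z))) by ring.
    rewrite E0. lra. }
  simpl.
  replace (- (fx v z * / fv u z + fv v z * (- / (fv u z * (fv u z * 1)) * fx u z)))
    with (- (fv r z * (fv u z * fx v z - fv v z * fx u z)) / (fv r z * fv u z ^ 2)) by (field; lra).
  rewrite E. field. lra.
- intros z Hz. destruct (Hval z) as (_ & Va & _). rewrite Va.
  specialize (Pp z Hz). specialize (Pr z Hz). specialize (Hu z Hz). specialize (HQ z Hz).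
  assert (Hu2 : 0 < fv u z ^ 2) by (apply pow_lt; exact Hu).
  assert (Hru : 0 < fv r z * fv u z ^ 2) by (apply Rmult_lt_0_compat; assumption).
  assert (Hgp : 0 < gamma * fv p z) by (apply Rmult_lt_0_compat; lra).
  assert (Hlt : fv r z * fv u z ^ 2 < gamma * fv p z).
  { unfold mach_sqr in HQ. apply (Rmult_lt_compat_r (gamma * fv p z)) in HQ; [|exact Hgp].
    replace ((fv u z ^ 2 + fv v z ^ 2) * fv r z / (gamma * fv p z) * (gamma * fv p z))
      with ((fv u z ^ 2 + fv v z ^ 2) * fv r z) in HQ by (field; lra).
    assert (0 <= fv v z ^ 2 * fv r z) by (apply Rmult_le_pos; [apply pow2_ge_0|lra]). lra. }
  assert (/ (gamma * fv p z) < / (fv r z * fv u z ^ 2)).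
  { apply Rinv_lt_contravar; [|exact Hlt]. apply Rmult_lt_0_compat; assumption. }
  lra.
- intros z Hz. destruct (Hval z) as (_ & Va & Vb & Vd). rewrite Va, Vb, Vd.
  specialize (Pp z Hz). specialize (Pr z Hz). specialize (Hu z Hz). specialize (HQ z Hz).
  assert (Hu2 : 0 < fv u z ^ 2) by (apply pow_lt; exact Hu).
  assert (Hru : 0 < fv r z * fv u z ^ 2) by (apply Rmult_lt_0_compat; assumption).
  match goal with |- 0 < ?e =>
    replace e with ((1 - mach_sqr gamma (fv p z) (fv u z) (fv v z) (fv r z)) / (fv r z * fv u z ^ 2) ^ 2)
      by (unfold mach_sqr; field; lra) end.
  apply Rdiv_lt_0_compat; [lra|]. apply pow_lt, Hru.
Qed.

(** Scaling by [-1] turns minima into maxima. *)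
Definition scale_field (c : R) (F : diff_field) : diff_field :=
  mkField (fun z => c * fv F z) (fun z => c * fx F z) (fun z => c * fy F z).

Lemma elliptic_scale A P W a b d c :
  elliptic_system A P W a b d -> elliptic_system A (scale_field c P) (scale_field c W) a b d.
Proof.
intros H. destruct H as [H1 H2 HP HW Ha Hb Hd E1 E2 H3 H4].
constructor; auto.
- now apply C1_up_scal.
- now apply C1_up_scal.
- intros z Hz. simpl. rewrite (E1 z Hz). ring.
- intros z Hz. simpl. specialize (E2 z Hz). replace (- (c * fx W z)) with (c * - fx W z) by ring.
  rewrite E2. ring.
Qed.

(** * Maxima in the region behind the front *)

(** What the argument uses about the flow behind the front. *)
Record behind_flow (gamma b0 theta : R) (f : R -> R) (p0 u0 r0 pbar : R) (p u v r : diff_field) : Prop := {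
  bf_gamma : 1 < gamma;
  bf_wedge : front_in_wedge theta f;
  bf_flow : smooth_flow gamma b0 (Dplus theta f) p u v r;
  bf_u_pos : forall z, closure (Dplus theta f) z -> 0 < fv u z;
  bf_subsonic : forall z, closure (Dplus theta f) z ->
    mach_sqr gamma (fv p z) (fv u z) (fv v z) (fv r z) < 1;
  bf_slip : forall x, 0 < x -> fv v (x, x * tan theta) / fv u (x, x * tan theta) = tan theta;
  bf_data_pos : 0 < p0 /\ 0 < u0 /\ 0 < r0;
  bf_shock : forall y, 0 < y ->
    p0 < fv p (f y, y) /\
    2 * r0 * u0 ^ 2 = (1 + Derive f y ^ 2) * ((gamma + 1) * fv p (f y, y) + (gamma - 1) * p0) /\
    fv u (f y, y) = u0 - (fv p (f y, y) - p0) / (r0 * u0) /\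
    fv v (f y, y) = Derive f y * ((fv p (f y, y) - p0) / (r0 * u0)) /\
    fv r (f y, y) = r0 * (((gamma + 1) * fv p (f y, y) + (gamma - 1) * p0)
                    / ((gamma - 1) * fv p (f y, y) + (gamma + 1) * p0));
  bf_infinity : forall eps, 0 < eps -> exists K, forall x y,
    closure (Dplus theta f) (x, y) -> K < sqrt (x ^ 2 + y ^ 2) -> Rabs (fv p (x, y) - pbar) <= eps;
  bf_corner : fv p (0, 0) = pbar;
  bf_pbar : p0 < pbar /\ (gamma + 1) * pbar + (gamma - 1) * p0 < 2 * r0 * u0 ^ 2
}.

Arguments bf_gamma {_ _ _ _ _ _ _ _ _ _ _ _} _.
Arguments bf_wedge {_ _ _ _ _ _ _ _ _ _ _ _} _.
Arguments bf_flow {_ _ _ _ _ _ _ _ _ _ _ _} _.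
Arguments bf_u_pos {_ _ _ _ _ _ _ _ _ _ _ _} _.
Arguments bf_subsonic {_ _ _ _ _ _ _ _ _ _ _ _} _.
Arguments bf_slip {_ _ _ _ _ _ _ _ _ _ _ _} _.
Arguments bf_data_pos {_ _ _ _ _ _ _ _ _ _ _ _} _.
Arguments bf_shock {_ _ _ _ _ _ _ _ _ _ _ _} _.
Arguments bf_infinity {_ _ _ _ _ _ _ _ _ _ _ _} _.
Arguments bf_corner {_ _ _ _ _ _ _ _ _ _ _ _} _.
Arguments bf_pbar {_ _ _ _ _ _ _ _ _ _ _ _} _.

(** A maximum inside would spread, first horizontally to the curve halfway between
    front and wall and then along this curve to infinity, where [P] is smaller. *)
Lemma no_interior_maximum theta f P W a b d m l :
  front_in_wedge theta f -> elliptic_system (Dplus theta f) P W a b d -> l < m ->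
  (exists K, forall x y, closure (Dplus theta f) (x, y) -> K < sqrt (x ^ 2 + y ^ 2) -> fv P (x, y) <= l) ->
  (forall z, closure (Dplus theta f) z -> fv P z <= m) ->
  forall z, Dplus theta f z -> fv P z < m.
Proof.
intros H HS Hlm [K HK] Hle [x y] Hz. assert (Ht := fw_tan _ _ H).
assert (HleA : forall z, Dplus theta f z -> fv P z <= m) by (intros z' Hz'; apply Hle, subset_closure, Hz').
destruct (Rle_lt_or_eq_dec _ _ (HleA _ Hz)) as [Hlt|Heq]; [exact Hlt|exfalso].
assert (Hz' := Hz). apply (Dplus_iff _ _ _ _ H) in Hz' as (Hy & Hx1 & Hx2).
set (xm := fun s => (f s + s / tan theta) / 2).
assert (Hxm : forall s, 0 < s -> f s < xm s /\ xm s * tan theta < s).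
{ intros s Hs. destruct (fw_below _ _ _ H Hs) as [B1 B2].
  assert (B3 : s / tan theta * tan theta = s) by (field; lra).
  assert (B4 : f s < s / tan theta) by (apply Rmult_lt_reg_r with (tan theta); lra).
  unfold xm. split; [lra|]. replace ((f s + s / tan theta) / 2 * tan theta) with ((f s * tan theta + s) / 2) by (field; lra). lra. }
assert (Hmid : fv P (xm y, y) = m).
{ destruct (Hxm y Hy) as [B1 B2].
  assert (G := maximum_along_curve _ _ _ _ _ _ m (fun s => x + s * (xm y - x)) (fun _ => y) 0 1 HS HleA ltac:(lra)).
  cbv beta in G. replace (x + 1 * (xm y - x)) with (xm y) in G by ring. apply G.
  - intros s Hs. split; [|split].
    + apply (Dplus_iff _ _ _ _ H). split; [exact Hy|].
      replace (x + s * (xm y - x)) with ((1 - s) * x + s * xm y) by ring.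
      split.
      * destruct (Rle_lt_or_eq_dec 0 s (proj1 Hs)) as [Hsp|<-]; [nra|lra].
      * replace (((1 - s) * x + s * xm y) * tan theta) with ((1 - s) * (x * tan theta) + s * (xm y * tan theta)) by ring.
        destruct (Rle_lt_or_eq_dec 0 s (proj1 Hs)) as [Hsp|<-]; [nra|lra].
    + apply (ex_derive_continuous (fun s => x + s * (xm y - x))). auto_derive. exact I.
    + apply continuous_const.
  - replace (x + 0 * (xm y - x)) with x by ring. exact Heq. }
set (y1 := Rmax y (Rabs K + 1)).
assert (Hy1 : y <= y1) by apply Rmax_l. assert (Hy2 : Rabs K + 1 <= y1) by apply Rmax_r.
assert (Hfar : fv P (xm y1, y1) = m).
{ apply (maximum_along_curve _ _ _ _ _ _ m xm (fun s => s) y y1 HS HleA Hy1); [|exact Hmid].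
  intros s Hs. assert (Hs0 : 0 < s) by lra. destruct (Hxm s Hs0) as [B1 B2]. split; [|split].
  - apply (Dplus_iff _ _ _ _ H). lra.
  - apply (ex_derive_continuous xm). unfold xm.
    assert (ex_derive f s) by (eexists; apply (fw_derive theta); [exact H|exact Hs0]).
    auto_derive. auto.
  - apply continuous_id. }
destruct (Hxm y1 ltac:(lra)) as [B1 B2].
assert (fv P (xm y1, y1) <= l); [|lra].
apply HK.
- apply subset_closure, (Dplus_iff _ _ _ _ H). lra.
- apply Rlt_le_trans with y1; [generalize (Rle_abs K); lra|].
  rewrite <- (sqrt_pow2 y1) at 1 by lra. apply sqrt_le_1_alt. generalize (pow2_ge_0 (xm y1)). lra.
Qed.

(** Outside a large disc [P] is smaller than at [z1]. *)
Lemma maximum_attained theta f (P : R * R -> R) l z1 :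
  continuous_on (closure (Dplus theta f)) P -> closure (Dplus theta f) z1 -> l < P z1 ->
  (forall eps, 0 < eps -> exists K, forall x y, closure (Dplus theta f) (x, y) ->
     K < sqrt (x ^ 2 + y ^ 2) -> P (x, y) <= l + eps) ->
  exists x y, closure (Dplus theta f) (x, y) /\ l < P (x, y) /\
    forall z, closure (Dplus theta f) z -> P z <= P (x, y).
Proof.
intros HP Hz1 Hl Hinf. destruct z1 as [x1 y1].
destruct (Hinf ((P (x1, y1) - l) / 2) ltac:(lra)) as [K HK].
set (k := 1 + Rabs K + sqrt (x1 ^ 2 + y1 ^ 2)).
assert (Hs1 := sqrt_pos (x1 ^ 2 + y1 ^ 2)). assert (Hs2 := Rabs_pos K). assert (Hs3 := Rle_abs K).
assert (Hk : 0 < k) by (unfold k; lra).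
assert (Hsq : forall x y, dist2 0 0 (x, y) = x ^ 2 + y ^ 2).
{ intros x y. unfold dist2; simpl fst; simpl snd. ring. }
assert (Hnn : forall x y : R, 0 <= x ^ 2 + y ^ 2) by (intros x y; generalize (pow2_ge_0 x), (pow2_ge_0 y); lra).
assert (Hin : dist2 0 0 (x1, y1) <= k ^ 2).
{ rewrite Hsq, <- (pow2_sqrt (x1 ^ 2 + y1 ^ 2)) by apply Hnn. apply pow_incr. unfold k; lra. }
destruct (disc_compact_max (fun z => closure (Dplus theta f) z /\ dist2 0 0 z <= k ^ 2) 0 0 k P (x1, y1))
  as (x & y & [H1 H2] & Hmax); auto.
- apply closed_set_inter; [apply closed_set_closure|apply closed_set_disc].
- intros z Hz; apply Hz.
- apply (continuous_on_subset (closure (Dplus theta f))); [|exact HP]. intros z Hz; apply Hz.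
- exists x, y. assert (Hge := Hmax _ (conj Hz1 Hin)). split; [exact H1|]. split; [lra|].
  intros [x2 y2] Hz2. destruct (Rle_lt_dec (dist2 0 0 (x2, y2)) (k ^ 2)) as [Hd|Hd].
  + apply Hmax; auto.
  + assert (K < sqrt (x2 ^ 2 + y2 ^ 2)).
    { apply Rlt_le_trans with k; [unfold k; lra|]. rewrite <- (sqrt_pow2 k) by lra.
      apply sqrt_le_1_alt. rewrite <- Hsq. lra. }
    specialize (HK x2 y2 Hz2 H). lra.
Qed.

(** At its first return to zero [h] would have to increase. *)
Lemma negative_after_zero (h : R -> R) a :
  (forall y, a <= y -> ex_derive h y) -> h a = 0 ->
  (forall y, a <= y -> h y = 0 -> Derive h y < 0) ->
  forall y, a < y -> h y < 0.
Proof.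
intros Hd Ha Hz.
assert (Hloc : forall y, a <= y -> h y = 0 -> exists d, 0 < d /\ forall e, 0 < Rabs e < d -> h (y + e) * e < 0).
{ intros y Hy H0. assert (HD := Derive_correct h y (Hd y Hy)). apply is_derive_Reals in HD.
  specialize (Hz y Hy H0). destruct (HD (- Derive h y) ltac:(lra)) as [d Hdd].
  exists d; split; [apply cond_pos|]. intros e He.
  assert (Hne : e <> 0) by (intros ->; rewrite Rabs_R0 in He; lra).
  specialize (Hdd e Hne ltac:(lra)). rewrite H0, Rminus_0_r in Hdd. apply Rabs_def2 in Hdd.
  replace (h (y + e) * e) with (h (y + e) / e * e ^ 2) by (field; exact Hne).
  assert (0 < e ^ 2) by (apply pow2_gt_0; exact Hne).
  assert (h (y + e) / e < 0) by lra. nra. }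
assert (Hcont : forall y eps, a <= y -> 0 < eps -> exists d, 0 < d /\ forall t, Rabs (t - y) < d -> Rabs (h t - h y) < eps).
{ intros y eps Hy He. destruct (proj1 (filterlim_locally _ _) (ex_derive_continuous h y (Hd y Hy)) (mkposreal eps He)) as [d Hdd].
  exists d; split; [apply cond_pos|exact Hdd]. }
intros y2 Hy2. apply Rnot_le_lt; intros Hpos.
set (S := fun y => a <= y <= y2 /\ forall t, a < t <= y -> h t < 0).
destruct (completeness S) as [c [Hub Hlub]].
{ exists y2. intros y [Hy _]; lra. }
{ exists a. split; [lra|]. intros t Ht; lra. }
assert (Hca : a <= c) by (apply Hub; split; [lra|intros t Ht; lra]).
assert (Hc2 : c <= y2) by (apply Hlub; intros y [Hy _]; lra).
assert (Hbelow : forall t, a < t < c -> h t < 0).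
{ intros t Ht. apply NNPP; intros Hn. assert (c <= t); [|lra]. apply Hlub. intros s [Hs Hst].
  apply Rnot_lt_le; intros Hlt. apply Hn, Hst. lra. }
assert (Hext : forall d, 0 < d -> (forall t, c < t < c + d -> h t < 0) -> h c < 0 \/ c = a -> c < y2 -> False).
{ intros d Hd0 Hr Hc Hlt. set (e := Rmin (d / 2) (y2 - c)).
  assert (He : 0 < e) by (apply Rmin_pos; lra).
  assert (N1 : e <= d / 2) by apply Rmin_l. assert (N2 : e <= y2 - c) by apply Rmin_r.
  assert (S (c + e)); [|assert (c + e <= c) by (apply Hub; assumption); lra].
  split; [lra|]. intros t Ht. destruct (Rtotal_order t c) as [H|[H|H]].
  - apply Hbelow; lra.
  - subst t. destruct Hc as [Hc|Hc]; [exact Hc|lra].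
  - apply Hr; lra. }
destruct (Rtotal_order (h c) 0) as [H|[H|H]].
- destruct (Hcont c (- h c) Hca ltac:(lra)) as (d & Hd0 & Hc).
  destruct (Req_dec c y2) as [E|Hne]; [rewrite E in H; lra|].
  apply (Hext d Hd0); [|now left|lra]. intros t Ht.
  specialize (Hc t ltac:(rewrite Rabs_pos_eq; lra)). apply Rabs_def2 in Hc. lra.
- destruct (Hloc c Hca H) as (d & Hd0 & Hl).
  destruct (Req_dec c a) as [E|Hne].
  + apply (Hext d Hd0); [|now right|lra]. intros t Ht.
    specialize (Hl (t - c) ltac:(rewrite Rabs_pos_eq; lra)). replace (c + (t - c)) with t in Hl by ring. nra.
  + set (e := Rmin (d / 2) ((c - a) / 2)). assert (He : 0 < e) by (apply Rmin_pos; lra).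
    assert (N1 : e <= d / 2) by apply Rmin_l. assert (N2 : e <= (c - a) / 2) by apply Rmin_r.
    specialize (Hl (- e) ltac:(rewrite Rabs_Ropp, Rabs_pos_eq; lra)).
    specialize (Hbelow (c + - e) ltac:(lra)). nra.
- assert (Hne : c <> a) by (intros ->; lra).
  destruct (Hcont c (h c) Hca H) as (d & Hd0 & Hc).
  set (e := Rmin (d / 2) ((c - a) / 2)). assert (He : 0 < e) by (apply Rmin_pos; lra).
  assert (N1 : e <= d / 2) by apply Rmin_l. assert (N2 : e <= (c - a) / 2) by apply Rmin_r.
  specialize (Hbelow (c - e) ltac:(lra)).
  specialize (Hc (c - e) ltac:(replace (c - e - c) with (- e) by ring; rewrite Rabs_Ropp, Rabs_pos_eq; lra)).
  apply Rabs_def2 in Hc. lra.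
Qed.

(** This is the room for pushing arcs of the front or of the wall into the region
    between them. *)
Lemma front_wall_room theta f y0 k :
  front_in_wedge theta f -> 0 <= k < y0 ->
  exists e0, 0 < e0 /\ forall y, Rabs (y - y0) <= k -> 0 < y /\ f y + e0 <= y / tan theta.
Proof.
intros H Hk. assert (Ht := fw_tan _ _ H).
assert (Hpos : forall y, Rabs (y - y0) <= k -> 0 < y).
{ intros y Hy. apply Rabs_le_between in Hy. lra. }
destruct (compact_max (fun z => Rabs (snd z - y0) <= k /\ fst z = 0) (fun z => - (snd z / tan theta - f (snd z)))
  (Rabs y0 + k + 1) (0, y0)) as (xm & ym & [Hm1 Hm2] & Hmin).
- simpl. rewrite Rminus_diag, Rabs_R0. split; [lra|reflexivity].
- apply (closed_set_ext (fun z => ((True /\ Rabs (snd z - y0) <= (fun _ : R * R => k) z)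
     /\ fst z <= (fun _ : R * R => 0) z) /\ (fun _ : R * R => 0) z <= fst z)).
  { intros z. split; intros Hz; [split; [tauto|apply Rle_antisym; apply Hz]|].
    destruct Hz as [Hz1 Hz2]. repeat split; [exact Hz1| |]; rewrite Hz2; apply Rle_refl. }
  assert (Hc : forall D : R * R -> Prop, continuous_on D (fun z => Rabs (snd z - y0))).
  { intros D. apply (continuous_on_comp D Rabs (fun z => snd z - y0)); [intros; apply continuous_Rabs|cont_on]. }
  apply closed_set_le; [apply closed_set_le; [apply (closed_set_le (fun _ => True) (fun z => Rabs (snd z - y0)) (fun _ => k));
    [apply closed_set_everything|apply Hc|cont_on]| |]| |]; cont_on.
- simpl. intros x y' [H1 ->]. rewrite Rabs_R0. generalize (Rabs_pos y0), (Rabs_pos (y' - y0)). intros.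
  split; [lra|]. replace y' with ((y' - y0) + y0) by ring. eapply Rle_lt_trans; [apply Rabs_triang|]. lra.
- apply continuous_on_opp. apply continuous_on_minus.
  + apply (continuous_on_div _ (fun z => snd z) (fun _ => tan theta)); [intros; lra|cont_on|cont_on].
  + apply (continuous_on_comp _ f (fun z => snd z)); [|cont_on].
    intros z [Hz _]. apply (ex_derive_continuous f). eexists. apply (fw_derive theta); [exact H|].
    now apply Hpos.
- simpl in Hm1, Hmin.
  assert (Hym : 0 < ym) by (apply Hpos; lra). destruct (fw_below _ _ _ H Hym) as [B1 B2].
  exists (ym / tan theta - f ym). split.
  + assert (B3 : ym / tan theta * tan theta = ym) by (field; lra).
    assert (f ym < ym / tan theta) by (apply Rmult_lt_reg_r with (tan theta); lra). lra.
  + intros y' Hy'. split; [now apply Hpos|].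
    assert (Hroom := Hmin (0, y') (conj Hy' eq_refl)). simpl in Hroom. lra.
Qed.

Lemma front_tangential theta f F y0 :
  front_in_wedge theta f -> C1_field (Dplus theta f) F -> 0 < y0 ->
  is_derive (fun y => fv F (f y, y)) y0 (Derive f y0 * fx F (f y0, y0) + fy F (f y0, y0)).
Proof.
intros H HF Hy0. assert (Ht := fw_tan _ _ H).
assert (Hpos : forall y, Rabs (y - y0) < y0 -> 0 < y).
{ intros y Hy. apply Rabs_def2 in Hy. lra. }
apply (boundary_arc_derivative (Dplus theta f) (fv F) (fx F) (fy F) f (Derive f) 1 y0 y0); auto.
- now apply open_Dplus.
- apply Dplus_origin.
- intros y Hy. specialize (Hpos y Hy). destruct (fw_below _ _ _ H Hpos) as [B1 B2].
  split; [apply (closure_Dplus_iff _ _ _ _ H); lra|]. intros E; injection E; lra.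
- intros y Hy. apply (fw_derive theta); auto.
- apply (ex_derive_continuous (Derive f)). apply (fw_derive2 theta); auto.
- apply Rabs_R1.
- intros y Hy. destruct (front_wall_room theta f y0 (Rabs (y - y0)) H) as (e0 & He0 & Hroom).
  { split; [apply Rabs_pos|exact Hy]. }
  exists e0. split; [exact He0|]. intros y' e Hy' He. destruct (Hroom y' Hy') as [Hyp Hr].
  apply (Dplus_iff _ _ _ _ H). split; [exact Hyp|]. split; [lra|].
  apply Rlt_le_trans with (y' / tan theta * tan theta); [apply Rmult_lt_compat_r; lra|right; field; lra].
Qed.

Lemma wall_tangential theta f F x0 :
  front_in_wedge theta f -> C1_field (Dplus theta f) F -> 0 < x0 ->
  is_derive (fun y => fv F (y / tan theta, y)) (x0 * tan theta)
    (/ tan theta * fx F (x0, x0 * tan theta) + fy F (x0, x0 * tan theta)).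
Proof.
intros H HF Hx0. assert (Ht := fw_tan _ _ H). set (t := tan theta) in *. set (y0 := x0 * t).
assert (Hy0 : 0 < y0) by (apply Rmult_lt_0_compat; assumption).
assert (Hpos : forall y, Rabs (y - y0) < y0 -> 0 < y).
{ intros y Hy. apply Rabs_def2 in Hy. lra. }
assert (Hx : y0 / t = x0) by (unfold y0; field; lra).
replace (fx F (x0, y0)) with (fx F (y0 / t, y0)) by now rewrite Hx.
replace (fy F (x0, y0)) with (fy F (y0 / t, y0)) by now rewrite Hx.
assert (Hwall : forall y, 0 < y -> f y < y / t).
{ intros y Hy. destruct (fw_below _ _ _ H Hy) as [_ B]. fold t in B.
  apply Rmult_lt_reg_r with t; [exact Ht|]. replace (y / t * t) with y by (field; lra). exact B. }
apply (boundary_arc_derivative (Dplus theta f) (fv F) (fx F) (fy F) (fun y => y / t) (fun _ => / t) (-1) y0 y0); auto.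
- now apply open_Dplus.
- apply Dplus_origin.
- intros y Hy. specialize (Hpos y Hy). assert (Hw := Hwall y Hpos). destruct (fw_below _ _ _ H Hpos) as [B1 B2].
  split; [|intros E; injection E; lra]. apply (closure_Dplus_iff _ _ _ _ H). fold t.
  repeat split; try lra. right. field. lra.
- intros y Hy. auto_derive; [exact I|]. field. lra.
- apply continuous_const.
- rewrite Rabs_left; lra.
- intros y Hy. destruct (front_wall_room theta f y0 (Rabs (y - y0)) H) as (e0 & He0 & Hroom).
  { split; [apply Rabs_pos|exact Hy]. }
  exists e0. split; [exact He0|]. intros y' e Hy' He. destruct (Hroom y' Hy') as [Hyp Hr]. fold t in Hr.
  apply (Dplus_iff _ _ _ _ H). fold t. split; [exact Hyp|]. split; [lra|].
  apply Rlt_le_trans with (y' / t * t); [apply Rmult_lt_compat_r; lra|right; field; lra].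
Qed.

(** * The pressure behind the front is constant *)

Lemma definite_form_zero a b d t q : 0 < a -> 0 < a * d - b ^ 2 ->
  q * (a - 2 * b * t + d * t ^ 2) = 0 -> q = 0.
Proof.
intros Ha Hd H. apply Rmult_integral in H as [H|H]; [exact H|exfalso].
assert (a * (a - 2 * b * t + d * t ^ 2) = (a - b * t) ^ 2 + (a * d - b ^ 2) * t ^ 2) by ring.
rewrite H, Rmult_0_r in H0.
assert (P1 := pow2_ge_0 (a - b * t)). assert (P2 := pow2_ge_0 t).
assert (P3 : 0 <= (a * d - b ^ 2) * t ^ 2) by (apply Rmult_le_pos; lra).
assert (P4 : (a * d - b ^ 2) * t ^ 2 = 0) by lra.
apply Rmult_integral in P4 as [P4|P4]; [lra|].
assert (t = 0) by (apply Rsqr_0_uniq; rewrite Rsqr_pow2; exact P4). subst t. lra.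
Qed.

Lemma interior_local_max_derive (h : R -> R) c l e : is_derive h c l -> 0 < e ->
  (forall y, Rabs (y - c) < e -> h y <= h c) -> l = 0.
Proof.
intros Hh He Hm. apply is_derive_Reals in Hh.
assert (pr : derivable_pt h c) by (exists l; exact Hh).
rewrite <- (derive_pt_eq_0 h c l pr Hh).
apply (deriv_maximum h (c - e) (c + e)); [lra|lra|].
intros t Ht1 Ht2. apply Hm. apply Rabs_def1; lra.
Qed.

Lemma front_point_closure theta f y : front_in_wedge theta f -> 0 < y ->
  punctured_closure (Dplus theta f) (f y, y).
Proof.
intros H Hy. destruct (fw_below _ _ _ H Hy). split; [|intros E; injection E; lra].
apply (closure_Dplus_iff _ _ _ _ H). lra.
Qed.

Lemma front_slope gamma b0 theta f p0 u0 r0 pbar p u v r y :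
  behind_flow gamma b0 theta f p0 u0 r0 pbar p u v r -> 0 < y ->
  0 < r0 * u0 ^ 2 - (fv p (f y, y) - p0) /\
  fv v (f y, y) / fv u (f y, y)
    = Derive f y * ((fv p (f y, y) - p0) / (r0 * u0 ^ 2 - (fv p (f y, y) - p0))).
Proof.
intros H Hy. destruct (bf_data_pos H) as (Hp0 & Hu0 & Hr0).
assert (Hc := proj1 (front_point_closure _ _ y (bf_wedge H) Hy)).
assert (Hu := bf_u_pos H _ Hc).
destruct (bf_shock H y Hy) as (_ & _ & Eu & Ev & _).
set (P := fv p (f y, y)) in *.
assert (Hden : 0 < r0 * u0 ^ 2 - (P - p0)).
{ replace (r0 * u0 ^ 2 - (P - p0)) with (r0 * u0 * (u0 - (P - p0) / (r0 * u0))) by (field; lra).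
  rewrite <- Eu. repeat apply Rmult_lt_0_compat; assumption. }
split; [exact Hden|]. rewrite Ev, Eu. field.
replace (r0 * u0 ^ 2 - P + p0) with (r0 * u0 ^ 2 - (P - p0)) by ring.
replace (r0 * u0 * u0 - (P - p0)) with (r0 * u0 ^ 2 - (P - p0)) by ring.
repeat split; lra.
Qed.

(** An extremum of the pressure other than [pbar] lies on the front, at a point where
    the shock is normal: at any other front point the polar forces the whole
    gradient to vanish, and on the wall the slip condition is a Neumann
    condition; Hopf's lemma excludes both. *)
Lemma extremum_at_normal_shock gamma b0 theta f p0 u0 r0 pbar p u v r W a b d sg m x1 y1 :
  behind_flow gamma b0 theta f p0 u0 r0 pbar p u v r ->
  elliptic_system (Dplus theta f) p W a b d ->
  (forall z, fv W z = fv v z / fv u z /\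
      fv a z = / (fv r z * fv u z ^ 2) - / (gamma * fv p z) /\
      fv b z = - (fv v z / fv u z) / (gamma * fv p z) /\
      fv d z = / (fv r z * fv u z ^ 2) - (fv v z / fv u z) ^ 2 / (gamma * fv p z)) ->
  sg = 1 \/ sg = -1 -> sg * pbar < m ->
  closure (Dplus theta f) (x1, y1) -> sg * fv p (x1, y1) = m ->
  (forall z, closure (Dplus theta f) z -> sg * fv p z <= m) ->
  (forall z, Dplus theta f z -> sg * fv p z < m) /\
  0 < y1 /\ x1 = f y1 /\ Derive f y1 = 0.
Proof.
intros H HS HV Hsg Hm Hc1 Hm1 Hle.
assert (Hw := bf_wedge H). assert (Ht := fw_tan _ _ Hw).
assert (HF := bf_flow H).
destruct (bf_data_pos H) as (Hp0 & Hu0 & Hr0).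
assert (Hg := bf_gamma H).
assert (HSs := elliptic_scale _ _ _ _ _ _ sg HS).
assert (Hlt : forall z, Dplus theta f z -> sg * fv p z < m).
{ apply (no_interior_maximum theta f (scale_field sg p) _ a b d m ((sg * pbar + m) / 2) Hw HSs); [lra| |exact Hle].
  destruct (bf_infinity H ((m - sg * pbar) / 2) ltac:(lra)) as [K HK].
  exists K. intros x y Hxy Hfar. specialize (HK x y Hxy Hfar). apply Rabs_le_between in HK. simpl.
  destruct Hsg as [-> | ->]; lra. }
split; [exact Hlt|].
assert (Hc2 := Hc1). apply (closure_Dplus_iff _ _ _ _ Hw) in Hc2 as (G1 & G2 & G3).
assert (Hy1 : 0 < y1).
{ destruct (Rle_lt_or_eq_dec _ _ G1) as [Hy|<-]; [exact Hy|exfalso].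
  rewrite (fw_origin Hw) in G2. assert (x1 = 0) by nra. subst x1.
  rewrite (bf_corner H) in Hm1. lra. }
destruct (fw_below _ _ _ Hw Hy1) as [Bf1 Bf2].
split; [exact Hy1|].
destruct (Rle_lt_or_eq_dec _ _ G3) as [Hin|Hwall].
2:{ exfalso. subst y1. assert (Hx1 : 0 < x1) by lra.
  assert (Hh := hopf_wall theta f (scale_field sg p) _ a b d m x1 Hw HSs Hx1 Hlt Hm1). simpl in Hh.
  assert (HD := wall_tangential theta f W x1 Hw (es_W HS) Hx1).
  set (z := (x1, x1 * tan theta)) in *.
  assert (Hz : punctured_closure (Dplus theta f) z) by (split; [exact Hc1|intros E; injection E; lra]).
  assert (HWt : forall y : R, 0 < y -> fv W (y / tan theta, y) = tan theta).
  { intros y Hy. rewrite (proj1 (HV (y / tan theta, y))).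
    assert (Hyp : 0 < y / tan theta) by (apply Rdiv_lt_0_compat; lra).
    assert (Hsl := bf_slip H _ Hyp).
    replace (y / tan theta * tan theta) with y in Hsl by (field; lra). exact Hsl. }
  assert (HD0 : is_derive (fun y => fv W (y / tan theta, y)) (x1 * tan theta) 0).
  { apply (is_derive_ext_loc (fun _ => tan theta)); [|apply (is_derive_const (V := R_NormedModule) (tan theta))].
    exists (mkposreal _ Hy1). intros y Hy. change (Rabs (y - x1 * tan theta) < x1 * tan theta) in Hy.
    apply Rabs_def2 in Hy. symmetry. apply HWt. lra. }
  assert (EW := is_derive_unique _ _ _ HD). rewrite (is_derive_unique _ _ _ HD0) in EW.
  assert (E1 := es_eqy HS z Hz). assert (E2 := es_eqx HS z Hz).
  destruct (HV z) as (_ & Va & Vb & Vd).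
  assert (Hslip : fv v z / fv u z = tan theta) by apply (bf_slip H _ Hx1).
  rewrite Hslip in Vb, Vd. set (t := tan theta) in *.
  assert (Pu := bf_u_pos H z Hc1). assert (Pr := sf_r_pos HF z Hc1).
  assert (Pp := sf_p_pos HF z Hc1).
  set (k := / (fv r z * fv u z ^ 2)) in *. set (s := / (gamma * fv p z)) in *.
  assert (Hk : 0 < k) by (apply Rinv_0_lt_compat, Rmult_lt_0_compat; [|apply pow_lt]; assumption).
  assert (Vb' : fv b z = - t * s) by (rewrite Vb; reflexivity).
  assert (Vd' : fv d z = k - t ^ 2 * s) by (rewrite Vd; reflexivity).
  assert (Hn : k * (t * fx p z - fy p z) = 0).
  { assert (E3 : fx W z + t * fy W z = 0).
    { replace (fx W z + t * fy W z) with (t * (/ t * fx W z + fy W z)) by (field; lra). rewrite <- EW. ring. }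
    rewrite E1 in E3. replace (fx W z) with (- (- fx W z)) in E3 by ring. rewrite E2, Va, Vb', Vd' in E3. lra. }
  apply Rmult_integral in Hn as [Hn|Hn]; [lra|].
  replace (- t * (sg * fx p z) + sg * fy p z) with (- sg * (t * fx p z - fy p z)) in Hh by ring.
  rewrite Hn in Hh. lra. }
destruct (Rle_lt_or_eq_dec _ _ G2) as [Hin2|Hfr].
{ exfalso. assert (Dplus theta f (x1, y1)) by (apply (Dplus_iff _ _ _ _ Hw); lra).
  specialize (Hlt _ H0). lra. }
subst x1. split; [reflexivity|]. apply NNPP; intros HF0.
assert (Hz := front_point_closure _ _ _ Hw Hy1). set (z := (f y1, y1)) in *. set (F := Derive f y1) in *.
assert (Hh := hopf_front theta f (scale_field sg p) _ a b d m y1 Hw HSs Hy1 Hlt Hm1). simpl in Hh. fold z F in Hh.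
assert (HDp := front_tangential theta f p y1 Hw (es_P HS) Hy1). fold z F in HDp.
assert (HDW := front_tangential theta f W y1 Hw (es_W HS) Hy1). fold z F in HDW.
assert (Hnear : forall y, Rabs (y - y1) < y1 -> 0 < y).
{ intros y Hy. apply Rabs_def2 in Hy. lra. }
assert (HpT : F * fx p z + fy p z = 0).
{ assert (HDs : is_derive (fun y => sg * fv p (f y, y)) y1 (sg * (F * fx p z + fy p z))).
  { apply (is_derive_scal (fun y => fv p (f y, y))). exact HDp. }
  assert (E := interior_local_max_derive _ _ _ y1 HDs Hy1).
  apply Rmult_eq_reg_l with sg; [|destruct Hsg as [-> | ->]; lra]. rewrite Rmult_0_r. apply E.
  intros y Hy. change (sg * fv p (f y, y) <= sg * fv p z). rewrite Hm1. apply Hle, (front_point_closure _ _ _ Hw (Hnear y Hy)). }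
(* along the front, the slope of the shock is stationary where the pressure is *)
destruct (fw_derive2 theta f y1 Hw Hy1) as [F' HF'].
rewrite HpT in HDp.
assert (HF1 : F' = 0).
{ assert (HE : is_derive (fun y => (1 + Derive f y ^ 2) * ((gamma + 1) * fv p (f y, y) + (gamma - 1) * p0)) y1
     (2 * F * F' * ((gamma + 1) * fv p z + (gamma - 1) * p0) + (1 + F ^ 2) * ((gamma + 1) * 0))).
  { assert (X1 : ex_derive (Derive f) y1) by (eexists; exact HF').
    assert (X2 : ex_derive (fun y => fv p (f y, y)) y1) by (eexists; exact HDp).
    assert (Z1 : Derive (fun y : R => Derive f y) y1 = F') by now apply is_derive_unique.
    assert (Z2 : Derive (fun y : R => fv p (f y, y)) y1 = 0) by now apply is_derive_unique.
    set (h := fun y => fv p (f y, y)) in *. set (g := Derive f) in *.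
    apply (is_derive_ext (fun y => (1 + g y ^ 2) * ((gamma + 1) * h y + (gamma - 1) * p0))); [reflexivity|].
    auto_derive; [auto|]. 
    change (Derive (fun x => g x) y1 = F') in Z1. change (Derive (fun x => h x) y1 = 0) in Z2.
    rewrite Z1, Z2. fold F. change (h y1) with (fv p z). change (g y1) with F. ring. }
  assert (HE0 : is_derive (fun y => (1 + Derive f y ^ 2) * ((gamma + 1) * fv p (f y, y) + (gamma - 1) * p0)) y1 0).
  { apply (is_derive_ext_loc (fun _ => 2 * r0 * u0 ^ 2)); [|apply (is_derive_const (V := R_NormedModule) (2 * r0 * u0 ^ 2))].
    exists (mkposreal _ Hy1). intros y Hy.
    apply (bf_shock H y (Hnear y Hy)). }
  assert (EW := is_derive_unique _ _ _ HE). rewrite (is_derive_unique _ _ _ HE0) in EW.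
  assert (HN : 0 < (gamma + 1) * fv p z + (gamma - 1) * p0).
  { assert (Pp := sf_p_pos HF z (proj1 Hz)).
    assert (0 < (gamma + 1) * fv p z) by (apply Rmult_lt_0_compat; lra).
    assert (0 < (gamma - 1) * p0) by (apply Rmult_lt_0_compat; lra). lra. }
  assert (E2 : F' * (2 * F * ((gamma + 1) * fv p z + (gamma - 1) * p0)) = 0) by lra.
  apply Rmult_integral in E2 as [E2|E2]; [exact E2|exfalso].
  apply Rmult_integral in E2 as [E2|E2]; lra. }
rewrite HF1 in HF'.
assert (HWT : F * fx W z + fy W z = 0).
{ destruct (front_slope _ _ _ _ _ _ _ _ _ _ _ _ y1 H Hy1) as [Hden _]. fold z in Hden.
  assert (X1 : ex_derive (Derive f) y1) by (eexists; exact HF').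
  assert (X2 : ex_derive (fun y => fv p (f y, y)) y1) by (eexists; exact HDp).
  assert (Z1 : Derive (fun y : R => Derive f y) y1 = 0) by now apply is_derive_unique.
  assert (Z2 : Derive (fun y : R => fv p (f y, y)) y1 = 0) by now apply is_derive_unique.
  assert (HE : is_derive (fun y => Derive f y * ((fv p (f y, y) - p0) / (r0 * u0 ^ 2 - (fv p (f y, y) - p0)))) y1 0).
  { set (h := fun y => fv p (f y, y)) in *. set (g := Derive f) in *.
    apply (is_derive_ext (fun y => g y * ((h y - p0) / (r0 * u0 ^ 2 - (h y - p0))))); [reflexivity|].
    auto_derive; [repeat split; auto; change (h y1) with (fv p z); lra|].
    change (Derive (fun x => g x) y1 = 0) in Z1. change (Derive (fun x => h x) y1 = 0) in Z2.
    rewrite Z1, Z2. ring. }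
  rewrite <- (is_derive_unique _ _ _ HDW), <- (is_derive_unique _ _ _ HE).
  apply Derive_ext_loc. exists (mkposreal _ Hy1). intros y Hy.
  change (fv W (f y, y) = Derive f y * ((fv p (f y, y) - p0) / (r0 * u0 ^ 2 - (fv p (f y, y) - p0)))).
  rewrite (proj1 (HV (f y, y))). apply (front_slope _ _ _ _ _ _ _ _ _ _ _ _ y H (Hnear y Hy)). }
assert (E1 := es_eqy HS z Hz). assert (E2 := es_eqx HS z Hz).
assert (Hpx : fx p z = 0).
{ apply (definite_form_zero (fv a z) (fv b z) (fv d z) F);
    [apply (es_pos HS z (proj1 Hz))|apply (es_det HS z (proj1 Hz))|].
  assert (Epy : fy p z = - F * fx p z) by lra.
  rewrite E1 in HWT. replace (fx W z) with (- (- fx W z)) in HWT by ring. rewrite E2, Epy in HWT.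
  rewrite <- HWT. ring. }
assert (Hpy : fy p z = 0) by (rewrite Hpx in HpT; lra).
rewrite Hpx, Hpy in Hh. lra.
Qed.

(** A normal shock has the largest pressure on the polar, hence no minimum below [pbar]. *)
Lemma pressure_at_least gamma b0 theta f p0 u0 r0 pbar p u v r :
  behind_flow gamma b0 theta f p0 u0 r0 pbar p u v r ->
  forall z, closure (Dplus theta f) z -> pbar <= fv p z.
Proof.
intros H z Hz. apply Rnot_lt_le; intros Hlt.
assert (HF := bf_flow H). assert (Hg := bf_gamma H).
destruct (subsonic_elliptic _ _ _ _ _ _ _ Hg HF (bf_u_pos H)
  (bf_subsonic H)) as (W & a & b & d & HS & HV).
destruct (maximum_attained theta f (fun z => -1 * fv p z) (-1 * pbar) z) as (x1 & y1 & Hc1 & Hl & Hmax); auto; [|lra| |].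
{ apply continuous_on_mult; [apply continuous_on_const|apply (sf_p HF)]. }
{ intros eps He. destruct (bf_infinity H eps He) as [K HK].
  exists K. intros x y Hxy Hfar. specialize (HK x y Hxy Hfar). apply Rabs_le_between in HK. lra. }
destruct (extremum_at_normal_shock _ _ _ _ _ _ _ _ _ _ _ _ W a b d (-1) (-1 * fv p (x1, y1)) x1 y1 H HS HV
  (or_intror eq_refl) Hl Hc1 eq_refl Hmax) as (_ & Hy1 & -> & HF0).
destruct (bf_shock H y1 Hy1) as (_ & E & _). rewrite HF0 in E.
destruct (bf_pbar H) as [_ B].
assert ((gamma + 1) * fv p (f y1, y1) < (gamma + 1) * pbar) by (apply Rmult_lt_compat_l; lra). lra.
Qed.

(** A pressure above [pbar] would make the shock normal somewhere, with the front
    turning back there; it could then never turn forward again, and would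
    leave the domain. *)
Lemma pressure_at_most gamma b0 theta f p0 u0 r0 pbar p u v r :
  behind_flow gamma b0 theta f p0 u0 r0 pbar p u v r ->
  forall z, closure (Dplus theta f) z -> fv p z <= pbar.
Proof.
intros H z Hz. apply Rnot_lt_le; intros Hlt.
assert (HF := bf_flow H). assert (Hg := bf_gamma H).
assert (Hw := bf_wedge H).
destruct (bf_data_pos H) as (Hp0 & Hu0 & Hr0).
destruct (bf_pbar H) as [B1 B2].
assert (Hshock := bf_shock H).
destruct (subsonic_elliptic _ _ _ _ _ _ _ Hg HF (bf_u_pos H)
  (bf_subsonic H)) as (W & a & b & d & HS & HV).
destruct (maximum_attained theta f (fun z => 1 * fv p z) (1 * pbar) z) as (x1 & y1 & Hc1 & Hl & Hmax); auto; [|lra| |].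
{ apply continuous_on_mult; [apply continuous_on_const|apply (sf_p HF)]. }
{ intros eps He. destruct (bf_infinity H eps He) as [K HK].
  exists K. intros x y Hxy Hfar. specialize (HK x y Hxy Hfar). apply Rabs_le_between in HK. lra. }
set (m := 1 * fv p (x1, y1)) in *.
destruct (extremum_at_normal_shock _ _ _ _ _ _ _ _ _ _ _ _ W a b d 1 m x1 y1 H HS HV
  (or_introl eq_refl) Hl Hc1 eq_refl Hmax) as (Hlt1 & Hy1 & Hx1 & HF0).
subst x1.
set (w := fun y => fv W (f y, y)).
assert (Hwd : forall y, 0 < y -> is_derive w y (Derive f y * fx W (f y, y) + fy W (f y, y))).
{ intros y Hy. apply (front_tangential theta f W y Hw (es_W HS) Hy). }
assert (Hwf : forall y, 0 < y -> exists g, 0 < g /\ w y = Derive f y * g).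
{ intros y Hy. destruct (front_slope _ _ _ _ _ _ _ _ _ _ _ _ y H Hy) as [Hden E].
  exists ((fv p (f y, y) - p0) / (r0 * u0 ^ 2 - (fv p (f y, y) - p0))). split.
  - apply Rdiv_lt_0_compat; [|exact Hden]. destruct (Hshock y Hy) as [K _]. lra.
  - unfold w. rewrite (proj1 (HV (f y, y))). exact E. }
(* every normal shock point carries the maximal pressure, hence Hopf's lemma applies there *)
assert (Hzero : forall y, 0 < y -> w y = 0 -> Derive w y < 0).
{ intros y Hy Hw0. rewrite (is_derive_unique _ _ _ (Hwd y Hy)).
  destruct (Hwf y Hy) as (g & Hgp & Eg).
  assert (HFy : Derive f y = 0).
  { rewrite Hw0 in Eg. symmetry in Eg. apply Rmult_integral in Eg as [Eg|Eg]; [exact Eg|lra]. }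
  assert (Hpm : 1 * fv p (f y, y) = m).
  { unfold m. destruct (Hshock y Hy) as (_ & E1 & _). destruct (Hshock y1 Hy1) as (_ & E2 & _).
    rewrite HFy in E1. rewrite HF0 in E2.
    apply Rmult_eq_reg_l with (gamma + 1); [|lra]. lra. }
  assert (HSs := elliptic_scale _ _ _ _ _ _ 1 HS).
  assert (Hh := hopf_front theta f (scale_field 1 p) _ a b d m y Hw HSs Hy Hlt1 Hpm). simpl in Hh.
  rewrite HFy in Hh |- *.
  assert (Hz' := front_point_closure _ _ _ Hw Hy).
  assert (HpT : 1 * (Derive f y * fx p (f y, y) + fy p (f y, y)) = 0).
  { apply (interior_local_max_derive (fun y => 1 * fv p (f y, y)) y _ y).
    - apply (is_derive_scal (fun y => fv p (f y, y))).
      apply (front_tangential theta f p y Hw (es_P HS) Hy).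
    - exact Hy.
    - intros y' Hy'. rewrite Hpm. apply Hmax, (front_point_closure _ _ _ Hw).
      apply Rabs_def2 in Hy'. lra. }
  rewrite HFy in HpT.
  rewrite (es_eqy HS _ Hz').
  assert (Ha := es_pos HS _ (proj1 Hz')).
  replace (fy p (f y, y)) with 0 by lra.
  assert (fx p (f y, y) < 0) by lra. nra. }
assert (Hneg : forall y, y1 < y -> Derive f y < 0).
{ intros y Hy. assert (Hwy : w y < 0).
  { apply (negative_after_zero w y1); [| | |exact Hy].
    - intros t Ht. eexists. apply Hwd. lra.
    - destruct (Hwf y1 Hy1) as (g & _ & ->). rewrite HF0. ring.
    - intros t Ht. apply Hzero. lra. }
  destruct (Hwf y ltac:(lra)) as (g & Hgp & Eg). rewrite Eg in Hwy.
  apply Rnot_le_lt; intros Hle. assert (0 <= Derive f y * g) by (apply Rmult_le_pos; lra). lra. }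
(* far out the shock stays oblique: [eps] keeps its strength [gap / 2] away from that of
   the normal shock, and then the squared derivative of the front is at least [q] *)
set (N := (gamma + 1) * pbar + (gamma - 1) * p0) in *.
assert (HN : 0 < N).
{ unfold N. assert (0 < (gamma + 1) * pbar) by (apply Rmult_lt_0_compat; lra).
  assert (0 < (gamma - 1) * p0) by (apply Rmult_lt_0_compat; lra). lra. }
set (gap := 2 * r0 * u0 ^ 2 - N). assert (Hgap : 0 < gap) by (unfold gap; lra).
set (eps := gap / (2 * (gamma + 1))).
assert (Heps : 0 < eps) by (apply Rdiv_lt_0_compat; lra).
assert (Heps2 : (gamma + 1) * eps = gap / 2) by (unfold eps; field; lra).
destruct (bf_infinity H eps Heps) as [K HK].
set (q := gap / (2 * (2 * r0 * u0 ^ 2))).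
assert (Hru : 0 < 2 * r0 * u0 ^ 2) by lra.
assert (Hq : 0 < q) by (apply Rdiv_lt_0_compat; lra).
set (c := sqrt q). assert (Hc : 0 < c) by (now apply sqrt_lt_R0).
assert (Hc2 : c ^ 2 = q) by (apply pow2_sqrt; lra).
set (Y := y1 + Rabs K + 1). assert (HKp := Rabs_pos K). assert (HKle := Rle_abs K).
assert (Hsteep : forall y, Y <= y -> Derive f y <= - c).
{ intros y Hy. assert (Hyp : 0 < y) by (unfold Y in Hy; lra).
  assert (Hneg' := Hneg y ltac:(unfold Y in Hy; lra)).
  assert (Hfar : Rabs (fv p (f y, y) - pbar) <= eps).
  { apply HK; [apply (front_point_closure _ _ _ Hw Hyp)|].
    apply Rlt_le_trans with y; [unfold Y in Hy; lra|].
    rewrite <- (sqrt_pow2 y) at 1 by lra. apply sqrt_le_1_alt. generalize (pow2_ge_0 (f y)). lra. }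
  apply Rabs_le_between in Hfar.
  destruct (Hshock y Hyp) as (K1 & K2 & _). set (P := fv p (f y, y)) in *. set (F := Derive f y) in *.
  assert (HNP : (gamma + 1) * P + (gamma - 1) * p0 <= N + gap / 2).
  { unfold N. rewrite <- Heps2. assert ((gamma + 1) * P <= (gamma + 1) * (pbar + eps)) by (apply Rmult_le_compat_l; lra). lra. }
  assert (HNP0 : 0 < (gamma + 1) * P + (gamma - 1) * p0).
  { assert (0 < (gamma + 1) * P) by (apply Rmult_lt_0_compat; lra).
    assert (0 < (gamma - 1) * p0) by (apply Rmult_lt_0_compat; lra). lra. }
  assert (HF2 : c ^ 2 <= F ^ 2).
  { rewrite Hc2. set (M := (gamma + 1) * P + (gamma - 1) * p0) in *.
    assert (HM : M <= 2 * r0 * u0 ^ 2 - gap / 2) by (unfold gap in *; lra).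
    assert (HFM : F ^ 2 * M = 2 * r0 * u0 ^ 2 - M) by lra.
    assert (gap / 2 <= F ^ 2 * (2 * r0 * u0 ^ 2)).
    { apply Rle_trans with (F ^ 2 * M); [lra|]. apply Rmult_le_compat_l; [apply pow2_ge_0|lra]. }
    apply Rmult_le_reg_r with (2 * r0 * u0 ^ 2); [exact Hru|].
    replace (q * (2 * r0 * u0 ^ 2)) with (gap / 2) by (unfold q; field; lra). exact H0. }
  apply Rnot_lt_le; intros Hc0. assert (F ^ 2 < c ^ 2); [|lra]. nra. }
assert (HYp : 0 < Y) by (unfold Y; lra).
destruct (fw_below _ _ Y Hw HYp) as [HfY _].
(* descending at rate [c] from height [f Y], the front is below zero at [y2] *)
set (y2 := Y + (f Y + 1) / c).
assert (Hy2 : Y < y2) by (unfold y2; assert (0 < (f Y + 1) / c) by (apply Rdiv_lt_0_compat; lra); lra).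
destruct (mvt_open f (Derive f) Y y2 Hy2) as (s & Hs & E).
{ intros s Hs. apply (fw_derive theta); [exact Hw|lra]. }
{ intros s Hs. apply continuity_pt_filterlim, (ex_derive_continuous f). eexists. apply (fw_derive theta); [exact Hw|lra]. }
assert (HFs := Hsteep s ltac:(lra)).
destruct (fw_below _ _ y2 Hw ltac:(lra)) as [Hf2 _].
assert (Derive f s * (y2 - Y) <= - c * (y2 - Y)) by (apply Rmult_le_compat_r; lra).
replace (- c * (y2 - Y)) with (- (f Y + 1)) in H0 by (unfold y2; field; lra). lra.
Qed.

(** * The flow behind the front is uniform *)

(** With constant pressure the polar fixes the slope of the front, and velocity and
    density are carried unchanged along the streamlines, which are parallel to the wall
    and all start on the front. *)
Lemma behind_uniform gamma b0 theta f p0 u0 r0 pbar p u v r :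
  behind_flow gamma b0 theta f p0 u0 r0 pbar p u v r ->
  exists k, 0 < k /\ (forall y, 0 < y -> f y = k * y) /\
    2 * r0 * u0 ^ 2 = (1 + k ^ 2) * ((gamma + 1) * pbar + (gamma - 1) * p0) /\
    forall z, closure (Dplus theta f) z ->
      fv p z = pbar /\ fv u z = u0 - (pbar - p0) / (r0 * u0) /\
      fv v z = fv u z * tan theta /\
      fv r z = r0 * (((gamma + 1) * pbar + (gamma - 1) * p0) / ((gamma - 1) * pbar + (gamma + 1) * p0)).
Proof.
intros H.
assert (HF := bf_flow H). assert (Hg := bf_gamma H).
assert (Hw := bf_wedge H). assert (Ht := fw_tan _ _ Hw).
destruct (bf_data_pos H) as (Hp0 & Hu0 & Hr0).
destruct (bf_pbar H) as [B1 B2].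
assert (Hshock := bf_shock H).
assert (HA := sf_open HF). assert (HO := sf_origin HF).
assert (Pp : forall z, closure (Dplus theta f) z -> fv p z = pbar).
{ intros z Hz. apply Rle_antisym.
  - apply (pressure_at_most _ _ _ _ _ _ _ _ _ _ _ _ H z Hz).
  - apply (pressure_at_least _ _ _ _ _ _ _ _ _ _ _ _ H z Hz). }
assert (Hgp : forall x y, Dplus theta f (x, y) -> fx p (x, y) = 0 /\ fy p (x, y) = 0).
{ intros x y Hz. apply (gradient_of_constant (Dplus theta f) p pbar x y HA HO (sf_p HF)); [|exact Hz].
  intros z Hz'. apply Pp, subset_closure, Hz'. }
destruct (subsonic_elliptic _ _ _ _ _ _ _ Hg HF (bf_u_pos H)
  (bf_subsonic H)) as (W & a & b & d & HS & HV).
set (t := tan theta) in *.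
assert (HW : forall z, Dplus theta f z -> fv W z = t).
{ intros [x y] Hz. assert (Hz' := Hz). apply (Dplus_iff _ _ _ _ Hw) in Hz' as (Hy & Hx1 & Hx2). fold t in Hx2.
  destruct (fw_below _ _ _ Hw Hy) as [C1 C2]. fold t in C2.
  assert (E0 : y / t * t = y) by (field; lra).
  assert (Hxw : x < y / t) by (apply Rmult_lt_reg_r with t; lra).
  assert (Hseg : forall s, 0 < s <= 1 -> Dplus theta f (y / t + s * (x - y / t), y + s * 0)).
  { intros s Hs. rewrite Rmult_0_r, Rplus_0_r. apply (Dplus_iff _ _ _ _ Hw). fold t.
    split; [exact Hy|]. split; [nra|].
    replace ((y / t + s * (x - y / t)) * t) with (y / t * t - s * (y / t * t - x * t)) by ring. rewrite E0.
    assert (0 < s * (y - x * t)) by (apply Rmult_lt_0_compat; lra). lra. }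
  destruct (segment_mvt (Dplus theta f) (fv W) (fx W) (fy W) (y / t) y (x - y / t) 0 HA HO (es_W HS))
    as (s & Hs & E).
  - apply (closure_Dplus_iff _ _ _ _ Hw). fold t. lra.
  - exact Hseg.
  - replace (y / t + (x - y / t)) with x in E by ring. rewrite Rplus_0_r in E.
    assert (Hs' := Hseg s ltac:(lra)). destruct (Hgp _ _ Hs') as [Gx Gy].
    assert (E2 := es_eqx HS _ (subset_punctured _ _ HO Hs')).
    rewrite Gx, Gy in E2.
    assert (Hwx : fx W (y / t + s * (x - y / t), y + s * 0) = 0) by lra.
    rewrite Hwx in E.
    assert (Hwall : fv W (y / t, y) = t).
    { rewrite (proj1 (HV (y / t, y))).
      assert (Hyp : 0 < y / t) by (apply Rdiv_lt_0_compat; lra).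
      assert (Hsl := bf_slip H _ Hyp). fold t in Hsl. rewrite E0 in Hsl. exact Hsl. }
    rewrite <- Hwall. lra. }
assert (HWc : forall z, closure (Dplus theta f) z -> fv W z = t).
{ apply (eq_closure (Dplus theta f) (closure (Dplus theta f)) (fv W) (fun _ => t)); auto.
  - apply subset_closure.
  - apply (es_W HS).
  - apply continuous_on_const. }
assert (Hfc : forall y, 0 < y -> closure (Dplus theta f) (f y, y)).
{ intros y Hy. apply (front_point_closure _ _ _ Hw Hy). }
set (g := (pbar - p0) / (r0 * u0 ^ 2 - (pbar - p0))).
assert (Hgpos : 0 < g).
{ destruct (front_slope _ _ _ _ _ _ _ _ _ _ _ _ 1 H Rlt_0_1) as [Hden _].
  rewrite (Pp _ (Hfc 1 Rlt_0_1)) in Hden. apply Rdiv_lt_0_compat; lra. }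
set (k := t / g). assert (Hk : 0 < k) by (now apply Rdiv_lt_0_compat).
assert (HFk : forall y, 0 < y -> Derive f y = k).
{ intros y Hy. destruct (front_slope _ _ _ _ _ _ _ _ _ _ _ _ y H Hy) as [Hden E].
  rewrite (Pp _ (Hfc y Hy)) in E. fold g in E.
  rewrite <- (proj1 (HV (f y, y))), (HWc _ (Hfc y Hy)) in E. unfold k. rewrite E. field. lra. }
assert (Hlin : forall y, 0 < y -> f y = k * y).
{ assert (Hconst : forall y1 y2, 0 < y1 -> y1 < y2 -> f y2 - f y1 = k * (y2 - y1)).
  { intros y1 y2 H1 H2. destruct (mvt_open f (Derive f) y1 y2 H2) as (s & Hs & E).
    - intros s Hs. apply (fw_derive theta); [exact Hw|lra].
    - intros s Hs. apply continuity_pt_filterlim, (ex_derive_continuous f). eexists.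
      apply (fw_derive theta); [exact Hw|lra].
    - rewrite E, HFk by lra. reflexivity. }
  intros y Hy. apply NNPP; intros Hne.
  set (c := f y - k * y). assert (Hc : c <> 0) by (unfold c; intros E; apply Hne; lra).
  (* the constant f y - k y is squeezed to 0 at the vertex *)
  set (e := Rmin (y / 2) (Rabs c / (2 * (/ t + k)))).
  assert (Hit : 0 < / t) by now apply Rinv_0_lt_compat.
  assert (Hac : 0 < Rabs c) by now apply Rabs_pos_lt.
  assert (He : 0 < e) by (apply Rmin_pos; [lra|apply Rdiv_lt_0_compat; lra]).
  assert (N1 : e <= y / 2) by apply Rmin_l.
  assert (N2 : e * (/ t + k) <= Rabs c / 2).
  { apply Rle_trans with (Rabs c / (2 * (/ t + k)) * (/ t + k)); [apply Rmult_le_compat_r; [lra|apply Rmin_r]|right].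
    set (q := / t + k). assert (q <> 0) by (unfold q; lra). field. assumption. }
  assert (Ee := Hconst e y He ltac:(lra)).
  assert (Ec : c = f e - k * e) by (unfold c; lra).
  destruct (fw_below _ _ _ Hw He) as [C1 C2]. fold t in C2.
  assert (C3 : f e < e * / t).
  { apply Rmult_lt_reg_r with t; [exact Ht|]. replace (e * / t * t) with e by (field; lra). exact C2. }
  assert (0 < k * e) by (apply Rmult_lt_0_compat; lra).
  assert (Rabs c < Rabs c); [|lra].
  apply Rle_lt_trans with (e * (/ t + k)); [|lra]. rewrite Ec. apply Rabs_le. lra. }
assert (Hkt : k * t < 1).
{ destruct (fw_below _ _ 1 Hw Rlt_0_1) as [_ C2]. fold t in C2. rewrite (Hlin 1 Rlt_0_1) in C2. lra. }
exists k. split; [exact Hk|]. split; [exact Hlin|]. split.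
{ destruct (Hshock 1 Rlt_0_1) as (_ & E & _). rewrite (HFk 1 Rlt_0_1), (Pp _ (Hfc 1 Rlt_0_1)) in E. exact E. }
assert (Hcarry : forall F c, C1_field (Dplus theta f) F ->
   (forall x y, Dplus theta f (x, y) -> fx F (x, y) + t * fy F (x, y) = 0) ->
   (forall y, 0 < y -> fv F (f y, y) = c) ->
   forall z, closure (Dplus theta f) z -> fv F z = c).
{ intros F c HFC Hdir Hfr.
  apply (eq_closure (Dplus theta f) (closure (Dplus theta f)) (fv F) (fun _ => c)); auto.
  - apply subset_closure.
  - apply HFC.
  - apply continuous_on_const.
  - intros [x y] Hz. apply (Dplus_iff _ _ _ _ Hw) in Hz as (Hy & Hx1 & Hx2). fold t in Hx2.
    rewrite (Hlin y Hy) in Hx1.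
    (* the streamline through (x, y) meets the front at (xs, ys) *)
    set (s := (x - k * y) / (1 - k * t)). assert (Hs : 0 < s) by (apply Rdiv_lt_0_compat; lra).
    assert (Es : s * (1 - k * t) = x - k * y) by (unfold s; field; lra).
    set (ys := y - s * t). set (xs := x - s).
    assert (Hys : 0 < ys).
    { apply Rmult_lt_reg_r with (1 - k * t); [lra|]. rewrite Rmult_0_l.
      replace (ys * (1 - k * t)) with (y * (1 - k * t) - t * (s * (1 - k * t))) by (unfold ys; ring).
      rewrite Es. lra. }
    assert (Exs : xs = f ys) by (rewrite (Hlin ys Hys); unfold xs, ys; lra).
    assert (Hseg : forall q, 0 < q <= 1 -> Dplus theta f (xs + q * s, ys + q * (s * t))).
    { intros q Hq. assert (0 < q * s) by (apply Rmult_lt_0_compat; lra).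
      assert (0 < q * (s * t)) by (apply Rmult_lt_0_compat; [lra|apply Rmult_lt_0_compat; lra]).
      assert (0 < q * s * (1 - k * t)) by (apply Rmult_lt_0_compat; lra).
      apply (Dplus_iff _ _ _ _ Hw). fold t. split; [lra|]. rewrite (Hlin (ys + q * (s * t))) by lra.
      rewrite Exs, (Hlin ys Hys). split; [lra|].
      replace ((k * ys + q * s) * t) with (k * t * ys + q * (s * t)) by ring.
      assert (k * t * ys < 1 * ys) by (apply Rmult_lt_compat_r; lra). lra. }
    destruct (segment_mvt (Dplus theta f) (fv F) (fx F) (fy F) xs ys s (s * t) HA HO HFC) as (q & Hq & E).
    + rewrite Exs. apply Hfc, Hys.
    + exact Hseg.
    + replace (xs + s) with x in E by (unfold xs; ring). replace (ys + s * t) with y in E by (unfold ys; ring).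
      assert (Hd := Hdir _ _ (Hseg q ltac:(lra))).
      replace (s * fx F (xs + q * s, ys + q * (s * t)) + s * t * fy F (xs + q * s, ys + q * (s * t)))
        with (s * (fx F (xs + q * s, ys + q * (s * t)) + t * fy F (xs + q * s, ys + q * (s * t)))) in E by ring.
      rewrite Hd, Rmult_0_r, Exs, (Hfr ys Hys) in E. lra. }
assert (Hv : forall z, closure (Dplus theta f) z -> fv v z = fv u z * t).
{ intros z Hz. rewrite <- (HWc z Hz), (proj1 (HV z)).
  assert (Pu := bf_u_pos H z Hz). field. lra. }
assert (Hu : forall z, closure (Dplus theta f) z -> fv u z = u0 - (pbar - p0) / (r0 * u0)).
{ apply Hcarry; [apply (sf_u HF)| |].
  - intros x y Hz. assert (Hc := subset_closure _ _ Hz). assert (Hpc := subset_punctured _ _ HO Hz).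
    assert (E := sf_momx HF _ Hpc). destruct (Hgp _ _ Hz) as [Gx _].
    rewrite Gx, (Hv _ Hc), Rplus_0_r in E.
    assert (Pu := bf_u_pos H _ Hc). assert (Pr := sf_r_pos HF _ Hc).
    apply Rmult_integral in E as [E|E]; [lra|].
    apply Rmult_eq_reg_l with (fv u (x, y)); [|lra]. lra.
  - intros y Hy. destruct (Hshock y Hy) as (_ & _ & E & _). rewrite (Pp _ (Hfc y Hy)) in E. exact E. }
intros z Hz. split; [now apply Pp|]. split; [now apply Hu|]. split; [now apply Hv|].
revert z Hz. apply Hcarry; [apply (sf_r HF)| |].
- intros x y Hz. assert (Hc := subset_closure _ _ Hz). assert (Hpc := subset_punctured _ _ HO Hz).
  assert (E := smooth_flow_entropy _ _ _ _ _ _ _ _ Hg HF Hpc). destruct (Hgp _ _ Hz) as [Gx Gy].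
  rewrite Gx, Gy, (Hv _ Hc) in E.
  assert (Pu := bf_u_pos H _ Hc). assert (Pr := sf_r_pos HF _ Hc).
  assert (Ppz := sf_p_pos HF _ Hc).
  assert (E3 : gamma * fv p (x, y) / fv r (x, y) * fv u (x, y) * (fx r (x, y) + t * fy r (x, y)) = 0) by lra.
  apply Rmult_integral in E3 as [E3|E3]; [exfalso|exact E3].
  apply Rmult_integral in E3 as [E3|E3]; [|lra].
  assert (0 < gamma * fv p (x, y) / fv r (x, y)) by (apply Rdiv_lt_0_compat; [apply Rmult_lt_0_compat|]; lra). lra.
- intros y Hy. destruct (Hshock y Hy) as (_ & _ & _ & _ & E). rewrite (Pp _ (Hfc y Hy)) in E. exact E.
Qed.

(** * Uniqueness of the transonic shock *)

Lemma mach_mach_sqr gamma U : 1 < gamma -> 0 < pres U -> 0 < dens U ->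
  mach gamma U = sqrt (mach_sqr gamma (pres U) (velx U) (vely U) (dens U)).
Proof.
intros Hg Hp Hr. unfold mach, sonic_speed, mach_sqr.
assert (Hc : 0 < gamma * pres U / dens U) by (apply Rdiv_lt_0_compat; [apply Rmult_lt_0_compat|]; lra).
rewrite <- sqrt_div_alt by exact Hc. f_equal. field. lra.
Qed.

Lemma supersonic_mach_sqr gamma U : 1 < gamma -> 0 < pres U -> 0 < dens U -> supersonic gamma U ->
  1 < mach_sqr gamma (pres U) (velx U) (vely U) (dens U).
Proof.
intros Hg Hp Hr H. unfold supersonic in H. rewrite mach_mach_sqr in H by assumption.
apply Rnot_le_lt; intros Hle. apply sqrt_le_1_alt in Hle. rewrite sqrt_1 in Hle. lra.
Qed.

Lemma subsonic_mach_sqr gamma U : 1 < gamma -> 0 < pres U -> 0 < dens U -> subsonic gamma U ->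
  mach_sqr gamma (pres U) (velx U) (vely U) (dens U) < 1.
Proof.
intros Hg Hp Hr H. unfold subsonic in H. rewrite mach_mach_sqr in H by assumption.
apply Rnot_le_lt; intros Hle. apply sqrt_le_1_alt in Hle. rewrite sqrt_1 in Hle. lra.
Qed.

(** The pressure [p_plus] belongs to the normal shock. *)
Lemma p_plus_shock gamma p0 u0 rho0 p : 1 < gamma -> 0 < p0 -> 0 < u0 -> 0 < rho0 ->
  p < p_plus gamma p0 u0 rho0 -> (gamma + 1) * p + (gamma - 1) * p0 < 2 * rho0 * u0 ^ 2.
Proof.
intros Hg Hp Hu Hr H. unfold p_plus, mach0 in H.
assert (Hc : 0 < gamma * p0 / rho0) by (apply Rdiv_lt_0_compat; [apply Rmult_lt_0_compat|]; lra).
replace ((u0 / sqrt (gamma * p0 / rho0)) ^ 2) with (u0 ^ 2 * rho0 / (gamma * p0)) in H.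
2:{ unfold Rdiv at 2. rewrite Rpow_mult_distr, pow_inv, pow2_sqrt by lra. field. lra. }
apply (Rmult_lt_compat_l (gamma + 1)) in H; [|lra].
replace ((gamma + 1) * (p0 * (1 + 2 * gamma / (gamma + 1) * (u0 ^ 2 * rho0 / (gamma * p0) - 1))))
  with (2 * rho0 * u0 ^ 2 - (gamma - 1) * p0) in H by (field; lra).
lra.
Qed.

(** Points of the wall are limits of points inside that are equally far out. *)
Lemma pressure_at_infinity_closure theta f Up l :
  front_in_wedge theta f -> continuous_on (closure (Dplus theta f)) (fun z => pres (Up z)) ->
  pressure_at_infinity theta f Up l ->
  forall eps, 0 < eps -> exists K, forall x y, closure (Dplus theta f) (x, y) ->
    K < sqrt (x ^ 2 + y ^ 2) -> Rabs (pres (Up (x, y)) - l) <= eps.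
Proof.
intros H Hc Hinf eps He. destruct (Hinf eps He) as [K HK].
exists (Rabs K). intros x y Hz Hfar. apply Rnot_lt_le; intros Hlt.
assert (Hsq : forall x y, dist2 0 0 (x, y) = x ^ 2 + y ^ 2).
{ intros x' y'. unfold dist2; simpl fst; simpl snd. ring. }
assert (HKp := Rabs_pos K). assert (HKl := Rle_abs K).
assert (HK2 : Rabs K ^ 2 < x ^ 2 + y ^ 2).
{ rewrite <- (pow2_sqrt (x ^ 2 + y ^ 2)) by (generalize (pow2_ge_0 x), (pow2_ge_0 y); lra). nra. }
destruct (continuous_on_eps _ _ x y (Rabs (pres (Up (x, y)) - l) - eps) Hc Hz ltac:(lra)) as (d1 & Hd1 & C1).
destruct (continuous_on_eps (fun _ => True) (dist2 0 0) x y (x ^ 2 + y ^ 2 - Rabs K ^ 2)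
  (continuous_on_dist2 _ _ _) I ltac:(lra)) as (d2 & Hd2 & C2).
destruct (closure_near _ x y (Rmin d1 d2) Hz) as (x' & y' & HA & Hx & Hy); [now apply Rmin_pos|].
Rmin_facts.
specialize (C1 x' y' (subset_closure _ _ HA) ltac:(lra) ltac:(lra)). cbv beta in C1.
specialize (C2 x' y' I ltac:(lra) ltac:(lra)). rewrite !Hsq in C2. apply Rabs_def2 in C2.
assert (Hfar' : K < sqrt (x' ^ 2 + y' ^ 2)).
{ apply Rle_lt_trans with (Rabs K); [exact HKl|]. rewrite <- (sqrt_pow2 (Rabs K)) by lra.
  apply sqrt_lt_1_alt. split; [apply pow2_ge_0|lra]. }
specialize (HK x' y' (or_introl HA) Hfar').
assert (Rabs (pres (Up (x, y)) - l) <= Rabs (pres (Up (x', y')) - pres (Up (x, y))) + Rabs (pres (Up (x', y')) - l)).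
{ replace (pres (Up (x, y)) - l) with (- (pres (Up (x', y')) - pres (Up (x, y))) + (pres (Up (x', y')) - l)) by ring.
  eapply Rle_trans; [apply Rabs_triang|]. rewrite Rabs_Ropp. lra. }
lra.
Qed.

Lemma state_ext U p u v r : pres U = p -> velx U = u -> vely U = v -> dens U = r -> U = mkState p u v r.
Proof. destruct U; simpl; intros; subst; reflexivity. Qed.

Lemma transonic_shock_unique gamma p0 u0 rho0 theta pbar f Um Up :
  1 < gamma -> 0 < p0 -> 0 < u0 -> 0 < rho0 -> 0 < theta < PI / 2 ->
  p0 < pbar < p_plus gamma p0 u0 rho0 ->
  transonic_shock_solution gamma p0 u0 rho0 theta f Um Up ->
  (forall z, closure (Dplus theta f) z -> 0 < velx (Up z)) ->
  pressure_at_infinity theta f Up pbar ->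
  pres (Up (0, 0)) = pbar ->
  is_special_solution gamma p0 u0 rho0 theta pbar f Um Up.
Proof.
intros Hg Hp0 Hu0 Hr0 Hth Hpbar HT HU Hinf Hcorner.
set (b0 := bernoulli0 gamma p0 u0 rho0).
assert (Hw : front_in_wedge theta f).
{ constructor; [exact Hth|apply (front_regular _ _ _ _ _ _ _ _ HT)|apply (front_origin _ _ _ _ _ _ _ _ HT)
  |apply (front_between _ _ _ _ _ _ _ _ HT)]. }
assert (Ht := fw_tan _ _ Hw).
destruct (smooth_flow_of_euler gamma b0 (Dminus theta f) Um Hg (open_Dminus _ _ Hw) (Dminus_origin _ _)
  (ahead_regular _ _ _ _ _ _ _ _ HT) (ahead_positive _ _ _ _ _ _ _ _ HT) (ahead_euler _ _ _ _ _ _ _ _ HT))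
  as (p1 & u1 & v1 & r1 & HF1 & Ep1 & Eu1 & Ev1 & Er1).
destruct (smooth_flow_of_euler gamma b0 (Dplus theta f) Up Hg (open_Dplus _ _ Hw) (Dplus_origin _ _)
  (behind_regular _ _ _ _ _ _ _ _ HT) (behind_positive _ _ _ _ _ _ _ _ HT) (behind_euler _ _ _ _ _ _ _ _ HT))
  as (p2 & u2 & v2 & r2 & HF2 & Ep2 & Eu2 & Ev2 & Er2).
assert (Hfm : forall y, 0 < y -> closure (Dminus theta f) (f y, y)).
{ intros y Hy. destruct (fw_below _ _ _ Hw Hy). apply (closure_Dminus_iff _ _ _ _ Hw). lra. }
assert (Hfp : forall y, 0 < y -> closure (Dplus theta f) (f y, y)).
{ intros y Hy. apply (front_point_closure _ _ _ Hw Hy). }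
assert (Bm : forall z, closure (Dminus theta f) z -> bernoulli gamma (Um z) = b0).
{ intros z Hz. assert (E := sf_bern HF1 z Hz). rewrite Ep1, Eu1, Ev1, Er1 in E. exact E. }
assert (Bp : forall z, closure (Dplus theta f) z -> bernoulli gamma (Up z) = b0).
{ intros z Hz. assert (E := sf_bern HF2 z Hz). rewrite Ep2, Eu2, Ev2, Er2 in E. exact E. }
assert (HAF : ahead_flow gamma b0 theta f p0 u0 rho0 p1 u1 v1 r1).
{ constructor; auto.
  - intros z Hz. rewrite Ep1, Eu1, Ev1, Er1. destruct (ahead_positive _ _ _ _ _ _ _ _ HT z Hz).
    apply supersonic_mach_sqr; auto. apply (ahead_supersonic _ _ _ _ _ _ _ _ HT z Hz).
  - intros y Hy. rewrite Ep1, Eu1, Ev1, Er1.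
    destruct (ahead_positive _ _ _ _ _ _ _ _ HT _ (Hfm y Hy)). destruct (behind_positive _ _ _ _ _ _ _ _ HT _ (Hfp y Hy)).
    apply (normal_supersonic gamma b0 (Derive f y) (Um (f y, y)) (Up (f y, y))); auto.
    + assert (Hj := pressure_jump _ _ _ _ _ _ _ _ HT y Hy). lra.
    + apply (jump_conditions _ _ _ _ _ _ _ _ HT y Hy).
  - intros y Hy. rewrite Ep1, Eu1, Ev1, Er1. rewrite (entry_data _ _ _ _ _ _ _ _ HT y Hy). simpl. auto. }
assert (HUm : forall z, closure (Dminus theta f) z -> Um z = mkState p0 u0 0 rho0).
{ intros z Hz. destruct (ahead_uniform _ _ _ _ _ _ _ _ _ _ _ HAF z Hz) as (E1 & E2 & E3 & E4).
  rewrite Ep1 in E1. rewrite Eu1 in E2. rewrite Ev1 in E3. rewrite Er1 in E4. now apply state_ext. }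
assert (HBF : behind_flow gamma b0 theta f p0 u0 rho0 pbar p2 u2 v2 r2).
{ constructor; auto.
  - rewrite Eu2. exact HU.
  - intros z Hz. rewrite Ep2, Eu2, Ev2, Er2. destruct (behind_positive _ _ _ _ _ _ _ _ HT z Hz).
    apply subsonic_mach_sqr; auto. apply (behind_subsonic _ _ _ _ _ _ _ _ HT z Hz).
  - intros x Hx. rewrite Eu2, Ev2. apply (slip_condition _ _ _ _ _ _ _ _ HT x Hx).
  - intros y Hy. rewrite Ep2, Eu2, Ev2, Er2.
    assert (Hj := pressure_jump _ _ _ _ _ _ _ _ HT y Hy). rewrite (HUm _ (Hfm y Hy)) in Hj. simpl in Hj.
    assert (HRH := jump_conditions _ _ _ _ _ _ _ _ HT y Hy). rewrite (HUm _ (Hfm y Hy)) in HRH.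
    split; [lra|]. destruct (behind_positive _ _ _ _ _ _ _ _ HT _ (Hfp y Hy)).
    apply (shock_state gamma p0 u0 rho0 (Derive f y) (Up (f y, y))); auto; lra.
  - rewrite Ep2. apply (pressure_at_infinity_closure theta f Up pbar Hw); [|exact Hinf].
    apply (behind_regular _ _ _ _ _ _ _ _ HT).
  - rewrite Ep2. exact Hcorner.
  - split; [lra|]. apply p_plus_shock; auto. lra. }
destruct (behind_uniform _ _ _ _ _ _ _ _ _ _ _ _ HBF) as (k & Hk & Hlin & Hrel & Hst).
exists (PI / 2 - atan k).
assert (Hat := atan_bound k).
assert (Hat0 : 0 < atan k) by (rewrite <- atan_0; now apply atan_increasing).
split; [lra|]. rewrite sin_shift, cos_atan, Rsqr_pow2. split; [|split; [|split]].
- (* both sides are positive with square [((gamma+1) pbar + (gamma-1) p0) / (2 rho0 u0^2)] *)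
  set (N := (gamma + 1) * pbar + (gamma - 1) * p0) in *.
  assert (HN : 0 < N).
  { unfold N. assert (0 < (gamma + 1) * pbar) by (apply Rmult_lt_0_compat; lra).
    assert (0 < (gamma - 1) * p0) by (apply Rmult_lt_0_compat; lra). lra. }
  assert (Hc : 0 < gamma * p0 / rho0) by (apply Rdiv_lt_0_compat; [apply Rmult_lt_0_compat|]; lra).
  assert (Hk2 : 0 < 1 + k ^ 2) by (generalize (pow2_ge_0 k); lra).
  assert (Hin : (gamma + 1) / (2 * gamma) * (pbar / p0 + (gamma - 1) / (gamma + 1)) = N / (2 * gamma * p0)).
  { unfold N. field. lra. }
  rewrite Hin. unfold mach0.
  assert (HNp : 0 < N / (2 * gamma * p0)).
  { apply Rdiv_lt_0_compat; [exact HN|]. apply Rmult_lt_0_compat; lra. }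
  assert (S1 := sqrt_lt_R0 _ Hk2). assert (S2 := sqrt_lt_R0 _ Hc). assert (S3 := sqrt_lt_R0 _ HNp).
  apply Rsqr_inj.
  + apply Rlt_le, Rdiv_lt_0_compat; lra.
  + apply Rlt_le, Rmult_lt_0_compat; [|exact S3]. apply Rdiv_lt_0_compat; [lra|]. now apply Rdiv_lt_0_compat.
  + rewrite !Rsqr_pow2.
    replace ((1 / sqrt (1 + k ^ 2)) ^ 2) with (/ (sqrt (1 + k ^ 2) ^ 2)) by (field; lra).
    replace ((1 / (u0 / sqrt (gamma * p0 / rho0)) * sqrt (N / (2 * gamma * p0))) ^ 2)
      with (sqrt (gamma * p0 / rho0) ^ 2 * sqrt (N / (2 * gamma * p0)) ^ 2 / u0 ^ 2) by (field; lra).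
    rewrite !pow2_sqrt by lra.
    replace (gamma * p0 / rho0 * (N / (2 * gamma * p0)) / u0 ^ 2) with (N / (2 * rho0 * u0 ^ 2)) by (field; lra).
    rewrite Hrel. field. lra.
- intros y Hy. rewrite (Hlin y Hy). unfold cot. rewrite cos_shift, sin_shift.
  fold (tan (atan k)). rewrite tan_atan. ring.
- exact HUm.
- intros z Hz. destruct (Hst z Hz) as (E1 & E2 & E3 & E4).
  rewrite Ep2 in E1. rewrite E2 in E3. rewrite Eu2 in E2. rewrite Ev2 in E3. rewrite Er2 in E4.
  unfold state_behind. now apply state_ext.
Qed.

Theorem theorem2p5 (gamma p0 u0 rho0 theta p_star : R)
    (hgamma : 1 < gamma) (hp0 : 0 < p0) (hu0 : 0 < u0) (hrho0 : 0 < rho0)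
    (hM0 : 1 < mach0 gamma p0 u0 rho0)
    (htheta : 0 < theta < PI / 2)
    (hstar : is_p_star gamma p0 u0 rho0 p_star) :
  (0 < tan theta <= polar gamma p0 u0 rho0 p_star ->
   forall p_strong : R,
   is_p_strong gamma p0 u0 rho0 p_star theta p_strong ->
   forall (f : R -> R) (Um Up : R * R -> state),
   transonic_shock_solution gamma p0 u0 rho0 theta f Um Up ->
   (forall z, closure (Dplus theta f) z -> 0 < velx (Up z)) ->
   pressure_at_infinity theta f Up p_strong ->
   slope (Up (0, 0)) = tan theta ->
   pres (Up (0, 0)) = p_strong ->
   is_special_solution gamma p0 u0 rho0 theta p_strong f Um Up)
  /\
  (forall p_sonic : R,
   is_p_sonic gamma p0 u0 rho0 p_star p_sonic ->
   polar gamma p0 u0 rho0 p_sonic < tan theta < polar gamma p0 u0 rho0 p_star ->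
   forall p_weak : R,
   is_p_weak gamma p0 u0 rho0 p_sonic p_star theta p_weak ->
   forall (f : R -> R) (Um Up : R * R -> state),
   transonic_shock_solution gamma p0 u0 rho0 theta f Um Up ->
   (forall z, closure (Dplus theta f) z -> 0 < velx (Up z)) ->
   pressure_at_infinity theta f Up p_weak ->
   slope (Up (0, 0)) = tan theta ->
   pres (Up (0, 0)) = p_weak ->
   is_special_solution gamma p0 u0 rho0 theta p_weak f Um Up).
Proof.
destruct hstar as [Hstar _]. split.
- intros _ p_strong [Hs _] f Um Up HT HU Hinf _ Hc.
  apply transonic_shock_unique; auto; lra.
- intros p_sonic [Hso _] _ p_weak [Hwk _] f Um Up HT HU Hinf _ Hc.
  apply transonic_shock_unique; auto; lra.
Qed.
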